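(* Let $r\ge 1$. The simplicial map $\mathrm{tc}\colon Sur(r)^{\mathrm D}\to E(r)$ satisfies $$\mathrm{TC}=\mathrm N(\mathrm{tc})\circ\mathrm{EZ}$$ and, for every $r,d\in\mathbb N$ with $r,d\ge1$, induces a weak equivalence $$\mathrm{tc}_d\colon Sur_d(r)^{\mathrm D}\to E_d(r).$$
   Context: Chain complexes are over a fixed commutative unital ground ring. Multisimplicial sets. A $k$-fold multisimplicial set is a functor $X\colon(\triangle^{\times k})^{op}\to\mathsf{Set}$, with sets $X_{n_1,\dots,n_k}$, face maps $d^j_i$ and degeneracies $s^j_i$ in direction $j$. Its normalized chains $\mathrm N(X)$ are freely generated in degree $n$ by non-degenerate $(n_1,\dots,n_k)$-multisimplices with $\sum n_j=n$, with $\partial x=\sum_{j}\sum_{\ell=0}^{n_j}(-1)^{n_1+\dots+n_{j-1}+\ell}d^j_\ell(x)$. The diagonal simplicial set $X^{\mathrm D}$ has $X^{\mathrm D}_m=X_{m,\dots,m}$, $d_i=d^1_i\circ\cdots\circ d^k_i$, $s_i=s^1_i\circ\cdots\circ s^k_i$. Eilenberg--Zilber map. $\mathrm{EZ}\colon\mathrm N(X)\to\mathrm N(X^{\mathrm D})$ is given on $x\in X_{n_1,\dots,n_k}$, $n=n_1+\dots+n_k$, by $\mathrm{EZ}(x)=\sum_\sigma\mathrm{sign}(\sigma)X(\sigma_1,\dots,\sigma_k)(x)$, summed over $(n_1,\dots,n_k)$-shuffles $\sigma\in\mathbb S_n$ (permutations increasing on each of the $k$ consecutive blocks of sizes $n_1,\dots,n_k$),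 where $\sigma_\ell\colon[n]\to[n_\ell]$ sends $j$ to the number of elements $i$ of the $\ell$-th block with $\sigma(i)\le j$. Surjection model. $Sur(r)$ is the $r$-fold multisimplicial set whose $(m_1,\dots,m_r)$-multisimplices are the maps $f\colon\{1,\dots,m+r\}\to\{1,\dots,r\}$, $m=m_1+\dots+m_r$, with $|f^{-1}(\ell)|=m_\ell+1$ for each $\ell$, written as sequences $f(1)\cdots f(m+r)$; $d^\ell_j$ and $s^\ell_j$ respectively remove and double the $(j+1)$-st occurrence of $\ell$. For $i<j$ let $f_{ij}$ be the subsequence of entries equal to $i$ or $j$. $Sur_d(r)\subseteq Sur(r)$ consists of those $f$ such that for all $i<j$ the number of positions in $f_{ij}$ at which consecutive entries differ is at most $d$. Thus an $m$-simplex of $Sur(r)^{\mathrm D}$ is a sequence of length $r(m+1)$ in which each $\ell\in\{1,\dots,r\}$ occurs $m+1$ times. Barratt--Eccles simplicial set. $E(r)_n=\mathbb S_r^{\,n+1}$, with faces and degeneracies removing and doubling entries. A permutation $\sigma$ is written as the sequence $\sigma(1)\cdots\sigma(r)$, and $\sigma_{ij}\in\mathbb S_2$ records the order in which $i<j$ occur in it. $E_d(r)\subseteq E(r)$ consists of those $(w_0,\dots,w_n)$ such that for all $i<j$ the number of $\ell$ with $(w_\ell)_{ij}\neq(w_{\ell+1})_{ij}$ is at most $d-1$. The map $\mathrm{tc}$. For $f\in Sur(r)^{\mathrm D}_m$, $\mathrm{tc}(f)=(\sigma_0,\dots,\sigma_m)$, where $\sigma_j$ is the permutation represented by the subsequence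 of $f$ consisting of the $(j+1)$-st occurrence of each $\ell\in\{1,\dots,r\}$; e.g. $\mathrm{tc}(122333112)=(123,231,312)$. Table completion (Berger--Fresse). $\mathrm{TC}\colon\mathrm N\,Sur(r)\to\mathrm N\,E(r)$ is defined as follows. For $f\in Sur(r)_{m_1,\dots,m_r}$, each vertex $v=(v_1,\dots,v_r)$ with $0\le v_\ell\le m_\ell$ of the prism $\triangle^{m_1}\times\cdots\times\triangle^{m_r}$ determines the permutation $f_v\in\mathbb S_r$ represented by the subsequence of $f$ consisting, for each $\ell$, of the $(v_\ell+1)$-st occurrence of $\ell$. Then $\mathrm{TC}(f)=\sum_\gamma\pm(f_{\gamma(0)},\dots,f_{\gamma(m)})$, summed over all maximal lattice paths $\gamma$ from $(0,\dots,0)$ to $(m_1,\dots,m_r)$ (each step raising exactly one coordinate by $1$), i.e. over the maximal simplices of the prism, the sign being that of the $(m_1,\dots,m_r)$-shuffle $\sigma$ encoding $\gamma$ ($\sigma$ sends the $i$-th element of the $\ell$-th block to the position of the $i$-th step of $\gamma$ in direction $\ell$). A weak equivalence of simplicial sets is a map whose geometric realization is a (weak) homotopy equivalence. *)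

(* Defs.v *)
From HB Require Import structures.
From mathcomp Require Import all_boot all_order all_algebra all_fingroup finmap.
From mathcomp Require Import generic_quotient zify.
From mathcomp Require Import all_classical all_reals all_analysis.
(* [monalg] (free modules [malg T K]) is imported without its notations: they
   conflict with those of MathComp-Analysis. *)
From mathcomp.multinomials Require Import -(notations) monalg.
From Stdlib Require Import Relations.Relation_Operators.

Set Implicit Arguments.
Unset Strict Implicit.
Unset Printing Implicit Defensive.

Import Order.TTheory GRing.Theory Num.Theory numFieldNormedType.Exports.

Local Open Scope ring_scope.

(* [n] is 'I_n.+1 *)
Record dmap (m n : nat) := DMap {
  dfun :> {ffun 'I_m.+1 -> 'I_n.+1};
  dmap_homoP : [forall i : 'I_m.+1, forall j : 'I_m.+1,
    (i <= j)%N ==> (dfun i <= dfun j)%N] }.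

HB.instance Definition _ m n := [isSub for @dfun m n].
HB.instance Definition _ m n := [Finite of dmap m n by <:].

Lemma dmap_homo m n (a : dmap m n) (i j : 'I_m.+1) :
  (i <= j)%N -> (a i <= a j)%N.
Proof. by case: a => a /= /forallP/(_ i)/forallP/(_ j)/implyP; apply. Qed.

Lemma mkdmap_subproof m n (f : 'I_m.+1 -> 'I_n.+1) :
  (forall i j : 'I_m.+1, (i <= j)%N -> (f i <= f j)%N) ->
  [forall i : 'I_m.+1, forall j : 'I_m.+1,
    (i <= j)%N ==> (finfun f i <= finfun f j)%N].
Proof.
by move=> h; apply/forallP => i; apply/forallP => j; apply/implyP; rewrite !ffunE; exact: h.
Qed.

Definition mkdmap m n (f : 'I_m.+1 -> 'I_n.+1)
    (h : forall i j : 'I_m.+1, (i <= j)%N -> (f i <= f j)%N) : dmap m n :=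
  DMap (mkdmap_subproof h).

Definition did n : dmap n n := @mkdmap n n id (fun _ _ h => h).

Definition dcomp m n p (b : dmap n p) (a : dmap m n) : dmap m p :=
  @mkdmap m p (fun i => b (a i)) (fun _ _ h => dmap_homo b (dmap_homo a h)).

Lemma codeg_subproof (b : bool) n (i : nat) (s t : 'I_(b + n).+1) :
  (s <= t)%N ->
  ((inord (minn n (s - (b && (i < s)))) : 'I_n.+1) <=
   (inord (minn n (t - (b && (i < t)))) : 'I_n.+1))%N.
Proof.
move=> st; rewrite !inordK ?ltnS ?geq_minl // leq_min geq_minl geq_min /=.
by apply/orP; right; case: b s t st => /= s t; [case: (ltnP i s); case: (ltnP i t) => /=|]; lia.
Qed.

(* For b = true and i <= n, the i-th codegeneracy [n+1] -> [n], hitting i twice;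
   for b = false, the identity of [n].  The minimum plays no role for i <= n. *)
Definition codeg (b : bool) n (i : nat) : dmap (b + n) n :=
  mkdmap (@codeg_subproof b n i).

Record msset (k : nat) := MSSet {
  msimp :> ('I_k -> nat) -> choiceType;
  mop : forall m n : 'I_k -> nat,
    (forall l, dmap (m l) (n l)) -> msimp n -> msimp m;
  mop_id : forall n (x : msimp n), mop (fun l => did (n l)) x = x;
  mop_comp : forall m n p (b : forall l, dmap (n l) (p l))
      (a : forall l, dmap (m l) (n l)) (x : msimp p),
    mop (fun l => dcomp (b l) (a l)) x = mop a (mop b x) }.

Record sset := SSet {
  ssimp :> nat -> choiceType;
  sop : forall m n : nat, dmap m n -> ssimp n -> ssimp m;
  sop_id : forall n (x : ssimp n), sop (did n) x = x;
  sop_comp : forall m n p (b : dmap n p) (a : dmap m n) (x : ssimp p),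
    sop (dcomp b a) x = sop a (sop b x) }.

Record smap (X Y : sset) := SMap {
  sfun :> forall n, X n -> Y n;
  sfun_nat : forall m n (a : dmap m n) (x : X n),
    sfun (sop a x) = sop a (sfun x) }.

Definition diag k (X : msset k) : sset :=
  @SSet (fun n => X (fun _ => n)) (fun m n a => @mop k X _ _ (fun _ => a))
    (fun n => @mop_id k X (fun _ => n))
    (fun m n p b a => @mop_comp k X _ _ _ (fun _ => b) (fun _ => a)).

Section SubMsset.
Variables (k : nat) (X : msset k) (P : forall n, pred (X n)).
Hypothesis PX : forall m n (a : forall l, dmap (m l) (n l)) (x : X n),
  P x -> P (mop a x).

Definition sub_mop m n (a : forall l, dmap (m l) (n l)) (x : {x : X n | P x}) :
  {x : X m | P x} := Sub (mop a (val x)) (PX a (valP x)).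

Lemma sub_mop_id n (x : {x : X n | P x}) : sub_mop (fun l => did (n l)) x = x.
Proof. by apply: val_inj; exact: mop_id. Qed.

Lemma sub_mop_comp m n p (b : forall l, dmap (n l) (p l))
    (a : forall l, dmap (m l) (n l)) (x : {x : X p | P x}) :
  sub_mop (fun l => dcomp (b l) (a l)) x = sub_mop a (sub_mop b x).
Proof. by apply: val_inj; exact: mop_comp. Qed.

Definition sub_msset : msset k :=
  @MSSet k (fun n => {x : X n | P x}) sub_mop sub_mop_id sub_mop_comp.
End SubMsset.

Section SubSset.
Variables (X : sset) (P : forall n, pred (X n)).
Hypothesis PX : forall m n (a : dmap m n) (x : X n), P x -> P (sop a x).

Definition sub_sop m n (a : dmap m n) (x : {x : X n | P x}) :
  {x : X m | P x} := Sub (sop a (val x)) (PX a (valP x)).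

Lemma sub_sop_id n (x : {x : X n | P x}) : sub_sop (did n) x = x.
Proof. by apply: val_inj; exact: sop_id. Qed.

Lemma sub_sop_comp m n p (b : dmap n p) (a : dmap m n) (x : {x : X p | P x}) :
  sub_sop (dcomp b a) x = sub_sop a (sub_sop b x).
Proof. by apply: val_inj; exact: sop_comp. Qed.

Definition sub_sset : sset :=
  @SSet (fun n => {x : X n | P x}) sub_sop sub_sop_id sub_sop_comp.
End SubSset.

(* The source of the degeneracy s^j_i is the multi-index m, its target
   m + e_j. *)
Definition mdegenerate k (X : msset k) (x : {n : 'I_k -> nat & X n}) : Prop :=
  exists (m : 'I_k -> nat) (j : 'I_k) (i : 'I_(m j).+1) (y : X m),
    x = Tagged (fun n => X n) (mop (fun l => codeg (l == j) (m l) i) y).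

Definition sdegenerate (X : sset) (x : {n : nat & X n}) : Prop :=
  exists (m : nat) (i : 'I_m.+1) (y : X m),
    x = Tagged (fun n => X n) (sop (codeg true m i) y).

(* The free K-module on the elements of T outside D.  Below T is the set of
   all simplices, of all degrees, and D the set of degenerate ones: this is the
   total module of the complex N(X).  The differential is not needed, since
   an equality of chain maps is an equality of the underlying linear maps. *)
Definition nchains (K : comNzRingType) (T : choiceType) (D : T -> Prop) :
  lmodType K := malg {x : T | `[< ~ D x >]} K.

(* the class of a simplex: a basis element, or 0 if it is degenerate *)
Definition nclass (K : comNzRingType) (T : choiceType) (D : T -> Prop) (x : T) :
    nchains K D :=
  if insub x is Some y then mkmalgU y 1 else 0.

Definition linext (K : comNzRingType) (T : choiceType) (D : T -> Prop)
    (V : lmodType K) (F : T -> V) (c : nchains K D) : V :=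
  \sum_(x <- msupp c) mcoeff x c *: F (val x).

Definition mN (K : comNzRingType) k (X : msset k) : lmodType K :=
  nchains K (@mdegenerate k X).

Definition sN (K : comNzRingType) (X : sset) : lmodType K :=
  nchains K (@sdegenerate X).

Definition sclass (K : comNzRingType) (X : sset) n (x : X n) : sN K X :=
  nclass K (@sdegenerate X) (Tagged (fun n => X n) x).

Definition Nmap (K : comNzRingType) (X Y : sset) (f : smap X Y) :
    sN K X -> sN K Y :=
  linext (fun x => sclass K (f _ (tagged x))).

Section Blocks.
Variables (k : nat) (n : 'I_k -> nat).

Definition tdim : nat := (\sum_(l < k) n l)%N.

Definition offset (l : 'I_k) : nat := (\sum_(j < k | (j < l)%N) n j)%N.

(* {0, ..., tdim - 1} is cut in k consecutive blocks, of sizes n 0, n 1, ... *)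
Definition in_block (l : 'I_k) (i : 'I_tdim) : bool :=
  (offset l <= i < offset l + n l)%N.

Definition shuffle (s : 'S_tdim) : bool :=
  [forall l, forall a, forall b,
    [&& in_block l a, in_block l b & (a < b)%N] ==> (s a < s b)%N].

Lemma shuffle_comp_subproof (s : 'S_tdim) (l : 'I_k) (i j : 'I_tdim.+1) :
  (i <= j)%N ->
  ((inord #|[pred b | in_block l b & (s b < i)%N]| : 'I_(n l).+1) <=
   (inord #|[pred b | in_block l b & (s b < j)%N]| : 'I_(n l).+1))%N.
Proof.
have bound (j' : nat) : (#|[pred b | in_block l b & (s b < j')%N]| <= n l)%N.
  rewrite -(size_iota (offset l) (n l)) cardE -(size_map val).
  apply: uniq_leq_size; first by rewrite (map_inj_uniq val_inj) enum_uniq.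
  by move=> x /mapP[b]; rewrite mem_enum inE mem_iota => /andP[h _] ->.
move=> ij; rewrite !inordK ?ltnS ?bound //; apply: subset_leq_card.
by apply/fintype.subsetP => b; rewrite !inE => /andP[-> /leq_trans h]; exact: h.
Qed.

(* The map [tdim n] -> [n l]; elements of 'S_(tdim n) are permutations of
   {0, ..., tdim - 1}, whence s b < j where indexing from 1 would give
   s b <= j. *)
Definition shuffle_comp (s : 'S_tdim) (l : 'I_k) : dmap tdim (n l) :=
  mkdmap (@shuffle_comp_subproof s l).
End Blocks.

Definition EZ_basis (K : comNzRingType) k (X : msset k)
    (x : {n : 'I_k -> nat & X n}) : sN K (diag X) :=
  \sum_(s : 'S_(tdim (tag x)) | shuffle s)
    (-1) ^+ s *: @sclass K (diag X) (tdim (tag x))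
                   (mop (shuffle_comp s) (tagged x)).

Definition EZ (K : comNzRingType) k (X : msset k) : mN K X -> sN K (diag X) :=
  linext (@EZ_basis K k X).

Definition fiber m n (a : dmap m n) (j : nat) : nat :=
  #|[pred t | a t == j :> nat]|.

Section Sequences.
Variable r : nat.
Implicit Types f s : seq 'I_r.

Fixpoint labels_from s f : seq ('I_r * nat) :=
  if f is l :: f' then (l, count_mem l s) :: labels_from (l :: s) f' else [::].

(* f with each entry l decorated by j if it is the (j+1)-st occurrence of l *)
Definition labels f := labels_from [::] f.

(* The (j+1)-st occurrence of l is replaced by as many copies of l as there are
   elements over j; cofaces remove an occurrence, codegeneracies double one. *)
Definition sur_act (m n : 'I_r -> nat) (a : forall l, dmap (m l) (n l)) f :=
  flatten [seq nseq (fiber (a p.1) p.2) p.1 | p <- labels f].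

(* the subsequence of the (v l + 1)-st occurrence of each l *)
Definition vertex_seq (v : 'I_r -> nat) f : seq 'I_r :=
  [seq p.1 | p <- labels f & p.2 == v p.1].

(* The permutation s with s 0, s 1, ... equal to f; the default value is only
   used when f is not a permutation of the letters. *)
Definition perm_of_seq f : 'S_r :=
  odflt 1%g [pick s : 'S_r | codom s == f].

Lemma codom_perm_of_seq f : uniq f -> size f = r -> codom (perm_of_seq f) = f.
Proof.
move=> uf sf; rewrite /perm_of_seq; case: pickP => [s /eqP //|].
pose h := tnth (tcast sf (in_tuple f)).
have vh : codom h = f.
  by rewrite codomE /h map_tnth_enum val_tcast.
have ih : injective h by apply/injectiveP; rewrite /injectiveb /dinjectiveb -codomE vh.
move/(_ (perm ih)); rewrite (_ : codom _ = f) ?eqxx //.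
by rewrite -vh !codomE; apply: eq_map => i; rewrite permE.
Qed.
End Sequences.

Definition changes (T : eqType) (s : seq T) : nat :=
  count (fun p => p.1 != p.2) (zip s (behead s)).

Section SurAction.
Variable r : nat.
Implicit Types f g s : seq 'I_r.

Definition below m n (a : dmap m n) j := #|[pred t | (a t < j)%N]|.

Lemma below0 m n (a : dmap m n) : below a 0 = 0%N.
Proof. by rewrite /below eq_card0. Qed.

Lemma belowS m n (a : dmap m n) j : below a j.+1 = (below a j + fiber a j)%N.
Proof.
rewrite /below /fiber -cardUI [X in _ = (_ + X)%N]eq_card0 ?addn0; last first.
  by move=> t; rewrite !inE; case: ltngtP.
by apply: eq_card => t; rewrite !inE ltnS leq_eqVlt orbC.
Qed.

Lemma below_all m n (a : dmap m n) j : (n < j)%N -> below a j = m.+1.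
Proof.
move=> nj; rewrite /below -[RHS](card_ord m.+1); apply: eq_card => t.
by rewrite !inE (leq_trans (ltn_ord _) nj).
Qed.

Lemma below_lt m n (a : dmap m n) j (t : 'I_m.+1) :
  (t < below a j)%N = (a t < j)%N.
Proof.
have cI q : (q <= m.+1)%N -> #|[pred u : 'I_m.+1 | (u < q)%N]| = q.
  move=> qm; have inj : injective (widen_ord qm).
    by move=> x y /(congr1 val) /= xy; apply: val_inj.
  rewrite -{2}(card_ord q) -(card_imset _ inj).
  apply: eq_card => u; rewrite !inE; apply/idP/imsetP => [uq|[v _ ->]] //=.
  by exists (Ordinal uq) => //; apply: val_inj.
case: (ltnP (a t) j) => h.
  rewrite -[X in (X <= _)%N]cI //; apply: subset_leq_card.
  apply/fintype.subsetP => u; rewrite !inE ltnS => /(dmap_homo a) => k.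
  exact: leq_ltn_trans k h.
apply/negbTE; rewrite -leqNgt -[X in (_ <= X)%N]cI ?(ltnW (ltn_ord _)) //.
apply: subset_leq_card; apply/fintype.subsetP => u; rewrite !inE => k.
rewrite ltnNge; apply/negP => /(dmap_homo a) l.
by have := leq_trans (leq_ltn_trans l k) h; rewrite ltnn.
Qed.

Lemma mem_fiber m n (a : dmap m n) j (t : 'I_m.+1) :
  (val t \in iota (below a j) (fiber a j)) = (a t == j :> nat).
Proof.
by rewrite mem_iota -belowS leqNgt !below_lt ltnS -leqNgt eqn_leq andbC.
Qed.

Lemma sum_card_eq (T : finType) (h : T -> nat) (s : seq nat) : uniq s ->
  (\sum_(t <- s) #|[pred u | h u == t]|)%N = #|[pred u | h u \in s]|.
Proof.
elim: s => [|t s IH] /= => [_|/andP[ts us]].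
  by rewrite big_nil eq_card0.
rewrite big_cons IH // -cardUI [X in (_ + X)%N]eq_card0 ?addn0; last first.
  by move=> u; rewrite !inE; case: eqP => //= ->; rewrite (negbTE ts).
by apply: eq_card => u; rewrite !inE.
Qed.

Lemma fiber_comp m n p (b : dmap n p) (a : dmap m n) j :
  fiber (dcomp b a) j = (\sum_(t <- iota (below b j) (fiber b j)) fiber a t)%N.
Proof.
rewrite sum_card_eq ?iota_uniq //; apply: eq_card => u.
by rewrite !inE mem_fiber ffunE.
Qed.

Lemma fiber_did n j : fiber (did n) j = (j < n.+1)%N.
Proof.
case: (ltnP j n.+1) => h.
  rewrite /= -(card1 (Ordinal h)); apply: eq_card => t.
  by rewrite !inE ffunE.
rewrite /fiber eq_card0 // => t; rewrite !inE ffunE; apply/negbTE.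
by rewrite neq_ltn (leq_trans (ltn_ord _) h).
Qed.

Lemma labels_from_ext s s' f : (forall l, count_mem l s = count_mem l s') ->
  labels_from s f = labels_from s' f.
Proof.
elim: f s s' => //= l f IH s s' h; rewrite h; congr cons.
by apply: IH => i /=; rewrite h.
Qed.

Lemma labels_from_nseq s q l g : labels_from s (nseq q l ++ g) =
  [seq (l, t) | t <- iota (count_mem l s) q] ++ labels_from (nseq q l ++ s) g.
Proof.
elim: q s => //= q IH s; rewrite IH /= eqxx add1n; congr (_ :: (_ ++ _)).
by apply: labels_from_ext => i /=; rewrite !count_cat /= addnCA.
Qed.

Lemma labels_from_bound s f p : p \in labels_from s f ->
  (p.2 < count_mem p.1 s + count_mem p.1 f)%N.
Proof.
elim: f s => //= l f IH s; rewrite inE => /orP[/eqP -> /=|/IH /=].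
  by rewrite eqxx addnCA add1n ltnS leq_addr.
by rewrite addnA [X in (_ < X + _)%N]addnC.
Qed.

Lemma labels_fst f : [seq p.1 | p <- labels f] = f.
Proof. by rewrite /labels; elim: f [::] => //= l f IH s; rewrite IH. Qed.

Lemma labels_from_act m n (a : forall l, dmap (m l) (n l)) s s' f :
  (forall l, count_mem l s' = below (a l) (count_mem l s)) ->
  labels_from s'
    (flatten [seq nseq (fiber (a p.1) p.2) p.1 | p <- labels_from s f]) =
  flatten [seq [seq (p.1, t) | t <- iota (below (a p.1) p.2)
                                         (fiber (a p.1) p.2)]
          | p <- labels_from s f].
Proof.
elim: f s s' => //= l f IH s s' h; rewrite labels_from_nseq h; congr (_ ++ _).
apply: IH => i; rewrite count_cat h count_nseq /=.
by case: eqP => [->|_]; rewrite ?mul0n // mul1n add1n belowS addnC.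
Qed.

Lemma labels_act m n (a : forall l, dmap (m l) (n l)) f :
  labels (sur_act a f) =
  flatten [seq [seq (p.1, t) | t <- iota (below (a p.1) p.2)
                                         (fiber (a p.1) p.2)] | p <- labels f].
Proof. by rewrite /labels labels_from_act // => l; rewrite below0. Qed.

Lemma sur_act_comp m n p (b : forall l, dmap (n l) (p l))
    (a : forall l, dmap (m l) (n l)) f :
  sur_act (fun l => dcomp (b l) (a l)) f = sur_act a (sur_act b f).
Proof.
rewrite {2}/sur_act labels_act map_flatten -map_comp /sur_act.
elim: (labels f) => //= q s ->; rewrite flatten_cat; congr (_ ++ _).
rewrite fiber_comp -map_comp.
elim: (iota _ _) => [|t u IH] /=; first by rewrite big_nil.
by rewrite big_cons nseqD -IH.
Qed.

Lemma sur_act_id (n : 'I_r -> nat) f :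
  (forall l, count_mem l f = (n l).+1) -> sur_act (fun l => did (n l)) f = f.
Proof.
move=> cf; rewrite -{2}(labels_fst f) /sur_act.
have : {in labels f, forall p, p.2 < (n p.1).+1}%N.
  by move=> p /labels_from_bound /=; rewrite cf.
elim: (labels f) => //= p s IH h; rewrite fiber_did h ?mem_head //=.
by rewrite IH // => q qs; apply: h; rewrite inE qs orbT.
Qed.

Lemma count_sur_act m n (a : forall l, dmap (m l) (n l)) f l :
  count_mem l (sur_act a f) = below (a l) (count_mem l f).
Proof.
suff H s : (below (a l) (count_mem l s) + count_mem l
  (flatten [seq nseq (fiber (a p.1) p.2) p.1 | p <- labels_from s f]))%N =
  below (a l) (count_mem l s + count_mem l f)%N.
  by have := H [::]; rewrite /= below0 !add0n.
elim: f s => [|i f IH] s /=; first by rewrite !addn0.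
have IHi := IH (i :: s); rewrite /= in IHi.
rewrite count_cat count_nseq addnA [in RHS]addnCA [in RHS]addnA -IHi.
congr (_ + _)%N.
rewrite /=; case: (eqVneq i l) => [->|_] /=; last by rewrite mul0n addn0.
by rewrite mul1n add1n belowS.
Qed.

Lemma vertex_seq_act m n (a : forall l, dmap (m l) (n l))
    (v : forall l, 'I_(m l).+1) f :
  vertex_seq (fun l => v l) (sur_act a f) =
  vertex_seq (fun l => a l (v l)) f.
Proof.
rewrite /vertex_seq labels_act; elim: (labels f) => //= p s IH.
rewrite filter_cat map_cat IH filter_map -map_comp.
rewrite (@eq_filter _ _ (pred1 (val (v p.1)))) //.
rewrite -[p.2 == _]eq_sym -mem_fiber.
set u := iota _ _; have : uniq u by exact: iota_uniq.
case: ifP => vu uu; first by rewrite filter_pred1_uniq.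
rewrite (@eq_in_filter _ _ pred0) ?filter_pred0 // => t tu /=.
by apply: contraFF vu => /eqP e; rewrite e in tu.
Qed.
End SurAction.

Lemma changes_cons2 (T : eqType) (x y : T) s :
  changes (x :: y :: s) = ((x != y) + changes (y :: s))%N.
Proof. by []. Qed.

Lemma changes_le_cons (T : eqType) (x y : T) s :
  (changes (x :: s) <= (x != y) + changes (y :: s))%N.
Proof.
case: s => [|z s] //; rewrite !changes_cons2 addnA leq_add2r.
by case: (eqVneq x z) => // xz; case: (eqVneq x y) => //= <-; rewrite xz.
Qed.

Lemma changes_nseq (T : eqType) q (x : T) s :
  changes (x :: nseq q x ++ s) = changes (x :: s).
Proof. by elim: q => //= q IH; rewrite changes_cons2 eqxx IH. Qed.

Lemma changes_flatten (T U : eqType) (c : U -> nat) (h : U -> T) (s : seq U) :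
  (changes (flatten [seq nseq (c u) (h u) | u <- s]) <= changes (map h s))%N.
Proof.
have H x t : (changes (x :: flatten [seq nseq (c u) (h u) | u <- t]) <=
              changes (x :: map h t))%N.
  elim: t x => //= u t IH x; rewrite changes_cons2.
  case: (c u) => [|q] /=; last by rewrite changes_cons2 changes_nseq leq_add2l.
  exact: leq_trans (changes_le_cons _ (h u) _) (leq_add (leqnn _) (IH _)).
elim: s => //= u s IH; case: (c u) => [|q] /=; last by rewrite changes_nseq.
apply: leq_trans IH _.
by case: (map h s) => // z t; rewrite changes_cons2 leq_addl.
Qed.

Definition sur_pred r (m : 'I_r -> nat) (f : seq 'I_r) : bool :=
  [forall l, count_mem l f == (m l).+1].

(* The sequences have the right length: it is forced to be r plus the sum of
   the m l. *)
Definition sur_simp r (m : 'I_r -> nat) : choiceType :=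
  {f : seq 'I_r | sur_pred m f}.

Section Sur.
Variable r : nat.

Lemma sur_mop_subproof m n (a : forall l : 'I_r, dmap (m l) (n l))
    (f : sur_simp n) : sur_pred m (sur_act a (val f)).
Proof.
apply/forallP => l; rewrite count_sur_act.
by rewrite (eqP (forallP (valP f) l)) below_all.
Qed.

Definition sur_mop m n (a : forall l : 'I_r, dmap (m l) (n l))
    (f : sur_simp n) : sur_simp m := Sub _ (sur_mop_subproof a f).

Lemma sur_mop_id n (f : sur_simp n) : sur_mop (fun l => did (n l)) f = f.
Proof.
apply: val_inj; apply: sur_act_id => l; exact: (eqP (forallP (valP f) l)).
Qed.

Lemma sur_mop_comp m n p (b : forall l : 'I_r, dmap (n l) (p l))
    (a : forall l, dmap (m l) (n l)) (f : sur_simp p) :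
  sur_mop (fun l => dcomp (b l) (a l)) f = sur_mop a (sur_mop b f).
Proof. by apply: val_inj; exact: sur_act_comp. Qed.

Definition Sur : msset r := MSSet sur_mop_id sur_mop_comp.

Definition sur_le (d : nat) (m : 'I_r -> nat) (f : Sur m) : bool :=
  [forall i : 'I_r, forall j : 'I_r, (i < j)%N ==>
    (changes [seq l <- val f | (l == i) || (l == j)] <= d)%N].

Lemma sur_le_mop d m n (a : forall l, dmap (m l) (n l)) (f : Sur n) :
  sur_le d f -> sur_le d (mop a f).
Proof.
move=> /forallP h; apply/forallP => i; apply/forallP => j; apply/implyP => ij.
have /forallP/(_ j)/implyP/(_ ij) := h i; apply: leq_trans => /=.
set P := fun l => _; rewrite -[X in (_ <= changes (seq.filter _ X))%N]labels_fst.
rewrite filter_map /sur_act; set t := labels _.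
rewrite (_ : seq.filter P _ = flatten [seq nseq (fiber (a p.1) p.2) p.1
    | p <- seq.filter (preim fst P) t]); first exact: changes_flatten.
elim: t => //= p t IH; rewrite filter_cat filter_nseq IH.
by case: (P p.1); rewrite ?mul1n ?mul0n.
Qed.

Definition Surd (d : nat) : msset r :=
  sub_msset (fun m n a (x : Sur n) => @sur_le_mop d m n a x).
End Sur.

Lemma map_enum_dmap m n (a : dmap m n) (T : Type) (h : 'I_n.+1 -> T) :
  [seq h (a t) | t <- enum 'I_m.+1] =
  flatten [seq nseq (fiber a u) (h u) | u : 'I_n.+1 <- enum 'I_n.+1].
Proof.
have constE (U : Type) (x : U) i q : [seq x | _ <- iota i q] = nseq q x.
  by elim: q i => //= q IH i; rewrite IH.
have inordE q (U : Type) (F : 'I_q.+1 -> U) :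
    [seq F t | t <- enum 'I_q.+1] = [seq F (inord t) | t <- iota 0 q.+1].
  by rewrite -val_enum_ord -map_comp; apply: eq_map => t /=; rewrite inord_val.
have iotaE q : iota 0 (below a q) =
    flatten [seq iota (below a j) (fiber a j) | j <- iota 0 q].
  elim: q => [|q IH]; first by rewrite below0.
  rewrite belowS iotaD IH -[in RHS]addn1 iotaD map_cat flatten_cat /=.
  by rewrite cats0.
rewrite (inordE m) (inordE n).
have -> : iota 0 m.+1 = iota 0 (below a n.+1) by rewrite below_all.
rewrite iotaE map_flatten -map_comp.
congr flatten; apply/eq_in_map => j; rewrite mem_iota /= add0n => jn.
rewrite inordK // -(constE _ _ (below a j)) /=.
apply/eq_in_map => t; rewrite mem_iota => tj.
have tm : (t < m.+1)%N.
  case/andP: tj => _; rewrite -belowS => /leq_trans; apply.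
  by rewrite -[X in (_ <= X)%N](card_ord m.+1) max_card.
congr h; apply: val_inj; rewrite /= (inordK jn); apply/eqP.
by rewrite -mem_fiber /= inordK // mem_iota.
Qed.

Section BarrattEccles.
Variable r : nat.

Definition be_op m n (a : dmap m n) (w : {ffun 'I_n.+1 -> 'S_r}) :
  {ffun 'I_m.+1 -> 'S_r} := [ffun t => w (a t)].

Lemma be_op_id n (w : {ffun 'I_n.+1 -> 'S_r}) : be_op (did n) w = w.
Proof. by apply/ffunP => t; rewrite !ffunE. Qed.

Lemma be_op_comp m n p (b : dmap n p) (a : dmap m n)
    (w : {ffun 'I_p.+1 -> 'S_r}) : be_op (dcomp b a) w = be_op a (be_op b w).
Proof. by apply/ffunP => t; rewrite !ffunE. Qed.

Definition BE : sset :=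
  @SSet (fun n => {ffun 'I_n.+1 -> 'S_r}) be_op be_op_id be_op_comp.

(* i occurs before j in the sequence s(1) ... s(r); for i < j this boolean
   encodes the permutation s_ij of two letters *)
Definition before (s : 'S_r) (i j : 'I_r) : bool := ((s^-1)%g i < (s^-1)%g j)%N.

Definition be_le (d n : nat) (w : BE n) : bool :=
  [forall i : 'I_r, forall j : 'I_r, (i < j)%N ==>
    (changes [seq before (w t) i j | t <- enum 'I_n.+1] <= d.-1)%N].

Lemma be_le_op d m n (a : dmap m n) (w : BE n) :
  be_le d w -> be_le d (sop a w).
Proof.
move=> /forallP h; apply/forallP => i; apply/forallP => j; apply/implyP => ij.
have /forallP/(_ j)/implyP/(_ ij) := h i; apply: leq_trans => /=.
rewrite (eq_map (g := fun t => before (w (a t)) i j)) => [|t]; last by rewrite ffunE.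
by rewrite (map_enum_dmap a (fun t => before (w t) i j)); exact: changes_flatten.
Qed.

Definition BEd (d : nat) : sset :=
  sub_sset (fun m n a (x : BE n) => @be_le_op d m n a x).
End BarrattEccles.

Section TableCompletion.
Variable r : nat.

Definition tc_fun (m : nat) (f : diag (Sur r) m) : BE r m :=
  [ffun t : 'I_m.+1 => perm_of_seq (vertex_seq (fun _ => t) (val f))].

Lemma tc_nat m n (a : dmap m n) (f : diag (Sur r) n) :
  tc_fun (sop a f) = sop a (tc_fun f).
Proof.
apply/ffunP => t; rewrite !ffunE /=; congr perm_of_seq.
exact: (@vertex_seq_act r (fun=> m) (fun=> n) (fun=> a) (fun=> t)).
Qed.

Definition tc : smap (diag (Sur r)) (BE r) := SMap tc_nat.

Section Paths.
Variable m : 'I_r -> nat.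

(* the vertices of the prism with sides m *)
Definition vertex : finType := {dffun forall l : 'I_r, 'I_(m l).+1}.

(* The step number q of g goes from g q to g (q + 1), q < tdim m. *)
Definition step_src (q : 'I_(tdim m)) : 'I_(tdim m).+1 :=
  widen_ord (leqnSn _) q.
Definition step_tgt (q : 'I_(tdim m)) : 'I_(tdim m).+1 := lift ord0 q.

Definition is_path (g : {ffun 'I_(tdim m).+1 -> vertex}) : bool :=
  [&& [forall l, g ord0 l == 0%N :> nat],
      [forall l, g ord_max l == m l :> nat] &
      [forall q : 'I_(tdim m), exists l : 'I_r, forall l' : 'I_r,
        g (step_tgt q) l' == (g (step_src q) l' + (l' == l))%N :> nat]].

(* The element number i of the l-th block is sent by s to the position of the
   step of g which raises the l-th coordinate from i to i + 1. *)
Definition encodes (g : {ffun 'I_(tdim m).+1 -> vertex})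
    (s : 'S_(tdim m)) : bool :=
  [forall l : 'I_r, forall b : 'I_(tdim m), in_block l b ==>
    (g (step_src (s b)) l == (b - offset m l)%N :> nat) &&
    (g (step_tgt (s b)) l == (b - offset m l).+1 :> nat)].

(* Every path is encoded by exactly one permutation, which is a shuffle. *)
Definition path_perm (g : {ffun 'I_(tdim m).+1 -> vertex}) : 'S_(tdim m) :=
  odflt 1%g [pick s | encodes g s].
End Paths.

Definition TC_basis (K : comNzRingType) (x : {m : 'I_r -> nat & Sur r m}) :
    sN K (BE r) :=
  \sum_(g : {ffun 'I_(tdim (tag x)).+1 -> vertex (tag x)} | is_path g)
    (-1) ^+ path_perm g *: @sclass K (BE r) (tdim (tag x))
      [ffun t => perm_of_seq (vertex_seq (fun l => g t l) (val (tagged x)))].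

Definition TC (K : comNzRingType) : mN K (Sur r) -> sN K (BE r) :=
  linext (TC_basis K).
End TableCompletion.

Local Open Scope classical_set_scope.
Local Open Scope quotient_scope.

Section Realization.
Variable R : realType.

Definition splx_set (n : nat) : set 'rV[R]_n.+1 :=
  [set t | (forall i, 0 <= t ord0 i) /\ \sum_i t ord0 i = 1].
Arguments splx_set n : clear implicits.

Definition splx (n : nat) : topologicalType := set_type (splx_set n).

Lemma splx_push_subproof m n (a : dmap m n) (t : splx m) :
  (\row_j \sum_(i | a i == j) set_val t ord0 i) \in splx_set n.
Proof.
have := set_valP t => -[t0 t1]; rewrite inE; split => [j|].
  by rewrite mxE; apply: sumr_ge0 => i _; exact: t0.
rewrite -t1 (partition_big a xpredT) //=.
by apply: eq_bigr => j _; rewrite mxE; apply: eq_bigl.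
Qed.

Definition splx_push m n (a : dmap m n) (t : splx m) : splx n :=
  exist (fun u => u \in splx_set n) _ (splx_push_subproof a t).

Variable X : sset.

(* the disjoint union of the X n x splx n, X n being discrete *)
Definition cells : topologicalType :=
  {x : {n : nat & X n} & splx (tag x)}.

Definition cell n (x : X n) (t : splx n) : cells :=
  existT (fun x : {n : nat & X n} => splx (tag x)) (Tagged (fun n => X n) x) t.

Inductive glue : cells -> cells -> Prop :=
  Glue m n (a : dmap m n) (x : X n) (t : splx m) :
    glue (cell (sop a x) t) (cell x (splx_push a t)).

Definition glue_eq (p q : cells) : bool := `[< clos_refl_sym_trans _ glue p q >].

Lemma glue_eq_refl : reflexive glue_eq.
Proof. by move=> p; apply/asboolP; exact: rst_refl. Qed.

Lemma glue_eq_sym : symmetric glue_eq.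
Proof. by move=> p q; apply/asboolP/asboolP => h; exact: rst_sym. Qed.

Lemma glue_eq_trans : transitive glue_eq.
Proof.
move=> q p s /asboolP pq /asboolP qs; apply/asboolP; exact: rst_trans pq qs.
Qed.

Canonical glue_equiv : equiv_rel cells :=
  EquivRel glue_eq glue_eq_refl glue_eq_sym glue_eq_trans.

Definition realization : topologicalType :=
  quotient_topology {eq_quot glue_equiv}.

Definition to_realization (p : cells) : realization :=
  \pi_(quotient_topology {eq_quot glue_equiv}) p.
Definition of_realization (q : realization) : cells :=
  repr (q : quotient_topology {eq_quot glue_equiv}).

Lemma to_realizationP (p q : cells) :
  to_realization p = to_realization q <-> clos_refl_sym_trans _ glue p q.
Proof.
have E := @eqmodP cells glue_equiv p q.
split=> [h|h]; first by apply/asboolP; exact: (introT E h).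
by have /(elimT E) : glue_equiv p q by apply/asboolP.
Qed.

Lemma of_realizationK : cancel of_realization to_realization.
Proof. exact: reprK. Qed.
End Realization.

Section RealizationMap.
Variables (R : realType) (X Y : sset) (f : smap X Y).

Definition cells_map (p : cells R X) : cells R Y :=
  cell (f _ (tagged (tag p))) (tagged p).

Definition realization_map (q : realization R X) : realization R Y :=
  to_realization (cells_map (of_realization q)).

Lemma realization_mapE (p : cells R X) :
  realization_map (to_realization p) = to_realization (cells_map p).
Proof.
have H (u v : cells R X) : clos_refl_sym_trans _ (@glue R X) u v ->
    clos_refl_sym_trans _ (@glue R Y) (cells_map u) (cells_map v).
  elim=> [_ _ [m n a x t]|u'|u' v' _|u' v' w' _ uv _ vw].
  - by apply: rst_step; rewrite /cells_map /= sfun_nat; exact: Glue.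
  - exact: rst_refl.
  - exact: rst_sym.
  - exact: rst_trans uv vw.
by apply/to_realizationP/H/to_realizationP; rewrite of_realizationK.
Qed.
End RealizationMap.

Definition homotopic (R : realType) (S T : topologicalType) (f g : S -> T) :
    Prop :=
  exists H : S * R -> T,
    {within [set: S] `*` `[0, 1], continuous H} /\
    forall x, H (x, 0) = f x /\ H (x, 1) = g x.

Definition homotopy_equivalence (R : realType) (S T : topologicalType)
    (f : S -> T) : Prop :=
  continuous f /\
  exists g : T -> S,
    [/\ continuous g, homotopic R (g \o f) id & homotopic R (f \o g) id].

Definition weak_equivalence (R : realType) (X Y : sset) (f : smap X Y) : Prop :=
  homotopy_equivalence R (realization_map (R := R) f).

(* Main.v *)
Require Import Defs.
From mathcomp Require Import all_boot all_order all_algebra all_fingroup finmap.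
From mathcomp Require Import zify ring lra.
From mathcomp Require Import all_classical all_reals all_analysis.
From mathcomp.multinomials Require Import -(notations) monalg.
From Stdlib Require Import Relations.Relation_Operators.

(** The identity of chain maps holds term by term. A shuffle and a maximal
    lattice path of the prism are the same thing: at time [t] the path of a
    shuffle is at the vertex with coordinates [shuffle_comp s l t]. After these
    operators have acted on a sequence, the occurrences with number [t] are
    those which had the numbers given by that vertex; so a simplex of the image
    of the Eilenberg-Zilber map is sent to the simplex of the table of the same
    path, and the signs agree ([shuffle_of_path],
    [path_permK], [TC_EZ_basis]).

    For the weak equivalence, a point of the realization of either simplicial
    set is a word with nonnegative weights on its letters. For sequences, the
    letters are those of the alphabet, and the weights of the occurrences of
    each letter have the sum 1; for the Barratt-Eccles set the letters are
    permutations and the sum of all weights is 1. Gluing means that a letter may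
    be cut into equal letters with the same total weight, and that letters of
    weight 0 may be inserted. All of this is remembered, and nothing else, by
    the product of the exponentials of the weighted letters in the ring of
    noncommutative power series ([sig]): its left factors can be recovered one
    by one ([sig_cancel], [sigc_common]). Since the simplicial sets are finite
    in each dimension and every point lies in a simplex of bounded dimension,
    realizations are homeomorphic to their images in a space of power series
    ([real_sig_inj], [real_of_continuous]). There, maps can be written down, and
    their continuity is that of coefficients.

    A permutation acts on weighted sequences by a motion, which moves its
    letters to the front, one after the other; at the end the sequence is the
    permutation ([pull], [tidy]). A point of the realization of permutations
    then acts by a flow, in which its permutations act successively, from the
    last to the first, for a time that depends on its weight relative to those
    of the later ones ([flow]). The last one acts completely, so the result
    does not depend on the sequence with which the flow starts; this is the
    homotopy inverse. Both homotopies cut the weights of a point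
    at a time in the unit interval. The part before it acts on the normalized
    part after it, by the flow for sequences, and by writing it in front for
    permutations, where the part after it is replaced by its image under the
    composite ([sweep], [homotopy_gf], [homotopy_fg]).

    It remains to see that the complexity stays bounded. For letters [i] and
    [j], the motion of a permutation that moves [i] before [j] does not increase
    the number of changes between them, if the letter [i] is put in front to
    account for the permutation ([pulled_perm_changes]). So the word at the end
    of a flow has at most as many changes as the chain of permutations that
    acts, followed by the initial word. For a simplex of sequences that is cut
    at a vertex, the first letters of the permutations up to the cut, followed
    by the occurrences after it, form a subsequence of the sequence
    ([subseq_late]), whence the bound ([sweep_surd_image], [sweep_be_image]). *)

Set Implicit Arguments.
Unset Strict Implicit.
Unset Printing Implicit Defensive.

Import Order.TTheory GRing.Theory Num.Theory numFieldNormedType.Exports.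

Local Open Scope classical_set_scope.
Local Open Scope ring_scope.

(** * Topological tools *)

Section Topology.

Lemma ptws_cvgP (I : eqType) (V : topologicalType) (T : Type)
    (F : set_system T) (f : T -> {ptws I -> V}) (g : {ptws I -> V}) :
  Filter F -> (forall i, f x i @[x --> F] --> g i) -> f x @[x --> F] --> g.
Proof.
move=> FF fg; apply/cvg_sup => i; apply/cvg_image.
  by rewrite eqEsubset; split=> // y _; exists (fun=> y).
move=> A /fg; rewrite nbhs_simpl /= => FA.
exists [set h : {ptws I -> V} | A (h i)]; first exact: FA.
rewrite eqEsubset; split=> y; first by case=> h ? <-.
by move=> Ay; exists (fun=> y).
Qed.

Lemma ptws_coord_continuous (I : eqType) (V : topologicalType) (i : I) :
  continuous (fun h : {ptws I -> V} => h i).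
Proof. exact: (@proj_continuous I (fun=> V)). Qed.

Lemma ptws_coord_cvg (I : eqType) (V : topologicalType) (T : Type)
    (F : set_system T) (f : T -> {ptws I -> V}) (g : {ptws I -> V}) i :
  Filter F -> f x @[x --> F] --> g -> f x i @[x --> F] --> g i.
Proof. by move=> FF fg; apply: cvg_comp fg (@ptws_coord_continuous _ _ i g). Qed.

Lemma ptws_hausdorff (I : eqType) (V : topologicalType) :
  hausdorff_space V -> hausdorff_space {ptws I -> V}.
Proof. by move=> hV; apply: (@hausdorff_product I (fun=> V)). Qed.

Lemma prod_hausdorff (U V : topologicalType) :
  hausdorff_space U -> hausdorff_space V -> hausdorff_space (U * V)%type.
Proof.
move=> hU hV [p1 p2] [q1 q2] clpq; congr pair.
  apply: hU => A B nA nB.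
  have [] := clpq (A `*` setT) (B `*` setT).
  - by exists (A, setT) => //=; split=> //; exact: filterT.
  - by exists (B, setT) => //=; split=> //; exact: filterT.
  - by case=> u v [[/= ? _] [/= ? _]]; exists u.
apply: hV => A B nA nB.
have [] := clpq (setT `*` A) (setT `*` B).
- by exists (setT, A) => //=; split=> //; exact: filterT.
- by exists (setT, B) => //=; split=> //; exact: filterT.
- by case=> u v [[/= _ ?] [/= _ ?]]; exists v.
Qed.

(** A map out of a Hausdorff space is continuous as soon as it becomes so along
    finitely many maps [p i] with compact sources that jointly cover the
    domain: closed sets are pulled back to compact, hence closed, sets. *)
Lemma continuous_of_compact_cover (I : Type) (s : seq I)
    (B D : topologicalType) (C : I -> topologicalType)
    (K : forall i, set (C i)) (p : forall i, C i -> B) (h : forall i, C i -> D)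
    (phi : B -> D) (A : set B) :
  hausdorff_space B ->
  (forall i, compact (K i)) ->
  (forall i, {within K i, continuous (p i)}) ->
  (forall i, {within K i, continuous (h i)}) ->
  (forall i c, K i c -> h i c = phi (p i c)) ->
  A = \big[setU/set0]_(i <- s) (p i @` K i) ->
  {within A, continuous phi}.
Proof.
move=> hB cK cp ch hphi AE; apply/continuous_closedP => W cW.
apply/closed_subspaceP.
exists (\big[setU/set0]_(i <- s) (p i @` (K i `&` h i @^-1` W))).
  apply: compact_closed => //; apply: bigsetU_compact => i _.
  apply: continuous_compact; first by apply: continuous_subspaceW (cp i) => x [].
  have := ch i; move/continuous_closedP/(_ _ cW)/closed_subspaceP => [V cV VW].
  by rewrite setIC -VW setIC; exact: compact_closedI.
subst A; rewrite eqEsubset; split=> x [h1 h2]; split=> //.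
  elim/big_rec: _ h1 {h2} => //= i P _ IP [[c [Kc Wc] <-]|/IP //].
  by move: Wc; rewrite (hphi _ _ Kc).
elim/big_rec2: _ h2 => // i S1 S2 _ IH [[c Kc cx]|/IH]; last by right.
left; exists c => //; split=> //.
by have := hphi _ _ Kc; rewrite cx /preimage /= => ->.
Qed.

End Topology.

(** * Signatures of weighted words *)

Section Signature.
Variables (R : realType) (T : choiceType).
Implicit Types (k a : T) (w : seq T) (x y c : R).

(** The space of noncommutative power series, with the topology of
    convergence of every coefficient. *)
Definition signature := {ptws seq T -> R}.
Implicit Types z : signature.

Definition run k w := find (predC1 k) w.

(** Multiplication from the left by the exponential series of [x k]. *)
Definition expm k x z : signature :=
  fun w => \sum_(0 <= i < (run k w).+1) x ^+ i / i`!%:R * z (drop i w).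

(** The substitutions of [c k] for [k], and of [c a] for every letter [a]. *)
Definition scl k c z : signature := fun w => c ^+ count_mem k w * z w.
Definition scla c z : signature := fun w => c ^+ size w * z w.
Definition sone : signature := fun w => (w == [::])%:R.

(** The product of the exponentials of the letters of [l], each multiplied by
    its weight. These products do not change when a letter is cut into pieces
    or when letters of weight 0 are inserted, as degeneracies and faces do in
    realizations, and essentially nothing else is lost. *)
Definition sig (l : seq (T * R)) : signature :=
  foldr (fun p => expm p.1 p.2) sone l.

Lemma run_le_size k w : (run k w <= size w)%N.
Proof. exact: find_size. Qed.

Lemma take_run k w i : (i <= run k w)%N -> take i w = nseq i k.
Proof.
rewrite /run; elim: w i => [|a w IH] [|i] //=; case: eqVneq => //= -> ?.
by rewrite IH.
Qed.

Lemma run_drop k w i : (i <= run k w)%N -> run k (drop i w) = (run k w - i)%N.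
Proof.
rewrite /run; elim: w i => [|a w IH] [|i] //=; rewrite ?subn0 //.
by case: eqVneq => //= _ h; rewrite IH.
Qed.

Lemma count_drop_run P k w i : (i <= run k w)%N ->
  count P w = (P k * i + count P (drop i w))%N.
Proof.
by move=> h; rewrite -{1}(cat_take_drop i w) (take_run h) count_cat count_nseq.
Qed.

Lemma expm0 k z : expm k 0 z = z.
Proof.
apply/funext => w; rewrite /expm big_nat_recl // expr0 fact0 divr1 mul1r drop0.
by rewrite big1 ?addr0 // => i _; rewrite expr0n /= mul0r mul0r.
Qed.

Lemma expmD k x y z : expm k x (expm k y z) = expm k (x + y) z.
Proof.
apply/funext => w; rewrite /expm; set m := run k w.
pose F i n : R := (x ^+ i / i`!%:R) * (y ^+ (n - i) / (n - i)`!%:R) * z (drop n w).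
transitivity (\sum_(0 <= i < m.+1) \sum_(0 <= n < m.+1 | (i <= n)%N) F i n).
  apply: eq_big_nat => i /andP[_ im]; rewrite run_drop // mulr_sumr -/m.
  rewrite -subSn //.
  have -> : \sum_(0 <= n < m.+1 | (i <= n)%N) F i n = \sum_(i <= n < m.+1) F i n.
    rewrite (big_cat_nat (n := i)) //=; last exact: ltnW.
    rewrite big_nat_cond big1 ?add0r; last first.
      by move=> n /andP[/andP[_ ni]]; rewrite leqNgt ni.
    by rewrite big_nat_cond [RHS]big_nat_cond; apply: eq_bigl => n; rewrite /= andbT andbAC andbb.
  have := big_addn 0 m.+1 i xpredT (F i); rewrite add0n => ->; apply: eq_bigr => j _.
  by rewrite /F addnK drop_drop mulrA.
rewrite (exchange_big_dep_nat xpredT) //=; apply: eq_big_nat => n /andP[_ nm].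
have -> : \sum_(0 <= i < m.+1 | (i <= n)%N) F i n = \sum_(0 <= i < n.+1) F i n.
  rewrite (big_cat_nat (n := n.+1)) //= [X in _ + X]big_nat_cond.
  rewrite [X in _ + X]big1 ?addr0; last first.
    by move=> i /andP[/andP[ni _]]; rewrite leqNgt ni.
  by rewrite big_nat_cond [RHS]big_nat_cond; apply: eq_bigl => i; rewrite ltnS -andbA andbb andbT.
rewrite /F -mulr_suml; congr (_ * _).
rewrite [in RHS]addrC exprDn big_mkord mulr_suml; apply: eq_bigr => i _.
have ilen : (i <= n)%N by rewrite -ltnS.
have fne j : (j`!%:R : R) != 0 by rewrite pnatr_eq0 -lt0n fact_gt0.
rewrite -[X in _ = X / _]mulr_natr -[in RHS](bin_fact ilen) !natrM.
have bne : ('C(n, i)%:R : R) != 0 by rewrite pnatr_eq0 -lt0n bin_gt0.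
have := fne i; have := fne (n - i)%N; move: ('C(n, i)%:R) bne => B.
move: (i`!%:R) ((n - i)`!%:R) => u v Bn vn un; field.
by rewrite Bn vn un.
Qed.

Lemma expm_nil k x z : expm k x z [::] = z [::].
Proof. by rewrite /expm /= big_nat1 expr0 fact0 divr1 mul1r. Qed.

Lemma expm_cons_neq k x z a w : a != k -> expm k x z (a :: w) = z (a :: w).
Proof.
by move=> ak; rewrite /expm /run /= ak big_nat1 expr0 fact0 divr1 mul1r.
Qed.

Lemma scl1 k z : scl k 1 z = z.
Proof. by apply/funext => w; rewrite /scl expr1n mul1r. Qed.

Lemma sclM k c c' z : scl k c (scl k c' z) = scl k (c * c') z.
Proof. by apply/funext => w; rewrite /scl exprMn mulrA. Qed.

Lemma sclC k k' c c' z : scl k c (scl k' c' z) = scl k' c' (scl k c z).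
Proof. by apply/funext => w; rewrite /scl mulrCA. Qed.

Lemma scl_sone k c : scl k c sone = sone.
Proof.
by apply/funext => -[|a w]; rewrite /scl /sone /= ?expr0 ?mul1r ?mulr0.
Qed.

Lemma scl_expm k c x z : scl k c (expm k x z) = expm k (c * x) (scl k c z).
Proof.
apply/funext => w; rewrite /scl /expm mulr_sumr.
apply: eq_big_nat => i /andP[_ h].
rewrite (@count_drop_run _ k w i) //= eqxx mul1n exprD exprMn.
by rewrite !mulrA; congr (_ * _); rewrite [RHS]mulrAC -!mulrA; congr (_ * _); rewrite mulrCA mulrA.
Qed.

Lemma scl_expm_neq k k' c x z : k != k' ->
  scl k c (expm k' x z) = expm k' x (scl k c z).
Proof.
move=> kk; apply/funext => w; rewrite /scl /expm mulr_sumr.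
apply: eq_big_nat => i /andP[_ h].
by rewrite (@count_drop_run _ k' w i) //= eq_sym (negbTE kk) mul0n add0n mulrCA.
Qed.

Lemma scla_sone c : scla c sone = sone.
Proof.
by apply/funext => -[|a w]; rewrite /scla /sone /= ?expr0 ?mul1r ?mulr0.
Qed.

Lemma scla_expm k c x z : scla c (expm k x z) = expm k (c * x) (scla c z).
Proof.
apply/funext => w; rewrite /scla /expm mulr_sumr.
apply: eq_big_nat => i /andP[_ h].
have ile : (i <= size w)%N := leq_trans (h : (i <= run k w)%N) (run_le_size k w).
rewrite size_drop -{1}(subnKC ile) exprD exprMn.
by rewrite !mulrA; congr (_ * _); rewrite [RHS]mulrAC -!mulrA; congr (_ * _); rewrite mulrCA mulrA.
Qed.

Lemma sclaM c c' z : scla c (scla c' z) = scla (c * c') z.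
Proof. by apply/funext => w; rewrite /scla exprMn mulrA. Qed.

Lemma scla0 z : z [::] = 1 -> scla 0 z = sone.
Proof.
by move=> z1; apply/funext => -[|a w];
  rewrite /scla /sone /= ?expr0 ?mul1r // expr0n mul0r.
Qed.

Lemma scla1 z : scla 1 z = z.
Proof. by apply/funext => w; rewrite /scla expr1n mul1r. Qed.

Lemma sig_cat l l' : sig (l ++ l') = foldr (fun p => expm p.1 p.2) (sig l') l.
Proof. by rewrite /sig foldr_cat. Qed.

Lemma sig_nil l : sig l [::] = 1.
Proof. by elim: l => [|p l IH]; rewrite /= /sone // expm_nil IH. Qed.

Lemma scla_sig c l : scla c (sig l) = sig [seq (p.1, c * p.2) | p <- l].
Proof. by elim: l => [|p l IH] /=; rewrite ?scla_sone // scla_expm IH. Qed.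

Lemma scl_sig k c l : scl k c (sig l) =
  sig [seq (p.1, if p.1 == k then c * p.2 else p.2) | p <- l].
Proof.
elim: l => [|p l IH] /=; first exact: scl_sone.
by case: eqVneq => [->|pk]; rewrite ?scl_expm ?IH // scl_expm_neq 1?eq_sym ?IH.
Qed.

Lemma scl0_sig k l : scl k 0 (sig l) = sig [seq p <- l | p.1 != k].
Proof.
elim: l => [|p l IH] /=; first exact: scl_sone.
case: eqVneq => [->|pk] /=; first by rewrite scl_expm IH mul0r expm0.
by rewrite scl_expm_neq 1?eq_sym // IH.
Qed.

(** ** Continuity *)

Lemma cvg_bigsum (U I : Type) (F : set_system U) (r : seq I) (P : pred I)
    (f : I -> U -> R) (g : I -> R) : Filter F ->
  (forall i, P i -> f i u @[u --> F] --> g i) ->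
  \sum_(i <- r | P i) f i u @[u --> F] --> \sum_(i <- r | P i) g i.
Proof. by move=> FF; apply: (cvg_big (@add_continuous R)). Qed.

Lemma cvg_exprn (U : Type) (F : set_system U) (f : U -> R) x n : Filter F ->
  f u @[u --> F] --> x -> f u ^+ n @[u --> F] --> x ^+ n.
Proof. by move=> FF fx; apply: cvg_comp fx (@exprn_continuous R n x). Qed.

Lemma expm_cvg (U : Type) (F : set_system U) (x_ : U -> R) (z_ : U -> signature)
    k x z : Filter F -> x_ u @[u --> F] --> x -> z_ u @[u --> F] --> z ->
  expm k (x_ u) (z_ u) @[u --> F] --> expm k x z.
Proof.
move=> FF hx hz; apply: ptws_cvgP => w; rewrite /expm.
apply: cvg_bigsum => i _; apply: cvgM; last exact: cvg_comp hz (@ptws_coord_continuous _ _ _ _).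
apply: cvgM; last exact: cvg_cst.
exact: cvg_exprn.
Qed.

Lemma scl_cvg (U : Type) (F : set_system U) (x_ : U -> R) (z_ : U -> signature)
    k x z : Filter F -> x_ u @[u --> F] --> x -> z_ u @[u --> F] --> z ->
  scl k (x_ u) (z_ u) @[u --> F] --> scl k x z.
Proof.
move=> FF hx hz; apply: ptws_cvgP => w; rewrite /scl.
apply: cvgM; last exact: cvg_comp hz (@ptws_coord_continuous _ _ _ _).
exact: cvg_exprn.
Qed.

Lemma scla_cvg (U : Type) (F : set_system U) (x_ : U -> R) (z_ : U -> signature)
    x z : Filter F -> x_ u @[u --> F] --> x -> z_ u @[u --> F] --> z ->
  scla (x_ u) (z_ u) @[u --> F] --> scla x z.
Proof.
move=> FF hx hz; apply: ptws_cvgP => w; rewrite /scla.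
apply: cvgM; last exact: cvg_comp hz (@ptws_coord_continuous _ _ _ _).
exact: cvg_exprn.
Qed.

End Signature.

(** ** Cancellation *)

Section Cancellation.
Variables (R : realType) (T : choiceType).
Implicit Types (k a : T) (w : seq T) (l : seq (T * R)) (z : signature R T).

Definition nonneg l := all (fun p => 0 <= p.2) l.
Definition positive l := all (fun p => 0 < p.2) l.
Definition mass k l : R := \sum_(p <- l | p.1 == k) p.2.

Lemma positive_nonneg l : positive l -> nonneg l.
Proof. by apply: sub_all => p /ltW. Qed.

Lemma mass_cons k p l : mass k (p :: l) = (if p.1 == k then p.2 else 0) + mass k l.
Proof. by rewrite /mass big_cons; case: ifP; rewrite ?add0r. Qed.

Lemma mass_ge0 k l : nonneg l -> 0 <= mass k l.
Proof.
elim: l => [|p l IH] /=; first by rewrite /mass big_nil.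
by case/andP=> p0 /IH h; rewrite mass_cons addr_ge0 //; case: ifP.
Qed.

Lemma sig_ge0 l w : nonneg l -> 0 <= sig l w.
Proof.
elim: l w => [|p l IH] w /=; first by rewrite /sone.
case/andP=> p0 /IH h; rewrite /expm big_nat; apply: sumr_ge0 => i _.
by rewrite mulr_ge0 // divr_ge0 ?exprn_ge0.
Qed.

Lemma changes_nseq_cat k i w : (changes (nseq i k ++ w) <= (changes w).+1)%N.
Proof.
case: i => [|i] /=; first exact: leqW.
rewrite changes_nseq; case: w => // a w; rewrite changes_cons2 -add1n.
by rewrite leq_add2r leq_b1.
Qed.

(** A word with a nonzero coefficient has at most as many runs of equal letters
    as there are exponential factors. *)
Lemma sig_changes l w : sig l w != 0 -> (changes w <= size l)%N.
Proof.
elim: l w => [|p l IH] w /=; first by rewrite /sone; case: w => //= a w; rewrite eqxx.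
rewrite /expm => nz.
have [i /andP[ir nzi]] : exists i, (i < (run p.1 w).+1)%N && (sig l (drop i w) != 0).
  apply: contrapT => h; move: nz; rewrite big_nat big1 ?eqxx // => i /andP[_ ir].
  have [->|nzi] := eqVneq (sig l (drop i w)) 0; first by rewrite mulr0.
  by case: h; exists i; rewrite ir.
rewrite -(cat_take_drop i w) (take_run (ir : (i <= run p.1 w)%N)).
by apply: leq_trans (changes_nseq_cat _ _ _) _; rewrite ltnS; exact: IH.
Qed.

Lemma sig_cons_gt0 k x l w : 0 < x -> nonneg l -> 0 < sig l w ->
  0 < sig ((k, x) :: l) (k :: w).
Proof.
move=> x0 nl zw /=; rewrite /expm /run /= eqxx big_nat_recl // big_nat_recl //.
rewrite drop0 /= drop0 ltr_wpDl //; first by rewrite mulr_ge0 ?divr_ge0 ?sig_ge0.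
rewrite ltr_pwDl ?mulr_gt0 ?divr_gt0 ?expr1 ?fact_gt0 ?ltr0n //.
rewrite big_nat; apply: sumr_ge0 => i _.
by rewrite mulr_ge0 ?sig_ge0 // divr_ge0 ?exprn_ge0 // ltW.
Qed.

(** Among the words [a :: w] at which the signature of a positive weighted word
    is nonzero, one with the most changes of letter begins as that word does:
    otherwise its first letter could be put in front. *)
Lemma sig_head k x l k' x' l' :
  positive ((k, x) :: l) -> positive ((k', x') :: l') ->
  sig ((k, x) :: l) = sig ((k', x') :: l') -> k = k'.
Proof.
move=> pl pl' E.
pose P n := `[< exists a w, 0 < sig ((k, x) :: l) (a :: w) /\ changes (a :: w) = n >].
have exP : exists n, P n.
  exists (changes [:: k]); apply/asboolP; exists k, [::]; split=> //.
  case/andP: pl => /= x0 /positive_nonneg nl.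
  by apply: sig_cons_gt0; rewrite // sig_nil.
have ubP n : P n -> (n <= (size l).+1)%N.
  by move=> /asboolP[a [w [/lt0r_neq0 /sig_changes + <-]]].
case: (ex_maxnP exP ubP) => n /asboolP[a [w [zw cw]]] max_n.
have H j y m : positive ((j, y) :: m) ->
    sig ((k, x) :: l) = sig ((j, y) :: m) -> a = j.
  case/andP=> /= y0 /positive_nonneg nm Em; apply/eqP/contraT => aj.
  have : P n.+1.
    apply/asboolP; exists j, (a :: w); rewrite changes_cons2 cw eq_sym aj; split=> //.
    rewrite /= Em; apply: sig_cons_gt0 => //.
    by move: zw; rewrite /= Em expm_cons_neq.
  by move/max_n; rewrite ltnn.
by rewrite -(H _ _ _ pl) // (H _ _ _ pl').
Qed.

(** Cancellation recovers words from the left, so that the decoration of a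
    letter, on which its weight depends, has to be known from the preceding
    letters. *)
Fixpoint decorate (lab : seq T -> T -> nat) h w : seq (T * nat) :=
  if w is k :: w' then (k, lab h k) :: decorate lab (k :: h) w' else [::].

Definition weigh (y : T -> nat -> R) (s : seq (T * nat)) : seq (T * R) :=
  [seq (p.1, y p.1 p.2) | p <- s].

Lemma sig_cancel lab y h w w' :
  positive (weigh y (decorate lab h w)) -> positive (weigh y (decorate lab h w')) ->
  sig (weigh y (decorate lab h w)) = sig (weigh y (decorate lab h w')) -> w = w'.
Proof.
have nz k h0 w0 : positive (weigh y (decorate lab h0 (k :: w0))) ->
    sig (weigh y (decorate lab h0 (k :: w0))) <> @sone R T.
  case/andP=> x0 /positive_nonneg nl E.
  have := @sig_cons_gt0 k _ _ [::] x0 nl; rewrite sig_nil => /(_ ltr01).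
  by move: E => /= ->; rewrite /sone ltxx.
elim: w h w' => [|k w IH] h [|k' w'] //=.
- by move=> _ pw /esym E; case: (@nz k' h w').
- by move=> pw _ E; case: (@nz k h w).
move=> pw pw' E; have kk := sig_head pw pw' E; rewrite -{}kk in pw' E *.
case/andP: pw => _ pw; case/andP: pw' => _ pw'.
congr cons; apply: (IH (k :: h)) => //.
by move/(congr1 (expm k (- y k (lab h k)))): E; rewrite !expmD addNr !expm0.
Qed.

End Cancellation.

(** * Moving letters to the front *)

Section Moves.
Variables (R : realType) (T : choiceType).
Implicit Types (k a : T) (ks w : seq T) (l : seq (T * R)) (z : signature R T).
Implicit Types (s t u v : R).

Definition represents ks w z :=
  exists l, [/\ nonneg l, all (fun p => p.1 \in ks) l,
    {in ks, forall k, mass k l = 1}, sig l = z & unzip1 l = w].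

(** If [k] has mass 1, this moves the proportion [s] of all its occurrences. *)
Definition prepend k s z := expm k s (scl k (1 - s) z).

(** How much is in front of [k]: the sum of the products of the weights of a
    letter of [ks] and of a later [k], which is what the coefficient of a word
    of length 2 says. It measures the amount of moving [k] to the front
    continuously, and is 0 only when there is nothing to move. *)
Definition lead k ks z : R := \sum_(j <- ks) z [:: j; k].

(** The motion, at time [u], which moves the letters of [ks] to the front one
    after the other: the first one during the time [lead k ks' z], so that no
    time is spent on it when it already is in front; then it is left aside. *)
Fixpoint pull ks u z : signature R T :=
  if ks is k :: ks' then
    let D := lead k ks' z in
    if u <= D then prepend k (u / D) z
    else expm k 1 (pull ks' (u - D) (scl k 0 z))
  else z.

Fixpoint total_lead ks z : R :=
  if ks is k :: ks' then lead k ks' z + total_lead ks' z else 0.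

Lemma prepend0 k z : prepend k 0 z = z.
Proof. by rewrite /prepend subr0 scl1 expm0. Qed.

Lemma prepend1 k z : prepend k 1 z = expm k 1 (scl k 0 z).
Proof. by rewrite /prepend subrr. Qed.

Lemma prependM k s t z : prepend k s (prepend k t z) = prepend k (s + t - s * t) z.
Proof.
rewrite /prepend scl_expm expmD sclM; congr (expm k _ (scl k _ z)); ring.
Qed.

Lemma scl0_prepend k s z : scl k 0 (prepend k s z) = scl k 0 z.
Proof. by rewrite /prepend scl_expm sclM !mul0r expm0. Qed.

Lemma lead_prepend k s ks z : k \notin ks ->
  lead k ks (prepend k s z) = (1 - s) * lead k ks z.
Proof.
move=> kks; rewrite /lead mulr_sumr; apply: eq_big_seq => j jks.
have jk : j != k by apply: contraNneq kks => <-.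
by rewrite /prepend expm_cons_neq // /scl /= (negbTE jk) eqxx expr1.
Qed.

Lemma lead_expm k j s ks z : k != j -> k \notin ks -> lead j ks (expm k s z) = lead j ks z.
Proof.
move=> kj kks; apply: eq_big_seq => i iks; rewrite expm_cons_neq //.
by apply: contraNneq kks => <-.
Qed.

Lemma lead_scl k j s ks z : k != j -> k \notin ks -> lead j ks (scl k s z) = lead j ks z.
Proof.
move=> kj kks; apply: eq_big_seq => i iks; rewrite /scl /= [j == k]eq_sym (negbTE kj).
have /negbTE-> : i != k by apply: contraNneq kks => <-.
by rewrite expr0 mul1r.
Qed.

Lemma total_lead_expm k s ks z : k \notin ks -> total_lead ks (expm k s z) = total_lead ks z.
Proof.
elim: ks => //= j ks IH; rewrite inE negb_or => /andP[kj kks].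
by rewrite lead_expm // IH.
Qed.

Lemma total_lead_scl k s ks z : k \notin ks -> total_lead ks (scl k s z) = total_lead ks z.
Proof.
elim: ks => //= j ks IH; rewrite inE negb_or => /andP[kj kks].
by rewrite lead_scl // IH.
Qed.

Lemma scl_pull k c ks u z : k \notin ks -> scl k c (pull ks u z) = pull ks u (scl k c z).
Proof.
elim: ks u z => //= j ks IH u z; rewrite inE negb_or => /andP[kj kks].
rewrite lead_scl //; case: ifP => _; last by rewrite scl_expm_neq // IH // sclC.
by rewrite /prepend scl_expm_neq // sclC.
Qed.

Lemma lead_ge0 k ks w z ks' : represents ks w z -> 0 <= lead k ks' z.
Proof.
by case=> l [nl _ _ <- _]; apply: sumr_ge0 => j _; exact: sig_ge0.
Qed.

Lemma total_lead_ge0 ks w z ks' : represents ks w z -> 0 <= total_lead ks' z.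
Proof. by move=> h; elim: ks' => //= k ks' IH; rewrite addr_ge0 // (lead_ge0 _ _ h). Qed.

Lemma sig1 k l : sig l [:: k] = mass k l.
Proof.
elim: l => [|[j x] l IH]; first by rewrite /mass big_nil.
rewrite mass_cons /=; case: eqVneq => [->|jk]; last first.
  by rewrite expm_cons_neq 1?eq_sym // IH add0r.
rewrite /expm /run /= eqxx /= big_nat_recr // big_nat1 /= sig_nil IH.
by rewrite !expr0 !expr1 !divr1 mul1r mulr1 addrC.
Qed.

Lemma sig2 k a j x l : a != k ->
  sig ((j, x) :: l) [:: a; k] =
  sig l [:: a; k] + (if a == j then x * mass k l else 0).
Proof.
move=> ak /=; case: eqVneq => [<-|aj]; last by rewrite expm_cons_neq // addr0.
rewrite /expm /run /= eqxx /= eq_sym ak /= big_nat_recr // big_nat1 /= sig1.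
by rewrite !expr0 !expr1 !divr1 mul1r.
Qed.

Lemma mass_filter_neq k k' l : k' != k ->
  mass k' [seq p <- l | p.1 != k] = mass k' l.
Proof.
move=> kk; rewrite /mass big_filter_cond; apply: eq_bigl => p.
by case: (eqVneq p.1 k') => [->|]; rewrite ?kk ?andbF.
Qed.

(** If no letter of positive weight precedes a [k] of positive weight, the
    letter [k] already is in front. *)
Lemma lead_eq0 k ks l : k \notin ks -> nonneg l ->
  all (fun p => p.1 \in k :: ks) l -> lead k ks (sig l) = 0 ->
  sig l = expm k (mass k l) (scl k 0 (sig l)).
Proof.
move=> kks; elim: l => [|[j x] l IH] /=.
  by move=> _ _ _; rewrite /mass big_nil expm0 scl_sone.
case/andP=> x0 nl /andP[jks lks]; rewrite mass_cons /=.
have leadE : lead k ks (expm j x (sig l)) =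
    lead k ks (sig l) + \sum_(a <- ks) (if a == j then x * mass k l else 0).
  rewrite /lead -big_split; apply: eq_big_seq => a aks.
  by apply: sig2; apply: contraNneq kks => <-.
move: jks; rewrite inE; case: eqVneq => [jk _|jk /= jks].
  rewrite {j}jk in leadE *; rewrite leadE big_seq big1 ?addr0; last first.
    by move=> a aks; case: eqP => // ak; move: kks; rewrite -ak aks.
  move=> /(IH nl lks) E; rewrite {1}E expmD scl_expm mul0r expm0 //.
have s0 a : 0 <= (if a == j then x * mass k l else 0).
  by case: ifP => // _; rewrite mulr_ge0 ?mass_ge0.
move/eqP; rewrite leadE paddr_eq0; last 2 first.
- by apply: sumr_ge0 => a _; exact: sig_ge0.
- exact: sumr_ge0.
case/andP=> /eqP /(IH nl lks) E.
rewrite psumr_eq0 // => /allP /(_ j jks) /=; rewrite eqxx mulf_eq0.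
case/orP=> /eqP h0; first by rewrite h0 !expm0 add0r.
rewrite h0 addr0 expm0 scl_expm_neq 1?eq_sym //; rewrite h0 expm0 in E; by rewrite -E.
Qed.

Lemma represents_prepend k ks w z s : represents (k :: ks) w z -> 0 <= s <= 1 ->
  represents (k :: ks) (k :: w) (prepend k s z).
Proof.
case=> l [nl lks ml <- <-] /andP[s0 s1].
exists ((k, s) :: [seq (p.1, if p.1 == k then (1 - s) * p.2 else p.2) | p <- l]).
split; last by rewrite /= /unzip1 -map_comp; congr cons.
- rewrite /nonneg /= s0 all_map; apply: sub_all nl => p /= p0.
  by case: ifP => // _; rewrite mulr_ge0 // subr_ge0.
- by rewrite /= mem_head all_map.
- move=> a aks; rewrite mass_cons /= /mass big_map /=.
  have [<-|ka] := eqVneq k a.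
    under eq_bigr => p /eqP pa do rewrite pa eqxx.
    by rewrite -mulr_sumr -/(mass k l) ml // ?mem_head // mulr1 addrC subrK.
  rewrite add0r -[RHS](ml a) //; apply: eq_bigr => p /eqP ->.
  by rewrite eq_sym (negbTE ka).
- by rewrite /= /prepend scl_sig.
Qed.

Lemma represents_erase k ks w z : uniq (k :: ks) -> represents (k :: ks) w z ->
  represents ks [seq a <- w | a != k] (scl k 0 z).
Proof.
case/andP=> kks _ [l [nl lks ml <- <-]]; exists [seq p <- l | p.1 != k]; split.
- by apply/allP => p; rewrite mem_filter => /andP[_]; exact: (allP nl).
- apply/allP => p; rewrite mem_filter => /andP[pk /(allP lks)].
  by rewrite inE (negbTE pk).
- move=> a aks; rewrite mass_filter_neq; first by rewrite ml // inE aks orbT.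
  by apply: contraNneq kks => <-.
- by rewrite scl0_sig.
- by rewrite /unzip1 filter_map.
Qed.

Lemma represents_expm k ks w z : k \notin ks -> represents ks w z ->
  represents (k :: ks) (k :: w) (expm k 1 z).
Proof.
move=> kks [l [nl lks ml <- <-]]; exists ((k, 1) :: l); split=> //=.
- by rewrite ler01.
- by rewrite mem_head; apply: sub_all lks => p; rewrite inE orbC => ->.
- move=> a; rewrite inE mass_cons /=; case: eqVneq => [->|ak] /= aks.
    rewrite /mass big_seq_cond big1 ?addr0 // => p /andP[/(allP lks) pks /eqP pk].
    by rewrite pk (negbTE kks) in pks.
  by rewrite add0r ml.
Qed.

Lemma ratio_itv u D : 0 <= u -> u <= D -> 0 <= u / D <= 1.
Proof.
move=> u0 uD; have [->|D0] := eqVneq D 0; first by rewrite invr0 mulr0 lexx ler01.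
have Dp : 0 < D by rewrite lt_neqAle eq_sym D0 (le_trans u0).
by rewrite divr_ge0 //= ?(le_trans u0) // ler_pdivrMr // mul1r.
Qed.

(** The motion may stop while the first letter moves, which leaves the others
    in place; otherwise no occurrence of that letter remains behind. *)
Fixpoint pulled ks w w' : Prop :=
  if ks is k :: ks' then
    w' = k :: w \/
    exists2 v, w' = k :: v & pulled ks' [seq a <- w | a != k] v
  else w' = w.

Lemma represents_pull ks w z u : uniq ks -> represents ks w z -> 0 <= u ->
  exists2 w', represents ks w' (pull ks u z) & pulled ks w w'.
Proof.
elim: ks w z u => [|k ks IH] w z u; first by move=> _ h _; exists w.
move=> uks; have /andP[kks uks'] := uks.
move=> h u0 /=; case: leP => uD.
  by exists (k :: w); [apply: represents_prepend => //; exact: ratio_itv|left].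
have uD' : 0 <= u - lead k ks z by rewrite subr_ge0 ltW.
have [v h1 h2] := IH _ _ _ uks' (represents_erase uks h) uD'.
by exists (k :: v); [exact: represents_expm|right; exists v].
Qed.

Lemma pull0 ks w z : represents ks w z -> pull ks 0 z = z.
Proof.
by case: ks => // k ks h /=; rewrite (lead_ge0 _ _ h) mul0r prepend0.
Qed.

(** The motion is a semiflow, because what remains in front of the moving letter
    decreases at unit speed. *)
Lemma pullD ks w z u v : uniq ks -> represents ks w z -> 0 <= u -> 0 <= v ->
  pull ks u (pull ks v z) = pull ks (u + v) z.
Proof.
elim: ks w z u v => // k ks IH w z u v uks h u0 v0.
have /andP[kks uks'] := uks; have h' := represents_erase uks h.
rewrite /=; set D := lead k ks z; have D0 : 0 <= D := lead_ge0 _ _ h.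
have [vD|vD] := leP v D.
  rewrite lead_prepend // -/D scl0_prepend prependM.
  have -> : (1 - v / D) * D = D - v.
    have [D0'|D1] := eqVneq D 0; last by field.
    by rewrite D0' mulr0 (_ : v = 0) ?subr0 //; apply/eqP; rewrite eq_le v0 -D0' vD.
  rewrite lerBrDr; case: ifP => uvD; last by rewrite opprB addrA.
  congr prepend; have [D0'|D1] := eqVneq D 0.
    have -> : v = 0 by apply/eqP; rewrite eq_le v0 -D0' vD.
    by rewrite D0' !(subr0, invr0, mulr0, addr0).
  have [Dv|Dv] := eqVneq (D - v) 0; last by field; rewrite D1.
  have Dv' : v = D by apply/eqP; rewrite eq_sym -subr_eq0 Dv.
  have -> : u = 0 by apply/eqP; rewrite eq_le u0 andbT; lra.
  by rewrite Dv' !mul0r !add0r subr0.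
have D'0 : lead k ks (expm k 1 (pull ks (v - D) (scl k 0 z))) = 0.
  rewrite -scl_pull // /lead big_seq big1 // => j jks.
  have jk : j != k by apply: contraNneq kks => <-.
  by rewrite expm_cons_neq // /scl /= (negbTE jk) eqxx expr0n mul0r.
have uvD : (u + v <= D) = false by apply/negbTE; rewrite -ltNge; lra.
rewrite D'0 uvD; have [u1|u1] := leP u 0.
  have -> : u = 0 by apply/eqP; rewrite eq_le u0 u1.
  by rewrite mul0r prepend0 add0r.
rewrite subr0 scl_expm mul0r expm0 -!scl_pull // sclM mul0r scl_pull //.
rewrite scl_pull // (IH _ _ _ _ _ h') ?subr_ge0 ?(ltW vD) //.
by rewrite addrA scl_pull.
Qed.

Lemma total_lead_pull ks w z v : uniq ks -> represents ks w z ->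
  0 <= v <= total_lead ks z -> total_lead ks (pull ks v z) = total_lead ks z - v.
Proof.
elim: ks w z v => [|k ks IH] w z v uks h.
  by rewrite /= => /le_anti <-; rewrite subr0.
have /andP[kks uks'] := uks; have h' := represents_erase uks h.
move=> /andP[v0 /= vS]; set D := lead k ks z; have D0 : 0 <= D := lead_ge0 _ _ h.
have [vD|vD] := leP v D.
  rewrite lead_prepend // -/D total_lead_expm // total_lead_scl //.
  have -> : (1 - v / D) * D = D - v; last by rewrite addrAC.
  have [D0'|D1] := eqVneq D 0; last by field.
  by rewrite D0' mulr0 (_ : v = 0) ?subr0 //; apply/eqP; rewrite eq_le v0 -D0' vD.
rewrite total_lead_expm // (IH _ _ _ _ h') ?total_lead_scl //; last first.
  by rewrite subr_ge0 (ltW vD) /= lerBlDl.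
rewrite -scl_pull // [lead _ _ _]big_seq big1 ?add0r; first by ring.
move=> j jks; have jk : j != k by apply: contraNneq kks => <-.
by rewrite expm_cons_neq // /scl /= (negbTE jk) eqxx expr0n mul0r.
Qed.

Lemma pull_total ks w z : uniq ks -> represents ks w z ->
  pull ks (total_lead ks z) z = sig [seq (k, 1) | k <- ks].
Proof.
elim: ks w z => [|k ks IH] w z uks h /=.
  by case: h => -[|p l] [] //= _ _ _ <-.
have /andP[kks uks'] := uks; have h' := represents_erase uks h.
set D := lead k ks z; have D0 : 0 <= D := lead_ge0 _ _ h.
have S0 : 0 <= total_lead ks z := total_lead_ge0 ks h.
case: ifP => hD; last first.
  by rewrite addrAC subrr add0r -(total_lead_scl 0 z kks) (IH _ _ _ h').
have St0 : total_lead ks z = 0 by apply/eqP; rewrite eq_le S0 andbT -(lerD2l D) addr0.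
have <- : pull ks 0 (scl k 0 z) = sig [seq (i, 1) | i <- ks].
  by rewrite -(IH _ _ uks' h') total_lead_scl // St0.
rewrite (pull0 h') St0 addr0; have [Dz|Dn] := eqVneq D 0; last first.
  by rewrite divff // prepend1.
rewrite Dz mul0r prepend0; case: h => l [nl lks ml lz _].
by rewrite -lz -{1}(ml k) ?mem_head //; apply: (lead_eq0 kks nl lks); rewrite lz.
Qed.

End Moves.

(** ** Continuity of the motion *)

Section PullContinuity.
Variables (R : realType) (T : choiceType).
Implicit Types (k : T) (ks w : seq T) (z : signature R T).

Lemma cvg_within_split (U V : Type) (F : set_system U) (Q A : set U) (f : U -> V)
    (G : set_system V) : Filter F ->
  f @ within (Q `&` A) F `=>` G -> f @ within (Q `&` ~` A) F `=>` G ->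
  f @ within Q F `=>` G.
Proof.
move=> FF h1 h2 W GW; have := h1 W GW; have := h2 W GW.
rewrite /nbhs /= /within /=; apply: filterS2 => u h h' Qu.
by have [Au|nAu] := pselect (A u); [apply: h'|apply: h].
Qed.

Lemma cvg_within_eq (U V : Type) (F : set_system U) (Q : set U) (f g : U -> V)
    (G : set_system V) : Filter F -> (forall u, Q u -> f u = g u) ->
  g @ within Q F `=>` G -> f @ within Q F `=>` G.
Proof.
move=> FF fg h W /h; rewrite /nbhs /= /within /=; apply: filterS => u hu Qu.
by rewrite fg //; exact: hu.
Qed.

Lemma cvg_withinW (U V : Type) (F : set_system U) (Q : set U) (f : U -> V)
    (G : set_system V) : Filter F -> f @ F `=>` G -> f @ within Q F `=>` G.
Proof.
by move=> FF h W /h; rewrite /nbhs /= /within /=; apply: filterS => u hu _.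
Qed.

Lemma near_within (U : Type) (F : set_system U) (Q P : set U) : Filter F ->
  Q `<=` P -> within Q F P.
Proof. by move=> FF QP; exact: (@filterE _ F). Qed.

Lemma cvg_within_comp (U V W : Type) (F : set_system U) (G : set_system V)
    (H : set_system W) (Q : set U) (A : set V) (f : U -> V) (g : V -> W) :
  Filter F -> f @ F `=>` G -> (forall u, Q u -> A (f u)) ->
  g @ within A G `=>` H -> (fun u => g (f u)) @ within Q F `=>` H.
Proof.
move=> FF fG QA gH O HO; have := fG _ (gH O HO).
by apply: (@filterS _ F) => u h Qu; apply: h; exact: QA.
Qed.

Lemma lead_cvg (U : Type) (F : set_system U) (z_ : U -> signature R T) z k ks :
  Filter F -> z_ u @[u --> F] --> z -> lead k ks (z_ u) @[u --> F] --> lead k ks z.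
Proof.
move=> FF hz; apply: cvg_bigsum => j _.
exact: cvg_comp hz (@ptws_coord_continuous _ _ _ _).
Qed.

Lemma prepend_cvg (U : Type) (F : set_system U) (s_ : U -> R)
    (z_ : U -> signature R T) s z k :
  Filter F -> s_ u @[u --> F] --> s -> z_ u @[u --> F] --> z ->
  prepend k (s_ u) (z_ u) @[u --> F] --> prepend k s z.
Proof.
move=> FF hs hz; apply: expm_cvg => //; apply: scl_cvg => //.
by apply: cvgB => //; exact: cvg_cst.
Qed.

Lemma prepend_continuous k :
  continuous (fun p : R * signature R T => prepend k p.1 p.2).
Proof.
case=> s z.
have c1 : fst p @[p --> (s, z)] --> s by exact: cvg_fst.
have c2 : snd p @[p --> (s, z)] --> z by exact: cvg_snd.
exact: (prepend_cvg _ c1 c2).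
Qed.

Lemma total_lead_cvg (U : Type) (F : set_system U) (z_ : U -> signature R T) z ks :
  Filter F -> z_ u @[u --> F] --> z ->
  total_lead ks (z_ u) @[u --> F] --> total_lead ks z.
Proof.
move=> FF hz; elim: ks => [|k ks IH] /=; first exact: cvg_cst.
by apply: cvgD => //; exact: lead_cvg.
Qed.

(** Near a fixed point of all [prepend k s] the proportion [s] need not
    converge, as the unit interval is compact. *)
Lemma prepend_fixed_cvg (U : Type) (F : set_system U) (s_ : U -> R)
    (z_ : U -> signature R T) z k :
  Filter F -> (\forall u \near F, 0 <= s_ u <= 1) -> z_ u @[u --> F] --> z ->
  (forall s, prepend k s z = z) -> prepend k (s_ u) (z_ u) @[u --> F] --> z.
Proof.
move=> FF hs hz fixz; apply: ptws_cvgP => w; apply/cvgrPdist_lt => e e0.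
pose P (z' : signature R T) (s : R) := `|z w - prepend k s z' w| < e.
have H : \forall z' \near z, `[(0:R), 1] `<=` P z'.
  apply: ((compact_near_coveringP _).1 (@segment_compact R 0 1) _ (nbhs z)
    (fun z' s => P z' s)).
  move=> s _.
  have c : prepend k p.1 p.2 w @[p --> (s, z)] --> z w.
    have := @ptws_coord_cvg _ _ _ _ _ _ w _ (@prepend_continuous k (s : R, z)).
    by move/(_ (nbhs_filter _)); rewrite /= fixz.
  by move/cvgrPdist_lt : c => /(_ e e0).
have := hz _ H; rewrite /nbhs /=; apply: filterS2 hs => u su; apply.
by rewrite /= in_itv.
Qed.

Lemma prepend_fixed k ks w z : uniq (k :: ks) -> represents (k :: ks) w z ->
  lead k ks z = 0 -> expm k 1 (scl k 0 z) = z /\ forall s, prepend k s z = z.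
Proof.
case/andP=> kks _ [l [nl lks ml lz _]] D0.
have E : expm k 1 (scl k 0 z) = z.
  by rewrite -lz -{1}(ml k) ?mem_head // -(lead_eq0 kks nl lks) // lz.
split=> // s; rewrite -{1}E /prepend scl_expm sclM mulr0 expmD mulr1 addrC subrK.
exact: E.
Qed.

Definition pull_domain ks : set (R * signature R T) :=
  [set p | 0 <= p.1 /\ exists w, represents ks w p.2].

(** The two branches of the definition agree where they meet. The division by
    the amount to be moved is harmless where this amount tends to 0: the limit
    is fixed by all [prepend k s]. *)
Lemma pull_continuous ks : uniq ks ->
  {within pull_domain ks, continuous (fun p => pull ks p.1 p.2)}.
Proof.
elim: ks => [|k ks IH] uks.
  by apply: continuous_subspaceT => p; exact: cvg_snd.
have /andP[kks uks'] := uks; apply/subspace_continuousP => -[u0 z0] [/= u00 [w0 hz0]].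
set D0 := lead k ks z0; have D00 : 0 <= D0 := lead_ge0 _ _ hz0.
set Q := pull_domain (k :: ks); rewrite /from_subspace /=.
have cu : p.1 @[p --> (u0, z0)] --> u0 by exact: cvg_fst.
have cz : p.2 @[p --> (u0, z0)] --> z0 by exact: cvg_snd.
have cD : lead k ks p.2 @[p --> (u0, z0)] --> D0 by exact: (lead_cvg _ cz).
apply: (@cvg_within_split _ _ _ _ [set p | p.1 <= lead k ks p.2]).
- have [uD|uD] := leP u0 D0; last first.
    move=> W _; rewrite /nbhs /= /within /=.
    have cuD : p.1 - lead k ks p.2 @[p --> (u0, z0)] --> u0 - D0 by exact: (cvgB cu cD).
    have : \forall p \near (u0, z0), 0 < p.1 - lead k ks p.2.
      by move/cvgr_gt : cuD; apply; rewrite subr_gt0.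
    by apply: filterS => p; rewrite subr_gt0 ltNge => /negP h [_ /= /h].
  apply: (@cvg_within_eq _ _ _ _ _
    (fun p : R * signature R T => prepend k (p.1 / lead k ks p.2) p.2)).
    by move=> p [_ /= h]; rewrite /= h.
  have [D0z|D0n] := eqVneq D0 0; last first.
    have cuD : p.1 / lead k ks p.2 @[p --> (u0, z0)] --> u0 / D0.
      exact: (cvgM cu (cvgV D0n cD)).
    have c0 := prepend_cvg (k := k) _ cuD cz.
    by apply: cvg_withinW; exact: c0.
  have [_ fixz] := prepend_fixed uks hz0 D0z.
  rewrite -/D0 D0z fixz; apply: prepend_fixed_cvg => //.
    apply: near_within => -[u z] [[/= u_ _] uDz].
    exact: ratio_itv.
  by apply: cvg_withinW; exact: cz.
- have [uD|uD] := ltP u0 D0.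
    move=> W _; rewrite /nbhs /= /within /=.
    have cuD : lead k ks p.2 - p.1 @[p --> (u0, z0)] --> D0 - u0 by exact: (cvgB cD cu).
    have : \forall p \near (u0, z0), 0 < lead k ks p.2 - p.1.
      by move/cvgr_gt : cuD; apply; rewrite subr_gt0.
    by apply: filterS => p; rewrite subr_gt0 => /ltW h [_ /= /(_ h)].
  set A := Q `&` ~` _.
  apply: (@cvg_within_eq _ _ _ _ _ (fun p : R * signature R T =>
      expm k 1 (pull ks (p.1 - lead k ks p.2) (scl k 0 p.2)))).
    by move=> p [_ /= /negP/negbTE h]; rewrite /= h.
  have h' := represents_erase uks hz0.
  have -> : (if u0 <= D0 then prepend k (u0 / D0) z0
             else expm k 1 (pull ks (u0 - D0) (scl k 0 z0))) =
            expm k 1 (pull ks (u0 - D0) (scl k 0 z0)).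
    case: ifP => // uD'; have {uD uD'} uD : u0 = D0 by apply/eqP; rewrite eq_le uD uD'.
    rewrite uD subrr (pull0 h'); have [Dz|Dn] := eqVneq D0 0; last first.
      by rewrite divff // prepend1.
    by rewrite Dz mul0r prepend0; case: (prepend_fixed uks hz0 Dz) => ->.
  apply: expm_cvg; first exact: cvg_cst.
  pose m (p : R * signature R T) := (p.1 - lead k ks p.2, scl k 0 p.2).
  have cm : m p @[p --> (u0, z0)] --> (u0 - D0, scl k 0 z0).
    exact: (cvg_pair (cvgB cu cD) (scl_cvg (k := k) _ (cvg_cst 0) cz)).
  have mdom p : A p -> pull_domain ks (m p).
    case=> -[_ [w /(represents_erase uks) hw]] /= /negP; rewrite -ltNge => h.
    by split; [rewrite /= subr_ge0 ltW|exists [seq a <- w | a != k]].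
  have H : pull_domain ks (u0 - D0, scl k 0 z0).
    by split; [rewrite /= subr_ge0|exists [seq a <- w0 | a != k]].
  have := IH uks'; move/subspace_continuousP => /(_ _ H) c.
  exact: (cvg_within_comp (nbhs_filter _) cm mdom c).
Qed.

(** ** The action of the interval on weighted words with unit masses *)

Section PullAction.
Variables (ks : seq T) (uks : uniq ks).

(** The motion, run for the proportion [th] of the time that it needs. *)
Definition tidy th z := pull ks (th * total_lead ks z) z.

Definition unit_words : set (signature R T) := [set z | exists w, represents ks w z].

Lemma represents_tidy th w z : 0 <= th -> represents ks w z ->
  exists2 w', represents ks w' (tidy th z) & pulled ks w w'.
Proof.
move=> th0 h; apply: represents_pull => //.
by rewrite mulr_ge0 // (total_lead_ge0 _ h).
Qed.

Lemma tidy0 z : unit_words z -> tidy 0 z = z.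
Proof. by case=> w h; rewrite /tidy mul0r (pull0 h). Qed.

Lemma tidy1 z : unit_words z -> tidy 1 z = sig [seq (k, 1) | k <- ks].
Proof. by case=> w h; rewrite /tidy mul1r (pull_total uks h). Qed.

(** The time that is left after the proportion [th'] has been run is the
    proportion [1 - th'] of the whole. *)
Lemma tidyM th th' z : 0 <= th <= 1 -> 0 <= th' <= 1 -> unit_words z ->
  tidy th (tidy th' z) = tidy (th + th' - th * th') z.
Proof.
move=> /andP[t0 t1] /andP[s0 s1] [w h]; have S0 := total_lead_ge0 ks h.
rewrite /tidy (total_lead_pull uks h); last by rewrite mulr_ge0 //= ler_piMl.
rewrite (pullD uks h) ?mulr_ge0 //; last by rewrite subr_ge0 ler_piMl.
by congr pull; ring.
Qed.

Lemma tidy_continuous :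
  {within [set p | 0 <= p.1 <= 1 /\ unit_words p.2], continuous (fun p => tidy p.1 p.2)}.
Proof.
apply/subspace_continuousP => -[th z] [/= /andP[th0 th1] [w h]].
pose m (p : R * signature R T) := (p.1 * total_lead ks p.2, p.2).
have cz : p.2 @[p --> (th, z)] --> z by exact: cvg_snd.
have cm : m p @[p --> (th, z)] --> (th * total_lead ks z, z).
  have c1 : p.1 @[p --> (th, z)] --> th by exact: cvg_fst.
  exact: (cvg_pair (cvgM c1 (total_lead_cvg (ks := ks) _ cz)) cz).
have mdom p : 0 <= p.1 <= 1 /\ unit_words p.2 -> pull_domain ks (m p).
  case=> /andP[p0 _] [v hv]; split; last by exists v.
  by rewrite /= mulr_ge0 // (total_lead_ge0 _ hv).
have H : pull_domain ks (th * total_lead ks z, z).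
  by split; [rewrite /= mulr_ge0 // (total_lead_ge0 _ h)|exists w].
have := pull_continuous uks; move/subspace_continuousP => /(_ _ H) c.
exact: (cvg_within_comp (nbhs_filter _) cm mdom c).
Qed.

End PullAction.
End PullContinuity.

(** * Counting changes of letter *)

Section Changes.
Variable T : eqType.
Implicit Types (a b c : T) (s t : seq T).

Lemma changes_cons_ge c s : (changes s <= changes (c :: s))%N.
Proof. by case: s => // a s; rewrite changes_cons2 leq_addl. Qed.

Lemma changes_subseq_cons c s t : subseq s t -> (changes (c :: s) <= changes (c :: t))%N.
Proof.
elim: t c s => [|b t IH] c s; first by rewrite subseq0 => /eqP ->.
case: s => [|a s]; first by rewrite /changes.
rewrite /=; case: eqVneq => [-> st|_ st].
  by rewrite !changes_cons2 leq_add2l IH.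
apply: leq_trans (changes_le_cons _ b _) _; rewrite [changes (c :: b :: t)]changes_cons2 leq_add2l.
exact: (IH b (a :: s)).
Qed.

Lemma changes_subseq s t : subseq s t -> (changes s <= changes t)%N.
Proof.
case: s => [|a s]; first by rewrite /changes.
elim: t => //= b t IH; case: eqVneq => [->|_ st]; first exact: changes_subseq_cons.
exact: leq_trans (IH st) (changes_cons_ge _ _).
Qed.

Lemma changes_dup s a t : changes (s ++ a :: a :: t) = changes (s ++ a :: t).
Proof.
elim: s => [|b [|c s] IH] /=; first by rewrite changes_cons2 eqxx.
  by rewrite !changes_cons2 eqxx.
by rewrite !changes_cons2 /= in IH *; rewrite IH.
Qed.

Lemma changes_rcons s a b : changes (rcons (rcons s a) b) = (changes (rcons s a) + (a != b))%N.
Proof.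
elim: s => [|c s IH] /=; first by rewrite changes_cons2 addn0.
case: s IH => [|d s] /= IH; first by rewrite !changes_cons2 !addn0.
by rewrite changes_cons2 IH addnA -changes_cons2.
Qed.

Lemma changes_cat_le s t t' : (forall c, changes (c :: t) <= changes (c :: t'))%N ->
  t' != [::] -> (changes (s ++ t) <= changes (s ++ t'))%N.
Proof.
move=> h; elim: s => [|a s IH] /= t'0.
  case: t' h t'0 => // b t' h _; have := h b; rewrite changes_cons2 eqxx add0n.
  exact: leq_trans (changes_cons_ge _ _).
case: s IH => [|b s] IH; first exact: h.
by rewrite /= !changes_cons2 leq_add2l; exact: IH.
Qed.

Lemma changes_map_inj (U : eqType) (h : T -> U) s : {in s &, injective h} ->
  changes (map h s) = changes s.
Proof.
elim: s => [|a [|b s] IH] //= hi; rewrite !changes_cons2 -IH; last first.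
  by move=> x y xs ys; apply: hi; rewrite inE ?xs ?ys orbT.
congr (_ + _)%N; congr (nat_of_bool (~~ _)); apply/eqP/eqP => [|-> //].
by apply: hi; rewrite !inE eqxx ?orbT.
Qed.

End Changes.

Section Pairs.
Variable r : nat.
Implicit Types (i j l c : 'I_r) (w f : seq 'I_r) (s : 'S_r).

Definition pair_sub i j w := [seq l <- w | (l == i) || (l == j)].

Lemma pair_subC i j w : pair_sub i j w = pair_sub j i w.
Proof. by apply: eq_filter => l; rewrite orbC. Qed.

Lemma pair_sub_subseq i j w f : subseq w f -> subseq (pair_sub i j w) (pair_sub i j f).
Proof.
by move=> wf; rewrite subseq_filter filter_all (subseq_trans (filter_subseq _ _)).
Qed.

Lemma pulled_sub ks w w' : pulled ks w w' -> forall l, l \in w' -> (l \in ks) || (l \in w).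
Proof.
elim: ks w w' => [|k ks IH] w w' /=; first by move=> -> l ->.
case=> [-> l|[v -> /IH h] l]; rewrite !inE; first by case/orP => ->; rewrite ?orbT.
case/orP=> [->//|/h]; rewrite mem_filter.
by case/orP=> [->|/andP[_ ->]]; rewrite ?orbT.
Qed.

(** If [i] precedes [j] in [ks], either the motion stops at [i] or before, and
    adds at most a letter [i] in front, or all of [i] is put before [j], which
    leaves one change; there was one already, if one counts the letter [i] that
    is put in front to account for the move itself. *)
Lemma pulled_changes ks w w' i j : uniq ks -> i \in ks -> j \in ks ->
  (index i ks < index j ks)%N -> j \in w -> pulled ks w w' ->
  (changes (i :: pair_sub i j w') <= changes (i :: pair_sub i j w))%N.
Proof.
elim: ks w w' => //= k ks IH w w' /andP[kks uks].
rewrite !inE; case: (eqVneq k j) => [|kj]; first by rewrite ltn0.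
rewrite /= => ik jks.
case: (eqVneq k i) ik => [<- _ _|ki ik].
  move=> jw [->|[v -> pv]]; first by rewrite /pair_sub /= eqxx changes_cons2 eqxx.
  rewrite /pair_sub /= eqxx /= changes_cons2 eqxx add0n.
  have kv : k \notin v.
    apply/negP => /(pulled_sub pv); rewrite (negbTE kks) mem_filter eqxx //.
  have [q ->] : exists q, [seq l <- v | (l == k) || (l == j)] = nseq q j.
    exists (size [seq l <- v | (l == k) || (l == j)]).
    apply/all_pred1P/allP => l; rewrite mem_filter => /andP[].
    by case/orP => // /eqP -> kv'; rewrite kv' in kv.
  apply: (@leq_trans 1).
    case: q => // q; rewrite -[nseq q.+1 j]/(j :: nseq q j) changes_cons2.
    rewrite -[nseq q j]cats0 changes_nseq.
    by rewrite addn0 leq_b1.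
  apply: (@leq_trans (changes [:: k; j])); first by rewrite changes_cons2 kj.
  apply: changes_subseq_cons; rewrite sub1seq mem_filter eqxx orbT //.
rewrite /= in ik; rewrite ltnS => lt_ij jw.
case=> [->|[v -> pv]].
  by rewrite /pair_sub /= (negbTE ki) (negbTE kj).
rewrite {1}/pair_sub /= (negbTE ki) (negbTE kj) /=.
have -> : pair_sub i j w = pair_sub i j [seq a <- w | a != k].
  rewrite /pair_sub -filter_predI; apply: eq_filter => l /=.
  by case: (eqVneq l k) => [->|]; rewrite ?andbT // (negbTE ki) (negbTE kj).
by apply: IH; rewrite // mem_filter jw eq_sym kj.
Qed.

Definition first i j s := if before s i j then i else j.
Definition second i j s := if before s i j then j else i.

Lemma first_neq i j s : i != j -> first i j s != second i j s.
Proof. by rewrite /first /second; case: ifP => // _; rewrite eq_sym. Qed.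

Lemma index_codom s l : index l (codom s) = (s^-1)%g l.
Proof.
rewrite -{1}[l](permKV s) codomE index_map; last exact: perm_inj.
by rewrite index_enum_ord.
Qed.

Lemma uniq_codom s : uniq (codom s).
Proof. by rewrite codomE map_inj_uniq ?enum_uniq //; exact: perm_inj. Qed.

Lemma mem_codom_perm s l : l \in codom s.
Proof. by rewrite -[l](permKV s) codom_f. Qed.

Lemma before_sym s i j : i != j -> before s j i = ~~ before s i j.
Proof.
move=> ij; rewrite /before -leqNgt [in RHS]leq_eqVlt; case: eqVneq => //= h.
by case/eqP: ij; rewrite (perm_inj (val_inj h)).
Qed.

Lemma pair_sub_codom i j s : i != j -> pair_sub i j (codom s) = [:: first i j s; second i j s].
Proof.
suff H a b : a != b -> before s a b -> pair_sub a b (codom s) = [:: a; b].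
  move=> ij; rewrite /first /second; case: ifP => h; first exact: H.
  by rewrite pair_subC; apply: H; rewrite 1?eq_sym // before_sym // h.
move=> ab ba; have ua := uniq_codom s.
pose A := pair_sub a b (codom s).
have sA : sorted (fun x y => index x (codom s) < index y (codom s))%N A.
  apply: sorted_filter; first by move=> x y z; exact: ltn_trans.
  rewrite codomE sorted_map; have := iota_ltn_sorted 0 r; rewrite -val_enum_ord sorted_map.
  by congr sorted; apply/funext => x; apply/funext => y; rewrite /= -codomE !index_codom !permK.
have mA x : (x \in A) = (x == a) || (x == b).
  by rewrite mem_filter mem_codom_perm andbT.
have uA : uniq A by rewrite filter_uniq.
have pA : perm_eq A [:: a; b].
  by apply: uniq_perm => // [|x]; rewrite ?mA ?inE //= inE ab.
have : size A = 2%N by rewrite (perm_size pA).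
have := sA; have := mA a; have := mA b; rewrite !eqxx orbT /=.
rewrite -/A; case: A {sA pA} uA mA => [|x [|y [|z A]]] //=; rewrite !inE andbT.
move=> xy mA hb ha; rewrite andbT => lt _.
have xin := mA x; have yin := mA y; rewrite !inE !eqxx orbT /= in xin yin.
move: xin yin => /esym/orP[/eqP xa|/eqP xb] /esym/orP[/eqP ya|/eqP yb]; subst=> //.
- by rewrite eqxx in xy.
- by move: lt ba; rewrite !index_codom /before => h1 h2; have := ltn_trans h1 h2; rewrite ltnn.
- by rewrite eqxx in xy.
Qed.

Lemma pulled_perm_changes s w w' i j : i != j -> i \in w -> j \in w ->
  pulled (codom s) w w' ->
  (changes (first i j s :: pair_sub i j w') <= changes (first i j s :: pair_sub i j w))%N.
Proof.
move=> ij iw jw pw; rewrite /first; case: ifP => h.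
  by apply: pulled_changes pw; rewrite ?uniq_codom ?mem_codom_perm ?index_codom.
rewrite ![pair_sub i j _]pair_subC.
apply: pulled_changes pw; rewrite ?uniq_codom ?mem_codom_perm ?index_codom //.
by have := before_sym s ij; rewrite h.
Qed.

Lemma changes_first i j (ws : seq 'S_r) : i != j ->
  changes [seq first i j s | s <- ws] = changes [seq before s i j | s <- ws].
Proof.
move=> ij; rewrite -(@changes_map_inj _ _ (fun b : bool => if b then i else j)).
  by rewrite -map_comp.
by move=> [] [] _ _ // /eqP; rewrite ?(negbTE ij) // eq_sym (negbTE ij).
Qed.

(** ** Occurrences *)

Lemma mem_labels_from h f l k : ((l, k) \in labels_from h f) =
  (count_mem l h <= k < count_mem l h + count_mem l f)%N.
Proof.
elim: f h => [|a f IH] h /=; first by rewrite addn0; case: ltngtP.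
rewrite inE IH /= xpair_eqE; case: (eqVneq l a) => [->|la] /=.
  by apply/idP/idP; lia.
by rewrite !add0n.
Qed.

Lemma uniq_labels_from h f : uniq (labels_from h f).
Proof.
elim: f h => //= a f IH h; rewrite IH andbT mem_labels_from /= eqxx add1n.
by rewrite ltnn.
Qed.

Lemma labels_from_cat h f f' : labels_from h (f ++ f') =
  labels_from h f ++ labels_from (rev f ++ h) f'.
Proof. by elim: f h => //= a f IH h; rewrite IH rev_cons cat_rcons. Qed.

Lemma labels_split f A l k B : labels f = A ++ (l, k) :: B ->
  forall k', (k' < k)%N -> (l, k') \in A.
Proof.
move=> E k' kk; have fE := labels_fst f; rewrite E map_cat /= in fE.
have := labels_from_cat [::] (unzip1 A) (l :: unzip1 B).
rewrite -/(labels _) /unzip1 fE E => /eqP; rewrite eqseq_cat; last first.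
  by rewrite -/(labels _) -[RHS](size_map fst) labels_fst size_map.
move=> /andP[/eqP AE /eqP [kE _]]; rewrite AE mem_labels_from /=.
by move: kk; rewrite kE cats0 count_rev.
Qed.

Variables (m : nat) (f : seq 'I_r).
Hypothesis f_count : forall l, count_mem l f = m.+1.

Lemma mem_labels l k : ((l, k) \in labels f) = (k <= m)%N.
Proof. by rewrite mem_labels_from /= add0n f_count ltnS. Qed.

(** Every letter has an occurrence number [q], exactly one; so these form the
    one line notation of a permutation. *)
Lemma vertex_seq_perm q : (q <= m)%N ->
  codom (perm_of_seq (vertex_seq (fun=> q) f)) = vertex_seq (fun=> q) f.
Proof.
move=> qm; have u : uniq (vertex_seq (fun=> q) f).
  rewrite map_inj_in_uniq ?filter_uniq ?uniq_labels_from //.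
  by move=> [a b] [c e]; rewrite !mem_filter /= => /andP[/eqP -> _] /andP[/eqP -> _] ->.
apply: codom_perm_of_seq => //; rewrite -[RHS](card_ord r) -(card_uniqP u).
apply: eq_card => l; rewrite inE; apply/mapP; exists (l, q) => //.
by rewrite mem_filter /= eqxx mem_labels.
Qed.

Definition vertex_perm q := perm_of_seq (vertex_seq (fun=> q) f).

Variables (i j : 'I_r).
Hypothesis ij : i != j.

Definition late q := [seq p <- labels f | ((p.1 == i) || (p.1 == j)) && (q <= p.2)%N].

(** An occurrence with number larger than [q] comes after the occurrence of the
    same letter with number [q], so that the first late occurrence has number
    [q]. *)
Lemma late_head q : (q <= m)%N ->
  exists2 L, late q = (first i j (vertex_perm q), q) :: L &
    [seq p.1 | p <- L & p.2 == q] = [:: second i j (vertex_perm q)].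
Proof.
move=> qm; have E : [seq p.1 | p <- late q & p.2 == q] =
    [:: first i j (vertex_perm q); second i j (vertex_perm q)].
  rewrite -pair_sub_codom // vertex_seq_perm // /pair_sub /vertex_seq filter_map.
  rewrite /late -!filter_predI; congr map; apply: eq_filter => p /=.
  by case: (eqVneq p.2 q) => [->|]; rewrite ?leqnn ?andbT ?andbF.
case EL: (late q) E => [|[l k] L] //=.
have lk : (l, k) \in late q by rewrite EL mem_head.
have := lk; rewrite mem_filter /= => /andP[/andP[lij qk] _].
case: eqVneq => [->|kq] /=; first by case=> -> E; exists L.
have [A [B [EAB EA]]] : exists A B, labels f = A ++ (l, k) :: B /\
    [seq p <- A | ((p.1 == i) || (p.1 == j)) && (q <= p.2)%N] = [::].
  move: EL; rewrite /late; elim: (labels f) => //= p s IH.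
  case: ifP => h; first by case=> -> _; exists [::], s.
  by move=> /IH[A [B [-> EA]]]; exists (p :: A), B; rewrite /= h EA.
have qk' : (q < k)%N by rewrite ltn_neqAle eq_sym kq.
have := labels_split EAB qk' => qA.
have : (l, q) \in [seq p <- A | ((p.1 == i) || (p.1 == j)) && (q <= p.2)%N].
  by rewrite mem_filter /= lij leqnn.
by rewrite EA.
Qed.

Lemma late_succ q : late q.+1 = [seq p <- late q | (q < p.2)%N].
Proof.
rewrite /late -filter_predI; apply: eq_filter => p /=.
by case: (ltnP q p.2) => h; rewrite ?andbF //= !andbT (ltnW h) andbT.
Qed.

(** The permutations at the vertices before [q] and the occurrences from [q] on
    can be read off from one subsequence of [f]; so together they do not have
    more changes than [f]. *)
Lemma subseq_late q : (q <= m)%N ->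
  subseq ([seq first i j (vertex_perm t) | t <- iota 0 q] ++ unzip1 (late q))
    (pair_sub i j f).
Proof.
elim: q => [|q IH] qm.
  rewrite /= /pair_sub -[X in subseq _ [seq _ <- X | _]](labels_fst f) filter_map.
  rewrite /late /unzip1.
  by under eq_filter => p do rewrite andbT.
apply: subseq_trans (IH (ltnW qm)).
rewrite -addn1 iotaD map_cat -catA; apply: cat_subseq => //=.
have [L EL _] := late_head (ltnW qm); rewrite addn1 late_succ EL /= ltnn eqxx.
by rewrite map_subseq // filter_subseq.
Qed.

Lemma subseq_firsts q : (q <= m)%N ->
  subseq ([seq first i j (vertex_perm t) | t <- iota 0 q.+1] ++
          [:: second i j (vertex_perm q)]) (pair_sub i j f).
Proof.
move=> qm; apply: subseq_trans (subseq_late qm).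
rewrite -addn1 iotaD map_cat -catA; apply: cat_subseq => //=.
have [L -> E] := late_head qm; rewrite /= eqxx -E.
by rewrite map_subseq // filter_subseq.
Qed.

End Pairs.

(** * Weights on the vertices of simplices *)

Section Weights.
Variable R : realType.
Implicit Types (t x y : nat -> R) (tau rho : R).

Definition cum t q : R := \sum_(0 <= i < q) t i.

Definition simplex n t := (forall i, (i <= n)%N -> 0 <= t i) /\ cum t n.+1 = 1.

(** The push-forward of barycentric coordinates. The fibers of a monotone map are
    intervals, so that partial sums are pushed forward to partial sums. *)
Definition push m n (a : dmap m n) t j : R :=
  \sum_(i <- iota (below a j) (fiber a j)) t i.

Lemma cum0 t : cum t 0 = 0.
Proof. by rewrite /cum big_geq. Qed.

Lemma cumS t q : cum t q.+1 = cum t q + t q.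
Proof. by rewrite /cum big_nat_recr. Qed.

Lemma below_le m n (a : dmap m n) j j' : (j <= j')%N -> (below a j <= below a j')%N.
Proof.
move=> jj; apply: subset_leq_card; apply/fintype.subsetP => u; rewrite !inE => h.
exact: leq_trans h jj.
Qed.

Lemma below_max m n (a : dmap m n) j : (below a j <= m.+1)%N.
Proof. by rewrite -[X in (_ <= X)%N](card_ord m.+1) max_card. Qed.

Lemma cum_below m n (a : dmap m n) t j : cum (push a t) j = cum t (below a j).
Proof.
elim: j => [|j IH]; first by rewrite below0 !cum0.
rewrite cumS IH belowS /cum /push [RHS](big_cat_nat (n := below a j)) ?leq_addr //=.
by rewrite {3}/index_iota addKn.
Qed.

Lemma pushE m n (a : dmap m n) t j : push a t j = cum t (below a j.+1) - cum t (below a j).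
Proof. by rewrite -!cum_below cumS addrAC subrr add0r. Qed.

Lemma mem_iota_below m n (a : dmap m n) j i :
  i \in iota (below a j) (fiber a j) -> (i <= m)%N.
Proof.
rewrite mem_iota -belowS => /andP[_ h]; rewrite -ltnS.
exact: leq_trans h (below_max _ _).
Qed.

Lemma push_sum m n (a : dmap m n) t (j : 'I_n.+1) :
  push a t j = \sum_(i < m.+1 | a i == j) t i.
Proof.
rewrite /push (eq_bigl (fun i : 'I_m.+1 => val i \in iota (below a j) (fiber a j))).
  rewrite -(big_mkord (fun i => i \in iota (below a j) (fiber a j)) t) -big_filter.
  apply: perm_big; apply: uniq_perm; rewrite ?filter_uniq ?iota_uniq // => i.
  rewrite mem_filter mem_index_iota /=; case: (boolP (i \in _)) => //= h.
  by rewrite ltnS (mem_iota_below h).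
by move=> i; rewrite mem_fiber.
Qed.

Lemma cum_ge0 n t q : (forall i, (i <= n)%N -> 0 <= t i) -> (q <= n.+1)%N -> 0 <= cum t q.
Proof.
move=> t0 qn; rewrite /cum big_nat; apply: sumr_ge0 => i /andP[_ iq].
by apply: t0; rewrite -ltnS (leq_trans iq).
Qed.

Lemma cum_le n t q q' : (forall i, (i <= n)%N -> 0 <= t i) ->
  (q <= q')%N -> (q' <= n.+1)%N -> cum t q <= cum t q'.
Proof.
move=> t0 qq qn; rewrite /cum [X in _ <= X](big_cat_nat (n := q)) //= lerDl.
rewrite big_nat; apply: sumr_ge0 => i /andP[_ iq].
by apply: t0; rewrite -ltnS (leq_trans iq).
Qed.

Lemma push_ge0 m n (a : dmap m n) t j : (forall i, (i <= m)%N -> 0 <= t i) ->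
  0 <= push a t j.
Proof.
move=> t0; rewrite /push big_seq; apply: sumr_ge0 => i /mem_iota_below; exact: t0.
Qed.

Lemma push_eq m n (a : dmap m n) t t' j : (forall i, (i <= m)%N -> t i = t' i) ->
  push a t j = push a t' j.
Proof. by move=> tt; apply: eq_big_seq => i /mem_iota_below; exact: tt. Qed.

Lemma simplex_push m n (a : dmap m n) t : simplex m t -> simplex n (push a t).
Proof.
case=> t0 t1; split; first by move=> i _; exact: push_ge0.
by rewrite cum_below below_all.
Qed.

Lemma count_iota_lt (P : pred nat) n j : (j < n)%N ->
  (forall u v, (u < v)%N -> (v <= n)%N -> P v -> P u) ->
  (count P (iota 1 n) < j.+1)%N = ~~ P j.+1.
Proof.
move=> jn mono; rewrite -(subnKC (ltnW jn)) iotaD count_cat add1n.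
have [Pj|nPj] := boolP (P j.+1); apply/idP/idP => //.
  rewrite -leqNgt -(subnSK jn) /= Pj.
  have -> : count P (iota 1 j) = j.
    rewrite -[RHS](size_iota 1); apply/eqP; rewrite -all_count; apply/allP => u.
    by rewrite mem_iota add1n => /andP[_ uj]; apply: mono Pj.
  by rewrite add1n addnS ltnS leq_addr.
have -> : count P (iota j.+1 (n - j)) = 0%N.
  apply/eqP; rewrite -leqn0 leqNgt -has_count; apply/hasPn => u.
  rewrite mem_iota => /andP[ju un]; apply: contra nPj => Pu.
  by move: ju; rewrite leq_eqVlt => /orP[/eqP ->//|ju]; apply: mono Pu => //; lia.
by rewrite addn0 ltnS -[X in (_ <= X)%N](size_iota 1) count_size.
Qed.

(** ** Common refinement *)

(** The simplex is the interval [0, 1], cut at the partial sums; cutting at the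
    partial sums of several families of weights refines all of them. *)
Lemma common_refinement (I : finType) (n : I -> nat) (y : I -> nat -> R) :
  (forall i, simplex (n i) (y i)) ->
  exists p (t : nat -> R) (a : forall i, dmap p (n i)),
    [/\ simplex p t, forall q, (q <= p)%N -> 0 < t q,
        forall i j, (j <= n i)%N -> push (a i) t j = y i j &
        (p <= \sum_i n i)%N].
Proof.
move=> sy.
pose B := 0 :: flatten [seq [seq cum (y i) j | j <- iota 1 (n i)] | i <- enum I].
pose c := sort <=%R (undup [seq b <- B | b < 1]).
have mem_c b : (b \in c) = (b < 1) && (b \in B) by rewrite mem_sort mem_undup mem_filter.
have c0 : 0 \in c by rewrite mem_c ltr01 mem_head.
have sc : sorted <%R c by rewrite lt_sorted_uniq_le sort_uniq undup_uniq sort_le_sorted.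
have B0 b : b \in B -> 0 <= b.
  rewrite inE => /orP[/eqP -> //|/flatten_mapP[i _ /mapP[j]]].
  rewrite mem_iota add1n ltnS => /andP[_ jn] ->; apply: (cum_ge0 (sy i).1).
  exact: ltnW.
have sz : (0 < size c)%N by case: (c) c0.
pose p := (size c).-1; have pE : size c = p.+1 by rewrite /p prednK.
(* the default value makes 1 the end of the last piece *)
pose C q := nth 1 c q.
have C0 : C 0%N = 0.
  apply/eqP; rewrite eq_le; apply/andP; split; last first.
    by apply: B0; have := mem_nth 1 sz; rewrite mem_c => /andP[].
  have := c0; move/(nthP 1) => [q qc <-].
  have [->//|q0] := posnP q.
  by apply: ltW; apply: (sorted_ltn_nth lt_trans 1 sc) => //; rewrite inE.
have Clt q q' : (q < q')%N -> (q' <= p.+1)%N -> C q < C q'.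
  move=> qq; rewrite leq_eqVlt => /orP[/eqP e|q'p].
    have qc : (q < size c)%N by rewrite pE -e.
    rewrite e {2}/C nth_default ?pE //.
    by have := mem_nth 1 qc; rewrite mem_c => /andP[].
  by apply: (sorted_ltn_nth lt_trans 1 sc) => //; rewrite inE pE // (ltn_trans qq).
pose t q := C q.+1 - C q.
have cumt q : cum t q = C q.
  by elim: q => [|q IH]; rewrite ?cum0 ?C0 // cumS IH /t addrC subrK.
have t_gt0 q : (q <= p)%N -> 0 < t q by move=> qp; rewrite subr_gt0 Clt.
(* the piece of [y i] in which the piece [q] of the refinement lies *)
pose A i (q : nat) := count (fun j => cum (y i) j <= C q) (iota 1 (n i)).
have An i q : (A i q <= n i)%N by rewrite -[X in (_ <= X)%N](size_iota 1) count_size.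
have Amono i (q q' : 'I_p.+1) : (q <= q')%N ->
    ((inord (A i q) : 'I_(n i).+1) <= (inord (A i q') : 'I_(n i).+1))%N.
  move=> qq; rewrite !inordK ?ltnS ?An //; apply: sub_count => j /= /le_trans; apply.
  by move: qq; rewrite leq_eqVlt => /orP[/eqP ->//|qq]; apply/ltW/Clt; rewrite // ltnW.
pose a i : dmap p (n i) := mkdmap (@Amono i).
have aE i (q : 'I_p.+1) : a i q = A i q :> nat by rewrite ffunE inordK // ltnS.
have Alt i (q : nat) j : (0 < j)%N -> (j <= n i)%N ->
    (A i q < j)%N = (C q < cum (y i) j).
  case: j => // j _ jn; rewrite /A count_iota_lt // ?ltNge // => u v uv vn /=.
  by apply: le_trans; apply: (cum_le (sy i).1) => //; exact: ltnW.
have key i j : (j <= (n i).+1)%N -> cum t (below (a i) j) = cum (y i) j.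
  case: (posnP j) => [-> _|j0]; first by rewrite below0 !cum0.
  rewrite leq_eqVlt => /orP[/eqP ->|].
    by rewrite below_all // (sy i).2 cumt /C nth_default // pE.
  rewrite ltnS => jn; rewrite cumt.
  have bP (q : nat) : (q <= p)%N -> (q < below (a i) j)%N = (C q < cum (y i) j).
    by move=> qp; rewrite -(Alt i q j j0 jn) -(aE i (Ordinal (qp : (q < p.+1)%N))) -below_lt.
  have bp := below_max (a i) j.
  have le1 : cum (y i) j <= 1 by rewrite -(sy i).2; apply: (cum_le (sy i).1) => //; exact: leqW.
  have [e1|n1] := eqVneq (cum (y i) j) 1.
    suff -> : below (a i) j = p.+1 by rewrite e1 /C nth_default // pE.
    apply/eqP; rewrite eqn_leq bp /= bP // e1.
    have pc : (p < size c)%N by rewrite pE.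
    by have := mem_nth 1 pc; rewrite mem_c => /andP[].
  have : cum (y i) j \in c.
    rewrite mem_c lt_neqAle n1 le1 /= inE; apply/orP; right.
    apply/flatten_mapP; exists i; first by rewrite mem_enum.
    by apply/mapP; exists j => //; rewrite mem_iota add1n ltnS j0.
  move/(nthP 1) => [b bc cb]; rewrite pE ltnS in bc.
  suff -> : below (a i) j = b by exact: cb.
  apply/eqP; rewrite eqn_leq; apply/andP; split; rewrite leqNgt; apply/negP => h.
    by have := bP b bc; rewrite h -cb ltxx.
  have h' : (below (a i) j <= p)%N := leq_trans (ltnW h) bc.
  have := bP _ h'; rewrite ltnn -cb; have := Clt _ _ h (leqW bc).
  by rewrite /C => ->.
exists p, t, a; split=> //.
- split; last by rewrite cumt /C nth_default // pE.
  by move=> q qp; exact/ltW/t_gt0.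
- by move=> i j jn; rewrite pushE !key ?(leqW jn) // cumS addrAC subrr add0r.
- rewrite -ltnS -pE size_sort (leq_trans (size_undup _)) // size_filter.
  rewrite (leq_trans (count_size _ _)) // /B /= ltnS size_flatten /shape -map_comp.
  rewrite sumnE big_map big_enum /= leq_eqVlt; apply/orP; left; apply/eqP.
  by apply: eq_bigr => i _; rewrite size_map size_iota.
Qed.

(** ** Cutting a simplex at a point of the interval *)

(** A point [tau] of the interval cuts the weights in those before [tau], [x],
    and those after it, [rho y] with [rho = 1 - tau]; [y] is normalized, so
    that it is not determined for [tau = 1]. *)
Definition cut n x rho y := [/\ forall i, (i <= n)%N -> 0 <= x i,
  0 <= rho, simplex n y, cum x n.+1 + rho = 1 &
  forall i j, (j < i)%N -> (i <= n)%N -> x i * (rho * y j) = 0].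

Lemma cut_exists n t tau : simplex n t -> 0 <= tau <= 1 ->
  exists x y, cut n x (1 - tau) y /\ forall i, t i = x i + (1 - tau) * y i.
Proof.
move=> [t0 t1] /andP[tau0 tau1].
pose x i := Num.min (Num.max (tau - cum t i) 0) (t i).
have xt i : x i <= t i by rewrite ge_min lexx orbT.
have x0 i : (i <= n)%N -> 0 <= x i.
  by move=> h; rewrite le_min t0 // le_max lexx orbT.
have cx q : (q <= n.+1)%N -> cum x q = Num.min tau (cum t q).
  elim: q => [|q IH] qn; first by rewrite !cum0; apply/esym/min_idPr.
  rewrite !cumS IH 1?ltnW // /x; have := t0 q qn.
  move: (cum t q) (t q) => c w w0; rewrite /Num.min /Num.max.
  by case: (ltP tau c) => ?; case: (ltP (tau - c) 0) => ?;
    do ?[case: ltP => /= ?]; lra.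
have sx : cum x n.+1 = tau by rewrite cx // t1; apply/min_idPl.
have orth i j : (j < i)%N -> (i <= n)%N -> x i * (t j - x j) = 0.
  move=> ji iN; have [->|xi] := eqVneq (x i) 0; first by rewrite mul0r.
  suff -> : x j = t j by rewrite subrr mulr0.
  have ti : cum t i < tau.
    rewrite ltNge; apply/negP => h; move/eqP: xi; apply.
    rewrite /x; have -> : Num.max (tau - cum t i) 0 = 0 by apply/max_idPr; rewrite subr_le0.
    by apply/min_idPl/t0.
  apply/min_idPr; rewrite le_max; apply/orP; left; rewrite lerBrDl -cumS.
  by apply: ltW; apply: le_lt_trans ti; apply: (cum_le t0) => //; exact: ltnW.
have [->|tau_ne] := eqVneq tau 1.
  exists t, t; split; last by move=> i; rewrite subrr mul0r addr0.
  by split; rewrite ?subrr ?t1 ?addr0 // => i j _ _; rewrite mul0r mulr0.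
have r0 : 1 - tau != 0 by rewrite subr_eq0 eq_sym.
have cE q : cum (fun i => (t i - x i) / (1 - tau)) q = (cum t q - cum x q) / (1 - tau).
  by rewrite /cum -mulr_suml sumrB.
exists x, (fun i => (t i - x i) / (1 - tau)); split; last first.
  by move=> i; rewrite mulrC divfK // addrC subrK.
split=> //; rewrite ?subr_ge0 //.
- split; last by rewrite cE sx t1 divff.
  by move=> i _; rewrite divr_ge0 ?subr_ge0.
- by rewrite sx addrC subrK.
- by move=> i j ji iN; rewrite [_ * (_ / _)]mulrC divfK // orth.
Qed.

(** The sum of [x] is fixed; if one of two such families were smaller
    somewhere, then it would be at most the other everywhere else. *)
Lemma cut_unique n x rho y x' y' : cut n x rho y -> cut n x' rho y' ->
  (forall i, (i <= n)%N -> x i + rho * y i = x' i + rho * y' i) ->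
  forall i, (i <= n)%N -> x i = x' i.
Proof.
have H x1 y1 x2 y2 : cut n x1 rho y1 -> cut n x2 rho y2 ->
  (forall i, (i <= n)%N -> x1 i + rho * y1 i = x2 i + rho * y2 i) ->
  forall i, (i <= n)%N -> x2 i <= x1 i.
  move=> [x10 r0 [y10 _] s1 o1] [x20 _ [y20 _] s2 o2] E i iN.
  rewrite leNgt; apply/negP => lt12.
  have le j : (j <= n)%N -> x1 j <= x2 j.
    move=> jn; case: (ltngtP j i) => [ji|ij|-> //]; last exact: ltW.
      have : rho * y2 j = 0.
        have := o2 i j ji iN; move/eqP; rewrite mulf_eq0 => /orP[/eqP x0|/eqP //].
        by have := x10 i iN; rewrite leNgt -x0 lt12.
      have := E j jn; have := mulr_ge0 r0 (y10 j jn); lra.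
    have : 0 < rho * y1 i by have := E i iN; have := mulr_ge0 r0 (y20 i iN); lra.
    move=> ry; have := o1 j i ij jn; move/eqP; rewrite mulf_eq0 (gt_eqF ry) orbF.
    by move/eqP->; exact: x20.
  have : cum x1 n.+1 < cum x2 n.+1.
    rewrite /cum !big_mkord (bigD1 (Ordinal (iN : (i < n.+1)%N))) //=.
    rewrite [X in _ < X](bigD1 (Ordinal (iN : (i < n.+1)%N))) //=.
    by apply: ltr_leD => //; apply: ler_sum => j _; apply: le; rewrite -ltnS.
  lra.
move=> c c' E i iN; apply/eqP; rewrite eq_le; apply/andP; split.
  by apply: (H _ _ _ _ c' c) => // j jn; rewrite E.
exact: (H _ _ _ _ c c').
Qed.

Lemma cut_push m n (a : dmap m n) x rho y : cut m x rho y ->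
  cut n (push a x) rho (push a y).
Proof.
case=> x0 r0 sy s o; split=> //.
- by move=> i _; exact: push_ge0.
- exact: simplex_push.
- by rewrite cum_below below_all.
- move=> i j ji iN; rewrite /push mulr_sumr mulr_suml big_seq big1 // => u ui.
  rewrite mulr_sumr big_seq big1 // => v vj; apply: o; last exact: mem_iota_below ui.
  move: ui vj; rewrite !mem_iota -!belowS => /andP[bi _] /andP[_ bj].
  exact: leq_trans bj (leq_trans (below_le a ji) bi).
Qed.

End Weights.

(** * Simplicial sets of words *)

(** A simplicial set whose simplices are words; a letter of the word of an
    [n]-simplex is decorated by one of the vertices [0, ..., n], which are
    determined by the preceding letters. The operators act by repeating every
    decorated letter along the fiber over its vertex. *)
Record coding (X : sset) (T : choiceType) := Coding {
  lam : forall n, X n -> seq (T * nat);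
  lab : seq T -> T -> nat;
  lam_decorate : forall n (x : X n), lam x = decorate lab [::] (unzip1 (lam x));
  lam_inj : forall n (x x' : X n), unzip1 (lam x) = unzip1 (lam x') -> x = x';
  lam_bound : forall n (x : X n), all (fun p => p.2 <= n)%N (lam x);
  lam_op : forall m n (a : dmap m n) (x : X n), lam (sop a x) =
    flatten [seq [seq (p.1, t) | t <- iota (below a p.2) (fiber a p.2)] | p <- lam x] }.

Section CodedSets.
Variables (R : realType) (X : sset) (T : choiceType) (C : coding X T).
Implicit Types (t : nat -> R).

Definition sigc n (x : X n) t : signature R T := sig (weigh (fun=> t) (lam C x)).

Lemma sigc_eq n (x : X n) t t' : (forall i, (i <= n)%N -> t i = t' i) ->
  sigc x t = sigc x t'.
Proof.
move=> tt; congr sig; apply/eq_in_map => p /(allP (lam_bound C x)) pn.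
by rewrite tt.
Qed.

Lemma expm_iota (k : T) t s z :
  foldr (fun p => expm p.1 p.2) z [seq (k, t i) | i <- s] =
  expm k (\sum_(i <- s) t i) z.
Proof.
elim: s => [|i s IH] /=; first by rewrite big_nil expm0.
by rewrite IH expmD big_cons.
Qed.

Lemma sigc_op m n (a : dmap m n) (x : X n) t : sigc (sop a x) t = sigc x (push a t).
Proof.
rewrite /sigc lam_op; elim: (lam C x) => //= p s IH.
rewrite /weigh map_cat sig_cat -map_comp expm_iota -/(weigh _ _) IH //.
Qed.

Lemma weigh_nonneg n (x : X n) t : (forall i, (i <= n)%N -> 0 <= t i) ->
  nonneg (weigh (fun=> t) (lam C x)).
Proof.
move=> t0; apply/allP => _ /mapP[p px ->] /=; apply: t0.
exact: (allP (lam_bound C x)).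
Qed.

Lemma weigh_positive n (x : X n) t : (forall i, (i <= n)%N -> 0 < t i) ->
  positive (weigh (fun=> t) (lam C x)).
Proof.
move=> t0; apply/allP => _ /mapP[p px ->] /=; apply: t0.
exact: (allP (lam_bound C x)).
Qed.

(** Equality of signatures is generated by the gluing relation: on a common
    refinement with positive weights the two words are equal. *)
Lemma sigc_common n n' (x : X n) (x' : X n') t t' :
  simplex n t -> simplex n' t' -> sigc x t = sigc x' t' ->
  exists p s (a : dmap p n) (a' : dmap p n'),
  [/\ simplex p s, forall i, (i <= n)%N -> push a s i = t i,
      forall i, (i <= n')%N -> push a' s i = t' i & sop a x = sop a' x'].
Proof.
move=> st st' E; pose nn (b : bool) := if b then n else n'.
pose tt (b : bool) := if b then t else t'.
have stt b : simplex (nn b) (tt b) by case: b.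
have [p [s [a [sp s0 pa _]]]] := common_refinement stt.
exists p, s, (a true), (a false); split=> //.
- exact: (pa true).
- exact: (pa false).
apply: (lam_inj (c := C)); apply: (@sig_cancel R T (lab C) (fun=> s) [::]).
- by rewrite -lam_decorate; exact: weigh_positive.
- by rewrite -lam_decorate; exact: weigh_positive.
rewrite -!lam_decorate -/(sigc _ s) -/(sigc (sop _ x') s) !sigc_op.
by rewrite (sigc_eq x (pa true)) (sigc_eq x' (pa false)).
Qed.

(** ** The realization *)

(* The barycentric coordinates are indexed by all natural numbers, to avoid
   dependent types; they are 0 out of range. *)
Definition wt n (t : splx R n) (i : nat) : R :=
  if (i < n.+1)%N then set_val t ord0 (inord i) else 0.

Lemma wt_ord n (t : splx R n) (i : 'I_n.+1) : wt t i = set_val t ord0 i.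
Proof. by rewrite /wt ltn_ord inord_val. Qed.

Lemma wt_simplex n (t : splx R n) : simplex n (wt t).
Proof.
have [t0 t1] : @splx_set R n (set_val t) by apply: set_valP.
split; first by move=> i iN; rewrite /wt ltnS iN t0.
by rewrite /cum big_mkord -[RHS]t1; apply: eq_bigr => i _; rewrite wt_ord.
Qed.

Lemma wt_push m n (a : dmap m n) (t : splx R m) i : (i <= n)%N ->
  wt (splx_push a t) i = push a (wt t) i.
Proof.
rewrite -ltnS => iN; rewrite -[i]/(nat_of_ord (Ordinal iN)) wt_ord push_sum mxE.
by apply: eq_bigr => j _; rewrite wt_ord.
Qed.

Lemma mksplx n t : simplex n t -> exists u : splx R n, forall i, (i <= n)%N -> wt u i = t i.
Proof.
move=> [t0 t1].
have h : (\row_(i < n.+1) t i) \in @splx_set R n.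
  rewrite inE; split; first by move=> i; rewrite mxE t0 // -ltnS.
  by rewrite -[RHS]t1 /cum big_mkord; apply: eq_bigr => i _; rewrite mxE.
exists (exist (fun u => u \in @splx_set R n) _ h : splx R n) => i; rewrite -ltnS => iN.
by rewrite -[i]/(nat_of_ord (Ordinal iN)) wt_ord mxE.
Qed.

Lemma splx_eq n (t u : splx R n) : (forall i, (i <= n)%N -> wt t i = wt u i) -> t = u.
Proof.
move=> E; apply: val_inj; apply/rowP => i; have := E i.
by rewrite -ltnS ltn_ord !wt_ord => ->.
Qed.

Lemma wt_continuous n i : continuous (fun t : splx R n => wt t i).
Proof.
rewrite /wt; case: (i < n.+1)%N; last exact: cst_continuous.
move=> t /=; apply: (@cvg_comp _ _ _ _ (fun M : 'rV[R]_n.+1 => M ord0 (inord i))).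
  exact: initial_continuous.
exact: coord_continuous.
Qed.

Lemma compact_splx n : compact [set: splx R n].
Proof.
have cA : compact (@splx_set R n).
  have cB : compact [set v : 'rV[R]_n.+1 | forall i, `[0, 1]%classic (v ord0 i)].
    exact: (@rV_compact R n.+1 (fun=> `[0, 1]%classic) (fun=> @segment_compact R 0 1)).
  apply: (subclosed_compact _ cB).
    rewrite (_ : @splx_set R n = (\bigcap_i [set t : 'rV[R]_n.+1 | 0 <= t ord0 i]) `&`
      [set t | \sum_i t ord0 i = 1]); last first.
      by rewrite eqEsubset; split=> t [h1 h2]; split=> // i; [move=> _|]; exact: h1.
    apply: closedI.
      apply: closed_bigI => i _; apply: (closed_comp _ (@closed_ge R 0)) => t _.
      exact: coord_continuous.
    apply: (closed_comp _ (@closed_eq R 1)) => t _.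
    by apply: (@cvg_bigsum R _ _ (nbhs t)) => i _; exact: coord_continuous.
  move=> t [t0 t1] i; rewrite /= in_itv /= t0 -t1 (bigD1 i) //= lerDl.
  exact: sumr_ge0.
move=> F PF _.
have GA : (set_val @ F) (@splx_set R n).
  by rewrite /=; apply: (@filterS _ F _ setT) filterT => t _; exact: set_valP.
have [a [Aa ca]] := cA _ (fmap_proper_filter set_val PF) GA.
exists (exist (fun u => u \in @splx_set R n) a (mem_set Aa) : splx R n); split=> // B U FB.
case=> _ [[V oV <-] /= Va VU].
have [||b [[/= t Bt <-] Vb]] := ca [set set_val t | t in B] V.
- by rewrite /=; apply: (@filterS _ F _ B) FB => t Bt; exists t.
- by apply: open_nbhs_nbhs; split.
- by exists t; split=> //; exact: VU.
Qed.

Definition cell_sig (p : cells R X) : signature R T :=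
  sigc (tagged (tag p)) (wt (tagged p)).

Definition real_sig (q : realization R X) := cell_sig (of_realization q).

Lemma real_sigE n (x : X n) (t : splx R n) :
  real_sig (to_realization (cell x t)) = sigc x (wt t).
Proof.
have H (u v : cells R X) : clos_refl_sym_trans _ (@Defs.glue R X) u v -> cell_sig u = cell_sig v.
  elim=> [_ _ [m n' a y s]|//|u' v' _ -> //|u' v' w' _ -> _ -> //].
  by rewrite /cell_sig /= sigc_op; apply: sigc_eq => i /(wt_push a s) ->.
apply: (H _ (cell x t)).
by apply/to_realizationP; rewrite of_realizationK.
Qed.

Lemma real_ind (P : realization R X -> Prop) :
  (forall n (x : X n) (t : splx R n), P (to_realization (cell x t))) -> forall q, P q.
Proof.
by move=> H q; rewrite -(of_realizationK q); case: (of_realization q) => -[n x] t; exact: H.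
Qed.

Lemma real_sig_inj : injective real_sig.
Proof.
elim/real_ind => n x t; elim/real_ind => n' x' t'; rewrite !real_sigE => E.
have [p [s [a [a' [sp sa sa' ex]]]]] := sigc_common (wt_simplex t) (wt_simplex t') E.
have [u uE] := mksplx sp.
have ta : splx_push a u = t.
  by apply: splx_eq => i iN; rewrite wt_push // -sa //; apply: push_eq.
have ta' : splx_push a' u = t'.
  by apply: splx_eq => i iN; rewrite wt_push // -sa' //; apply: push_eq.
apply/to_realizationP; apply: (@rst_trans _ _ _ (cell (sop a x) u)).
  by apply: rst_sym; rewrite -ta; apply: rst_step; exact: Glue.
by rewrite ex -ta'; apply: rst_step; exact: Glue.
Qed.

Lemma cell_continuous n (x : X n) :
  continuous (fun t : splx R n => to_realization (cell x t)).
Proof.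
move=> t; apply: (@cvg_comp _ _ _ (@cell R X n x) (@to_realization R X)).
  exact: (@existT_continuous _ (fun y : {n : nat & X n} => splx R (tag y))
    (Tagged (fun n => X n) x)).
exact: pi_continuous.
Qed.

Lemma real_continuous (S : topologicalType) (f : realization R X -> S) :
  (forall n (x : X n), continuous (fun t : splx R n => f (to_realization (cell x t)))) ->
  continuous f.
Proof.
move=> cf; apply/quotient_continuous.
by move=> [[n x] t] U nU; exact: (cf n x t U nU).
Qed.

Lemma weigh_cvg (U : Type) (F : set_system U) (f : U -> nat -> R) (g : nat -> R)
    (s : seq (T * nat)) : Filter F ->
  (forall i, f u i @[u --> F] --> g i) ->
  sig (weigh (fun=> f u) s) @[u --> F] --> sig (weigh (fun=> g) s).
Proof.
move=> FF fg; elim: s => [|p s IH] /=; first exact: cvg_cst.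
exact: expm_cvg.
Qed.

Lemma real_sig_continuous : continuous real_sig.
Proof.
apply: real_continuous => n x.
have -> : (fun t : splx R n => real_sig (to_realization (cell x t))) =
    (fun t : splx R n => sigc x (wt t)) by apply/funext => t; rewrite real_sigE.
move=> t; apply: (@weigh_cvg _ (nbhs t) _ _ _ (nbhs_filter t)) => i.
exact: wt_continuous.
Qed.

Definition sig_image : set (signature R T) :=
  [set z | exists n (x : X n) t, simplex n t /\ sigc x t = z].

Lemma real_sig_image q : sig_image (real_sig q).
Proof.
elim/real_ind: q => n x t; rewrite real_sigE; exists n, x, (wt t); split=> //.
exact: wt_simplex.
Qed.

Lemma sig_image_real z : sig_image z -> exists q, real_sig q = z.
Proof.
case=> n [x [t [st <-]]]; have [u uE] := mksplx st.
by exists (to_realization (cell x u)); rewrite real_sigE; exact: sigc_eq.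
Qed.

(** Every point lies in a simplex of dimension [N], of which there are finitely
    many; so the realization is compact. *)
Definition bounded_dim N := (exists s : seq (X N), forall x, x \in s) /\
  forall z, sig_image z -> exists (x : X N) t, simplex N t /\ sigc x t = z.

Lemma compact_real N : bounded_dim N -> compact [set: realization R X].
Proof.
case=> -[s sP] HN.
have -> : [set: realization R X] =
    \big[setU/set0]_(x <- s) [set to_realization (cell x t) | t in [set: splx R N]].
  rewrite eqEsubset; split=> // q _.
  have [x [t [st E]]] := HN _ (real_sig_image q); have [u uE] := mksplx st.
  rewrite -bigcup_seq; exists x; first exact: sP.
  by exists u => //; apply: real_sig_inj; rewrite real_sigE -E; exact: sigc_eq.
apply: bigsetU_compact => x _; apply: continuous_compact; last exact: compact_splx.
by apply: continuous_subspaceT; exact: cell_continuous.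
Qed.

Definition real_of (z : signature R T) (q0 : realization R X) : realization R X :=
  xget q0 [set q | real_sig q = z].

Lemma real_ofK q0 z : sig_image z -> real_sig (real_of z q0) = z.
Proof. by move=> /sig_image_real ex; exact: (@xgetPex _ q0 [set q | real_sig q = z] ex). Qed.

Lemma real_sigK q0 q : real_of (real_sig q) q0 = q.
Proof. by apply: real_sig_inj; rewrite real_ofK //; exact: real_sig_image. Qed.

Lemma signature_hausdorff : hausdorff_space (signature R T).
Proof. by apply: ptws_hausdorff; exact: Rhausdorff. Qed.

(** The realization is compact and the space of power series is Hausdorff, so
    that the embedding is a homeomorphism onto its image. *)
Lemma real_of_continuous N q0 : bounded_dim N ->
  {within sig_image, continuous (fun z => real_of z q0)}.
Proof.
move=> bN; apply: (@continuous_of_compact_cover unit [:: tt] _ _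
  (fun=> realization R X) (fun=> setT) (fun=> real_sig) (fun=> id)).
- exact: signature_hausdorff.
- by move=> _; exact: compact_real bN.
- by move=> _; apply: continuous_subspaceT; exact: real_sig_continuous.
- by move=> _; apply: continuous_subspaceT => q; exact: cvg_id.
- by move=> _ q _; rewrite real_sigK.
- rewrite big_seq1 eqEsubset; split=> z.
    by move=> /sig_image_real[q qz]; exists q.
  by case=> q _ <-; exact: real_sig_image.
Qed.

Lemma compact_sig_image N : bounded_dim N -> compact sig_image.
Proof.
move=> bN; rewrite (_ : sig_image = real_sig @` setT).
  apply: continuous_compact; last exact: compact_real bN.
  by apply: continuous_subspaceT; exact: real_sig_continuous.
rewrite eqEsubset; split=> z; first by move=> /sig_image_real[q qz]; exists q.
by case=> q _ <-; exact: real_sig_image.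
Qed.

End CodedSets.

(** * Flows along words *)

(** ** Relative continuity *)

Section Within.

Lemma within_comp (U V W : topologicalType) (K : set U) (A : set V)
    (f : U -> V) (g : V -> W) :
  {within K, continuous f} -> {within A, continuous g} ->
  (forall x, K x -> A (f x)) -> {within K, continuous (fun x => g (f x))}.
Proof.
move=> /subspace_continuousP cf /subspace_continuousP cg KA.
apply/subspace_continuousP => x Kx O /(cg _ (KA _ Kx)).
rewrite /nbhs /= /within /= => /(cf _ Kx).
by rewrite /nbhs /= /within /=; apply: filterS => u h Ku; apply: (h Ku); exact: KA.
Qed.

Lemma within_pair (U V W : topologicalType) (K : set U) (f : U -> V) (g : U -> W) :
  {within K, continuous f} -> {within K, continuous g} ->
  {within K, continuous (fun x => (f x, g x))}.
Proof.
move=> /subspace_continuousP cf /subspace_continuousP cg.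
apply/subspace_continuousP => x Kx; have FF := within_filter K (nbhs_filter x).
by apply: cvg_pair; [exact: cf|exact: cg].
Qed.

End Within.

(** ** Actions of letters, and of words *)

Section Flows.
Variables (R : realType) (S : choiceType) (V : topologicalType) (Dm : set V).
Implicit Types (l : seq (S * R)) (v : V) (rho th : R) (k : S).

(** The unit interval acts as a monoid under [s + t - s t], which multiplies the
    proportions [1 - s] and [1 - t] that are left. As 1 acts by a constant map,
    the action factors through the cone over [Dm]; this is what makes flows
    continuous at the vertices of a simplex. *)
Record cone_action := ConeAction {
  act : S -> R -> V -> V;
  apex : S -> V;
  act_in : forall k th v, 0 <= th <= 1 -> Dm v -> Dm (act k th v);
  act0 : forall k v, Dm v -> act k 0 v = v;
  act1 : forall k v, Dm v -> act k 1 v = apex k;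
  actM : forall k th th' v, 0 <= th <= 1 -> 0 <= th' <= 1 -> Dm v ->
    act k th (act k th' v) = act k (th + th' - th * th') v;
  act_continuous : forall k,
    {within [set p | 0 <= p.1 <= 1 /\ Dm p.2], continuous (fun p => act k p.1 p.2)} }.

Variable A : cone_action.

Definition total l : R := \sum_(p <- l) p.2.

(** The letters act from the last one to the first one, by the proportion of
    their weight among what has come so far, of which [rho] is the share of
    [v]. By [flow_block] such flows are well defined on realizations. *)
Fixpoint flow l rho v : V :=
  if l is p :: l' then act A p.1 (p.2 / (p.2 + total l' + rho)) (flow l' rho v) else v.

Lemma total_cons p l : total (p :: l) = p.2 + total l.
Proof. by rewrite /total big_cons. Qed.

Lemma total_cat l l' : total (l ++ l') = total l + total l'.
Proof. by rewrite /total big_cat. Qed.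

Lemma total_ge0 l : nonneg l -> 0 <= total l.
Proof. by move=> nl; rewrite /total big_seq; apply: sumr_ge0 => p /(allP nl). Qed.

Lemma ratio_addr_itv (x M : R) : 0 <= x -> 0 <= M -> 0 <= x / (x + M) <= 1.
Proof. by move=> x0 M0; apply: ratio_itv => //; rewrite lerDl. Qed.

Lemma flow_in l rho v : nonneg l -> 0 <= rho -> Dm v -> Dm (flow l rho v).
Proof.
move=> + r0 Dv; elim: l => [//|p l IH] /= /andP[p0 nl].
apply: act_in; last exact: IH.
by rewrite -addrA; apply: ratio_addr_itv => //; rewrite addr_ge0 // total_ge0.
Qed.

Lemma flow_cat l l' rho v : flow (l ++ l') rho v = flow l (total l' + rho) (flow l' rho v).
Proof. by elim: l => //= p l ->; rewrite total_cat !addrA. Qed.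

Lemma flow_scale c l rho v : c != 0 ->
  flow [seq (p.1, c * p.2) | p <- l] (c * rho) v = flow l rho v.
Proof.
move=> c0; elim: l => //= p l ->; congr act.
have -> : total [seq (p.1, c * p.2) | p <- l] = c * total l.
  by rewrite /total big_map mulr_sumr.
by rewrite -!mulrDr invfM mulrACA divff // mul1r.
Qed.

Lemma flow_zero l rho v : nonneg l -> 0 <= rho -> Dm v -> total l = 0 -> flow l rho v = v.
Proof.
move=> + r0 Dv; elim: l => [//|p l IH] /= /andP[p0 nl].
rewrite total_cons => /eqP; rewrite paddr_eq0 ?total_ge0 // => /andP[/eqP -> /eqP E].
by rewrite IH // mul0r act0.
Qed.

Lemma flow_block k (s : seq R) l rho v : all (>= 0) s -> nonneg l -> 0 <= rho -> Dm v ->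
  flow ([seq (k, x) | x <- s] ++ l) rho v = flow ((k, \sum_(x <- s) x) :: l) rho v.
Proof.
move=> + nl r0 Dv; have Dw := flow_in nl r0 Dv.
elim: s => [_|x s IH] /=; first by rewrite big_nil mul0r act0.
case/andP=> x0 ns; rewrite IH //= big_cons total_cat.
have -> : total [seq (k, y) | y <- s] = \sum_(y <- s) y by rewrite /total big_map.
have S0 : 0 <= \sum_(y <- s) y by rewrite big_seq; apply: sumr_ge0 => y /(allP ns).
have T0 := total_ge0 nl.
move: (\sum_(y <- s) y) (total l) S0 T0 => a b a0 b0.
rewrite -!addrA actM ?ratio_addr_itv ?addr_ge0 //; congr act.
have [E|Dn] := eqVneq (a + (b + rho)) 0.
  move/eqP: E; rewrite paddr_eq0 ?addr_ge0 // => /andP[/eqP -> /eqP ->].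
  by rewrite !(addr0, mul0r, mulr0, subr0).
have Dn' : x + (a + (b + rho)) != 0.
  rewrite paddr_eq0 ?addr_ge0 // negb_and; apply/orP; right; exact: Dn.
by field; rewrite Dn Dn'.
Qed.

(** The last letter of nonzero weight acts by 1, hence as a constant map. *)
Lemma flow_const l v v' : nonneg l -> Dm v -> Dm v' -> 0 < total l ->
  flow l 0 v = flow l 0 v'.
Proof.
move=> + Dv Dv'; elim: l => [_|p l IH] /=; first by rewrite /total big_nil ltxx.
case/andP=> p0 nl; rewrite total_cons => t0.
have [E|l0] := eqVneq (total l) 0.
  rewrite E !addr0 in t0 *; rewrite divff ?gt_eqF // !act1 //; exact: flow_in.
by rewrite IH // lt_neqAle eq_sym l0 total_ge0.
Qed.

(** ** Continuity *)

(* The weights are a parameter with values in a fixed space, whatever the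
   length of the word. *)
Fixpoint lay (ss : seq S) (x : nat -> R) : seq (S * R) :=
  if ss is k :: ss' then (k, x 0%N) :: lay ss' (fun i => x i.+1) else [::].

Lemma total_lay ss x : total (lay ss x) = cum x (size ss).
Proof.
elim: ss x => [|k ss IH] x /=; first by rewrite /total big_nil cum0.
by rewrite total_cons IH /cum big_nat_recl.
Qed.

Lemma lay_scale ss c x : lay ss (fun i => c * x i) = [seq (p.1, c * p.2) | p <- lay ss x].
Proof. by elim: ss x => //= k ss IH x; rewrite IH. Qed.

Lemma lay_nonneg ss x : (forall i, 0 <= x i) -> nonneg (lay ss x).
Proof. by elim: ss x => //= k ss IH x x0; rewrite x0 IH. Qed.

Definition cube : set {ptws nat -> R} := [set x | forall i, `[0, 1]%classic (x i)].

Lemma compact_cube : compact cube.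
Proof.
exact: (@tychonoff nat (fun=> R) (fun=> `[0, 1]%classic) (fun=> @segment_compact R 0 1)).
Qed.

(* The coordinates of a simplex with an additional vertex, the second
   component; the others are extended by 0. *)
Definition bary n : set ({ptws nat -> R} * R) :=
  [set p | [/\ cube p.1, 0 <= p.2 <= 1, cum p.1 n + p.2 = 1 &
     forall i, (n <= i)%N -> p.1 i = 0]].

Lemma coord_cvg (U : Type) (F : set_system U) (f : U -> {ptws nat -> R}) (x : {ptws nat -> R}) i :
  Filter F -> f u @[u --> F] --> x -> f u i @[u --> F] --> x i.
Proof. by move=> FF h; exact: ptws_coord_cvg h. Qed.

Lemma cum_cvg (U : Type) (F : set_system U) (f : U -> {ptws nat -> R})
    (x : {ptws nat -> R}) n :
  Filter F -> f u @[u --> F] --> x -> cum (f u) n @[u --> F] --> cum x n.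
Proof. by move=> FF h; apply: cvg_bigsum => i _; exact: coord_cvg. Qed.

Lemma compact_bary n : compact (bary n).
Proof.
have c01 : compact (cube `*` `[(0 : R), 1]%classic).
  by apply: compact_setX; [exact: compact_cube|exact: segment_compact].
apply: (subclosed_compact _ c01); last first.
  by move=> p [h1 h2 _ _]; split; rewrite //= in_itv.
have cl : closed (cube `*` `[(0 : R), 1]%classic).
  apply: compact_closed => //; apply: prod_hausdorff; last exact: Rhausdorff.
  by apply: ptws_hausdorff; exact: Rhausdorff.
have -> : bary n = (cube `*` `[(0 : R), 1]%classic) `&`
    ([set p | cum p.1 n + p.2 = 1] `&` (\bigcap_(i in [set i | (n <= i)%N]) [set p | p.1 i = 0])).
  rewrite eqEsubset; split=> p.
    by case=> h1 h2 h3 h4; split; [split; rewrite //= in_itv|split].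
  by case=> -[h1 h2] [h3 h4]; split=> //; move: h2; rewrite /= in_itv.
apply: closedI => //; apply: closedI.
  apply: (closed_comp _ (@closed_eq R 1)) => -[x r] _.
  have c1 : p.1 @[p --> (x, r)] --> x by exact: cvg_fst.
  have c2 : p.2 @[p --> (x, r)] --> r by exact: cvg_snd.
  exact: (cvgD (cum_cvg (n := n) _ c1) c2).
apply: closed_bigI => i _; apply: (closed_comp _ (@closed_eq R 0)) => -[x r] _.
have c1 : p.1 @[p --> (x, r)] --> x by exact: cvg_fst.
exact: (@coord_cvg _ _ _ x i _ c1).
Qed.

(** Continuity of flows, by induction on the word: the simplex is parametrized
    by the interval and its face opposite to the first vertex; at [th = 1],
    where this parametrization degenerates, [act] is constant. *)
Lemma flow_continuous ss (Kv : set V) : hausdorff_space V -> compact Kv ->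
  Kv `<=` Dm ->
  {within bary (size ss) `*` Kv,
    continuous (fun p => flow (lay ss p.1.1) p.1.2 p.2)}.
Proof.
move=> hV cKv KvD; elim: ss => [|k ss IH].
  by apply: continuous_subspaceT => p; exact: cvg_snd.
pose K : set (R * (({ptws nat -> R} * R) * V)) :=
  `[0, 1]%classic `*` (bary (size ss) `*` Kv).
pose cns (th : R) (x : {ptws nat -> R}) : {ptws nat -> R} :=
  fun i => if i is j.+1 then (1 - th) * x j else th.
apply: (@continuous_of_compact_cover unit [:: tt] _ _
  (fun=> (R * (({ptws nat -> R} * R) * V))%type) (fun=> K)
  (fun _ q => ((cns q.1 q.2.1.1, (1 - q.1) * q.2.1.2), q.2.2))
  (fun _ q => act A k q.1 (flow (lay ss q.2.1.1) q.2.1.2 q.2.2))).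
- apply: prod_hausdorff => //; apply: prod_hausdorff; last exact: Rhausdorff.
  by apply: ptws_hausdorff; exact: Rhausdorff.
- move=> _; apply: compact_setX; first exact: segment_compact.
  by apply: compact_setX => //; exact: compact_bary.
- move=> _; apply: continuous_subspaceT => -[th [[x r] v]].
  have c1 : q.1 @[q --> (th, ((x, r), v))] --> th by exact: cvg_fst.
  have c2 : q.2 @[q --> (th, ((x, r), v))] --> ((x, r), v) by exact: cvg_snd.
  have c3 : q.2.1 @[q --> (th, ((x, r), v))] --> (x, r).
    by apply: cvg_comp c2 _; exact: cvg_fst.
  have c4 : q.2.1.1 @[q --> (th, ((x, r), v))] --> x.
    by apply: cvg_comp c3 _; exact: cvg_fst.
  have c5 : q.2.1.2 @[q --> (th, ((x, r), v))] --> r.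
    by apply: cvg_comp c3 _; exact: cvg_snd.
  have c6 : q.2.2 @[q --> (th, ((x, r), v))] --> v.
    by apply: cvg_comp c2 _; exact: cvg_snd.
  have c7 : 1 - q.1 @[q --> (th, ((x, r), v))] --> 1 - th.
    exact: (cvgB (cvg_cst _) c1).
  have c8 : cns q.1 q.2.1.1 @[q --> (th, ((x, r), v))] --> cns th x.
    by apply: ptws_cvgP => -[|i] //=; exact: (cvgM c7 (coord_cvg (i := i) _ c4)).
  have c9 : (1 - q.1) * q.2.1.2 @[q --> (th, ((x, r), v))] --> (1 - th) * r.
    exact: (cvgM c7 c5).
  have c10 : (cns q.1 q.2.1.1, (1 - q.1) * q.2.1.2) @[q --> (th, ((x, r), v))] -->
      (cns th x, (1 - th) * r) by exact: (cvg_pair c8 c9).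
  exact: (cvg_pair c10 c6).
- move=> _.
  have c1 : {within K, continuous (fun q => flow (lay ss q.2.1.1) q.2.1.2 q.2.2)}.
    have c2 : {within K, continuous (@snd R (({ptws nat -> R} * R) * V))}.
      by apply: continuous_subspaceT => q; exact: cvg_snd.
    by apply: (within_comp c2 IH) => q [].
  have c3 : {within K, continuous (@fst R (({ptws nat -> R} * R) * V))}.
    by apply: continuous_subspaceT => q; exact: cvg_fst.
  apply: (within_comp (within_pair c3 c1) (@act_continuous A k)).
  move=> [th [[x r] v]] [/= th01 [[/= cx /andP[r0 _] _ _] Kvv]].
  split; first by move: th01; rewrite in_itv.
  apply: flow_in => //; last exact: KvD.
  by apply: lay_nonneg => i; have := cx i; rewrite /= in_itv => /andP[].
- move=> _ [th [[x r] v]] [/= th01 [[/= cx /andP[r0 _] sx zx] /KvD Dv]].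
  move: th01; rewrite in_itv /= => /andP[th0 th1].
  have nx : nonneg (lay ss x).
    by apply: lay_nonneg => i; have := cx i; rewrite /= in_itv => /andP[].
  have -> : lay ss (fun i => (1 - th) * x i) = [seq (p.1, (1 - th) * p.2) | p <- lay ss x].
    exact: lay_scale.
  have -> : total [seq (p.1, (1 - th) * p.2) | p <- lay ss x] = (1 - th) * cum x (size ss).
    by rewrite -total_lay /total big_map mulr_sumr.
  rewrite -addrA -mulrDr sx mulr1 addrC subrK divr1.
  have [->|th_ne] := eqVneq th 1; last by rewrite flow_scale // subr_eq0 eq_sym.
  rewrite !act1 //; apply: flow_in => //; rewrite ?subrr ?mul0r //.
  by apply/allP => _ /mapP[q _ ->] /=; rewrite mul0r.
- rewrite big_seq1 eqEsubset; split=> [[[x r] v] [[/= cx /andP[r0 r1] sx zx] Kvv]|].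
    have x0 i : 0 <= x i by have := cx i; rewrite /= in_itv => /andP[].
    have x1 i : x i <= 1 by have := cx i; rewrite /= in_itv => /andP[].
    have sx' : x 0%N + (cum (fun i => x i.+1) (size ss) + r) = 1.
      by rewrite addrA -sx /cum big_nat_recl.
    have c0 : 0 <= cum (fun i => x i.+1) (size ss) by apply: sumr_ge0.
    (* at the vertex any point of the opposite face will do *)
    have [E|ne] := eqVneq (x 0%N) 1.
      have [cE rE] : cum (fun i => x i.+1) (size ss) = 0 /\ r = 0.
        by split; lra.
      have xE i : x i.+1 = 0.
        have [iss|ssi] := ltnP i (size ss); last by apply: zx.
        move/eqP: cE; rewrite /cum big_mkord psumr_eq0 //.
        by move=> /allP /(_ (Ordinal iss) (mem_index_enum _)) /= /eqP.
      exists (1, (((fun=> 0) : {ptws nat -> R}, 1), v)).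
        split; first by rewrite /= in_itv /= ler01 lexx.
        split=> //; split=> //=; rewrite ?ler01 ?lexx //.
          by move=> i; rewrite /= in_itv /= lexx ler01.
        by rewrite /cum big1 ?add0r.
      rewrite /= subrr mul0r rE; congr (_, _, _).
      by apply/funext => -[|i] /=; rewrite ?mulr0 ?xE ?E.
    have ne' : 1 - x 0%N != 0 by rewrite subr_eq0 eq_sym.
    have pos : 0 < 1 - x 0%N by rewrite lt_neqAle eq_sym ne' subr_ge0 x1.
    have sx2 : cum (fun i => x i.+1) (size ss) + r = 1 - x 0%N by lra.
    exists (x 0%N, (((fun i => x i.+1 / (1 - x 0%N)) : {ptws nat -> R}, r / (1 - x 0%N)), v)).
      split; first by rewrite /= in_itv /= x0 x1.
      split=> //; split=> /=.
      - move=> i; rewrite /= in_itv /= divr_ge0 ?(ltW pos) //= ler_pdivrMr // mul1r.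
        have [iss|ssi] := ltnP i (size ss); last by rewrite zx // ltW.
        rewrite -sx2 /cum big_mkord (bigD1 (Ordinal iss)) //= -addrA lerDl.
        by rewrite addr_ge0 // sumr_ge0.
      - by rewrite divr_ge0 ?(ltW pos) //= ler_pdivrMr // mul1r -sx2 lerDr.
      - by rewrite /cum -mulr_suml -mulrDl -/(cum (fun i => x i.+1) _) sx2 divff.
      - by move=> i ssi; rewrite zx ?mul0r.
    rewrite /=; congr (_, _, _); last by rewrite mulrC divfK.
    by apply/funext => -[|i] //=; rewrite mulrC divfK.
  move=> _ [[th [[x r] v]] [/= th01 [[/= cx /andP[r0 r1] sx zx] Kvv]] <-].
  move: th01; rewrite in_itv /= => /andP[th0 th1].
  have x0 i : 0 <= x i by have := cx i; rewrite /= in_itv => /andP[].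
  have x1 i : x i <= 1 by have := cx i; rewrite /= in_itv => /andP[].
  have t0' : 0 <= 1 - th by rewrite subr_ge0.
  have t1' : 1 - th <= 1 by rewrite gerBl.
  split=> //; split=> /=.
  + move=> [|i] /=; rewrite in_itv /=; first by rewrite th0 th1.
    by rewrite mulr_ge0 //= mulr_ile1.
  + by rewrite mulr_ge0 //= mulr_ile1.
  + rewrite /cum big_nat_recl // -mulr_sumr -addrA -mulrDr -/(cum x _) sx mulr1.
    by rewrite addrC subrK.
  + by move=> [|i] //= ssi; rewrite zx ?mulr0.
Qed.

End Flows.

(** * Homotopies from flows *)

Section Sweep.
Variables (R : realType) (S : choiceType) (V : topologicalType) (Dm : set V).
Variable A : cone_action R S Dm.
Variables (Y : sset) (CY : coding Y S).
Hypothesis CY_vertices : forall n (y : Y n), unzip2 (lam CY y) = iota 0 n.+1.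
Implicit Types (x y t : nat -> R).

Definition path n (w : Y n) x rho v : V := flow A (weigh (fun=> x) (lam CY w)) rho v.

Lemma path_eq n (w : Y n) x x' rho v : (forall i, (i <= n)%N -> x i = x' i) ->
  path w x rho v = path w x' rho v.
Proof.
move=> tt; congr flow; apply/eq_in_map => p /(allP (lam_bound CY w)) pn.
by rewrite tt.
Qed.

Lemma total_weigh n (w : Y n) x : total (weigh (fun=> x) (lam CY w)) = cum x n.+1.
Proof.
rewrite /total big_map /cum /index_iota subn0 -(CY_vertices w) big_map.
by apply: eq_bigr.
Qed.

Lemma path_op m n (a : dmap m n) (w : Y n) x rho v :
  (forall i, (i <= m)%N -> 0 <= x i) -> 0 <= rho -> Dm v ->
  path (sop a w) x rho v = path w (push a x) rho v.
Proof.
move=> x0 r0 Dv; rewrite /path lam_op.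
have : all (fun p => p.2 <= n)%N (lam CY w) := lam_bound CY w.
elim: (lam CY w) => //= p s IH /andP[pn sn].
have nn (q : seq (S * nat)) : nonneg (weigh (fun=> push a x) q).
  by apply/allP => _ /mapP[u _ ->] /=; exact: push_ge0.
rewrite {1}/weigh map_cat flow_cat -/(weigh _ _) IH // -map_comp.
set w' := flatten _.
have tw : total (weigh (fun=> x) w') = total (weigh (fun=> push a x) s).
  rewrite /w' /total !big_map big_flatten /= big_map; apply: eq_bigr => q _.
  by rewrite big_map.
rewrite /weigh in tw *; rewrite tw.
have -> : [seq (p.1, x i) | i <- iota (below a p.2) (fiber a p.2)] =
    [seq (p.1, c) | c <- [seq x i | i <- iota (below a p.2) (fiber a p.2)]].
  by rewrite -map_comp.
rewrite -flow_cat flow_block // ?big_map //; last exact: nn.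
by apply/allP => _ /mapP[i /mem_iota_below im ->]; exact: x0.
Qed.

Variables (X : sset) (T : choiceType) (CX : coding X T) (phi : smap X Y).
Variable psi : signature R T -> V.
Hypothesis psi_in : forall z, sig_image (R := R) CX z -> Dm (psi z).

Definition sweep_at n (f : X n) x rho y : V :=
  path (phi n f) x rho (psi (sigc CX f y)).

(** Where [rho = 0] the normalized rest [y] depends on the choice of a cut, but
    the flow does not depend on where it starts. *)
Lemma sweep_at_op n m (a : dmap m n) (f : X n) x rho y x' y' :
  cut n x rho y -> cut m x' rho y' ->
  (forall i, (i <= n)%N -> push a (fun j => x' j + rho * y' j) i = x i + rho * y i) ->
  sweep_at f x rho y = sweep_at (sop a f) x' rho y'.
Proof.
move=> c c' E.
have E' i : (i <= n)%N -> push a x' i + rho * push a y' i = x i + rho * y i.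
  by move=> iN; rewrite -E // /push mulr_sumr -big_split.
have xE i : (i <= n)%N -> push a x' i = x i := cut_unique (cut_push a c') c E' (i := i).
have [x0 r0 sy s1 _] := c; have [x0' _ sy' s1' _] := c'.
have im : sig_image (R := R) CX (sigc CX f y) by exists n, f, y.
have im' : sig_image (R := R) CX (sigc CX (sop a f) y') by exists m, (sop a f), y'.
rewrite /sweep_at sfun_nat path_op //; last exact: psi_in.
rewrite -(path_eq _ _ _ xE).
have [r00|rn] := eqVneq rho 0; last first.
  congr (path _ _ _ (psi _)); rewrite sigc_op; apply: sigc_eq => i iN.
  by have := E' i iN; rewrite xE // => /addrI /(mulfI rn).
rewrite r00 in s1' *; apply: flow_const; try exact: psi_in.
- by apply: weigh_nonneg => i _; exact: push_ge0.
- by rewrite total_weigh cum_below below_all //; lra.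
Qed.

Lemma cut_weights n x rho y : cut n x rho y -> simplex n (fun i => x i + rho * y i).
Proof.
case=> x0 r0 [y0 y1] s _; split; first by move=> i iN; rewrite addr_ge0 ?x0 ?mulr_ge0 ?y0.
have -> : cum (fun i => x i + rho * y i) n.+1 = cum x n.+1 + rho * cum y n.+1.
  by rewrite /cum big_split mulr_sumr.
by rewrite y1 mulr1.
Qed.

Lemma sweep_at_unique n n' (f : X n) (f' : X n') x y x' y' rho :
  cut n x rho y -> cut n' x' rho y' ->
  sigc CX f (fun i => x i + rho * y i) = sigc CX f' (fun i => x' i + rho * y' i) ->
  sweep_at f x rho y = sweep_at f' x' rho y'.
Proof.
move=> c c' E.
have [p [s [a [a' [sp sa sa' ff]]]]] := sigc_common (cut_weights c) (cut_weights c') E.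
have r01 : 0 <= 1 - rho <= 1.
  have [x0 r0 _ s1 _] := c; have := cum_ge0 x0 (leqnn _); rewrite -s1 => h.
  by apply/andP; split; lra.
have [x2 [y2 [c2 s2]]] := cut_exists sp r01; rewrite subKr in c2 s2.
have sE : s = (fun j => x2 j + rho * y2 j) by apply/funext.
rewrite (sweep_at_op f c c2 (a := a)); last by move=> i iN; rewrite -sE sa.
by rewrite (sweep_at_op f' c' c2 (a := a')) ?ff // => i iN; rewrite -sE sa'.
Qed.

(** At time [tau] the part of the weights before [tau] flows, and the rest is
    where the flow starts. The value at [z] does not depend on the simplex by
    [sweep_at_unique]. *)
Definition sweep (z : signature R T) (tau : R) : V :=
  xget (psi z) [set v | exists n (f : X n) x y, [/\ cut n x (1 - tau) y,
    sigc CX f (fun i => x i + (1 - tau) * y i) = z & sweep_at f x (1 - tau) y = v]].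

Lemma sweepE n (f : X n) x rho y tau : cut n x rho y -> rho = 1 - tau ->
  sweep (sigc CX f (fun i => x i + rho * y i)) tau = sweep_at f x rho y.
Proof.
move=> c rE; rewrite {}rE in c *; rewrite /sweep; set P := [set v | _].
have : P (xget (psi (sigc CX f (fun i => x i + (1 - tau) * y i))) P).
  by apply: xgetPex; exists (sweep_at f x (1 - tau) y), n, f, x, y.
by case=> n' [f' [x' [y' [c' E <-]]]]; exact: sweep_at_unique.
Qed.

Lemma sweep0 z : sig_image (R := R) CX z -> sweep z 0 = psi z.
Proof.
case=> n [f [t [st <-]]].
have c : cut n (fun=> 0) 1 t.
  split=> //; rewrite ?ler01 //; first by rewrite /cum big1 ?add0r.
  by move=> i j _ _; rewrite mul0r.
have -> : sigc CX f t = sigc CX f (fun i => 0 + 1 * t i).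
  by apply: sigc_eq => i _; rewrite add0r mul1r.
rewrite (sweepE f c) ?subr0 // /sweep_at /path flow_zero //.
- by congr psi; apply: sigc_eq => i _; rewrite add0r mul1r.
- exact: weigh_nonneg.
- by apply: psi_in; exists n, f, t.
- by rewrite total_weigh /cum big1.
Qed.

Lemma sweep1 n (f : X n) t : simplex n t ->
  sweep (sigc CX f t) 1 = path (phi n f) t 0 (psi (sigc CX f t)).
Proof.
move=> st; have c : cut n t 0 t.
  split=> //; [by case: st|by rewrite addr0; case: st|].
  by move=> i j _ _; rewrite mul0r mulr0.
have {1}-> : sigc CX f t = sigc CX f (fun i => t i + 0 * t i).
  by apply: sigc_eq => i _; rewrite mul0r addr0.
by rewrite (sweepE f c) ?subrr.
Qed.

Lemma sweep_ind (P : signature R T -> R -> V -> Prop) :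
  (forall n (f : X n) x rho y, cut n x rho y ->
    P (sigc CX f (fun i => x i + rho * y i)) (1 - rho) (sweep_at f x rho y)) ->
  forall z tau, sig_image (R := R) CX z -> 0 <= tau <= 1 -> P z tau (sweep z tau).
Proof.
move=> H z tau [n [f [t [st <-]]]] h; have [x [y [c tE]]] := cut_exists st h.
have -> : sigc CX f t = sigc CX f (fun i => x i + (1 - tau) * y i).
  by apply: sigc_eq => i _.
by rewrite (sweepE f c) // -{2}[tau](subKr 1); exact: H.
Qed.

(** ** Continuity of the sweep *)

(* The data of a cut, extended by 0 out of range, form a compact space. *)
Definition cutset N : set ((({ptws nat -> R} * R) * {ptws nat -> R})%type) :=
  [set q | [/\ bary N.+1 q.1, bary N.+1 (q.2, 0) &
    forall i j, (j < i)%N -> (i <= N)%N -> q.1.1 i * (q.1.2 * q.2 j) = 0]].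

Lemma cutset_cut N q : cutset N q -> cut N q.1.1 q.1.2 q.2.
Proof.
case: q => -[x rho] y [/= [/= cx /andP[r0 _] sx _] [/= cy _ sy _] o]; split=> //.
- by move=> i _; have := cx i; rewrite /= in_itv => /andP[].
- split; last by rewrite -sy addr0.
  by move=> i _; have := cy i; rewrite /= in_itv => /andP[].
Qed.

Lemma compact_cutset N : compact (cutset N).
Proof.
pose B := @bary R N.+1 `*` [set y : {ptws nat -> R} | bary N.+1 (y, 0 : R)].
have cB0 : compact [set y : {ptws nat -> R} | bary N.+1 (y, 0 : R)].
  rewrite (_ : [set y | _] = fst @` (bary N.+1 `&` [set p : {ptws nat -> R} * R | p.2 = 0])).
    apply: continuous_compact; first by apply: continuous_subspaceT => p; exact: cvg_fst.
    apply: compact_closedI; last first.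
      by apply: (closed_comp _ (@closed_eq R 0)) => p _; exact: cvg_snd.
    exact: compact_bary.
  rewrite eqEsubset; split=> y; first by move=> h; exists (y, 0).
  by case=> -[x r] [h /= r0] <-; rewrite /= -r0.
have cB : compact B by apply: compact_setX => //; exact: compact_bary.
pose Z i j := [set q : ({ptws nat -> R} * R) * {ptws nat -> R} |
  q.1.1 i * (q.1.2 * q.2 j) = 0].
have -> : cutset N = B `&` \bigcap_(p in [set p : nat * nat | (p.2 < p.1)%N /\ (p.1 <= N)%N])
    Z p.1 p.2.
  rewrite eqEsubset; split=> q.
    by case=> h1 h2 h3; split=> // -[i j] [/= ji iN]; exact: h3.
  by case=> -[h1 h2] h3; split=> // i j ji iN; apply: (h3 (i, j)).
apply: compact_closedI => //; apply: closed_bigI => -[i j] _.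
apply: (closed_comp _ (@closed_eq R 0)) => -[[x r] y] _.
have c1 : q.1 @[q --> ((x, r), y)] --> (x, r) by exact: cvg_fst.
have c2 : q.2 @[q --> ((x, r), y)] --> y by exact: cvg_snd.
have c3 : q.1.1 @[q --> ((x, r), y)] --> x by apply: cvg_comp c1 _; exact: cvg_fst.
have c4 : q.1.2 @[q --> ((x, r), y)] --> r by apply: cvg_comp c1 _; exact: cvg_snd.
exact: (cvgM (coord_cvg (i := i) _ c3) (cvgM c4 (coord_cvg (i := j) _ c2))).
Qed.

Lemma weigh_lay (ss : seq S) (x : nat -> R) :
  weigh (fun=> x) (zip ss (iota 0 (size ss))) = lay ss x.
Proof.
suff H i : weigh (fun=> x) (zip ss (iota i (size ss))) = lay ss (fun j => x (i + j)%N).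
  by rewrite H.
elim: ss i => //= k ss IH i; rewrite addn0 IH; congr (_ :: lay _ _).
by apply/funext => j; rewrite addSnnS.
Qed.

(** The pairs of a simplex and a cut of it form a compact space on which the
    sweep is given by a flow. *)
Lemma sweep_continuous N : hausdorff_space V -> bounded_dim R CX N ->
  {within sig_image (R := R) CX, continuous psi} ->
  {within [set p | sig_image (R := R) CX p.1 /\ 0 <= p.2 <= 1],
    continuous (fun p => sweep p.1 p.2)}.
Proof.
move=> hV bN cpsi; have [[s sP] HN] := bN.
pose Kv := psi @` sig_image (R := R) CX.
have cKv : compact Kv by apply: continuous_compact => //; exact: compact_sig_image bN.
have KvD : Kv `<=` Dm by move=> _ [z hz <-]; exact: psi_in.
pose Q : Type := (({ptws nat -> R} * R) * {ptws nat -> R})%type.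
apply: (@continuous_of_compact_cover (X N) s _ _
  (fun=> (({ptws nat -> R} * R) * {ptws nat -> R})%type) (fun=> cutset N)
  (fun f q => (sigc CX f (fun i => q.1.1 i + q.1.2 * q.2 i), 1 - q.1.2))
  (fun f q => sweep_at f q.1.1 q.1.2 q.2)).
- by apply: prod_hausdorff; [exact: signature_hausdorff|exact: Rhausdorff].
- by move=> _; exact: compact_cutset.
- move=> f; apply: continuous_subspaceT => -[[x r] y].
  have c1 : q.1 @[q --> ((x, r), y)] --> (x, r) by exact: cvg_fst.
  have c2 : q.2 @[q --> ((x, r), y)] --> y by exact: cvg_snd.
  have c3 : q.1.1 @[q --> ((x, r), y)] --> x by apply: cvg_comp c1 _; exact: cvg_fst.
  have c4 : q.1.2 @[q --> ((x, r), y)] --> r by apply: cvg_comp c1 _; exact: cvg_snd.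
  have c5 : (1 - q.1.2) @[q --> ((x, r), y)] --> 1 - r by exact: (cvgB (cvg_cst _) c4).
  have c6 : sigc CX f (fun i => q.1.1 i + q.1.2 * q.2 i) @[q --> ((x, r), y)] -->
      sigc CX f (fun i => x i + r * y i).
    apply: (@weigh_cvg _ _ _ _ (fun (q : Q) i => q.1.1 i + q.1.2 * q.2 i)
      (fun i => x i + r * y i) (lam CX f) (nbhs_filter _)) => i.
    exact: (cvgD (coord_cvg (i := i) _ c3) (cvgM c4 (coord_cvg (i := i) _ c2))).
  exact: (cvg_pair c6 c5).
- move=> f; pose ss := unzip1 (lam CY (phi N f)).
  have ssz : size ss = N.+1.
    by rewrite /ss size_map -(size_map snd) -/(unzip2 _) CY_vertices size_iota.
  have lamE : lam CY (phi N f) = zip ss (iota 0 (size ss)).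
    by rewrite ssz -(CY_vertices (phi N f)) /ss zip_unzip.
  have -> : (fun q : Q => sweep_at f q.1.1 q.1.2 q.2) =
      (fun q : Q => flow A (lay ss q.1.1) q.1.2 (psi (sigc CX f q.2))).
    by apply/funext => q; rewrite /sweep_at /path lamE weigh_lay.
  have cf : {within cutset N, continuous (fun q : Q => sigc CX f q.2)}.
    apply: continuous_subspaceT => -[p y].
    have c2 : q.2 @[q --> (p, y)] --> y by exact: cvg_snd.
    by apply: (@weigh_cvg _ _ _ _ (fun (q : Q) => q.2) y (lam CX f) (nbhs_filter _)) => i;
      exact: (coord_cvg (i := i) _ c2).
  have im (q : Q) : cutset N q -> sig_image (R := R) CX (sigc CX f q.2).
    by move=> /cutset_cut [_ _ sy _ _]; exists N, f, q.2.
  have c1 : {within cutset N, continuous (@fst ({ptws nat -> R} * R) {ptws nat -> R})}.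
    by apply: continuous_subspaceT => q; exact: cvg_fst.
  apply: (within_comp (within_pair c1 (within_comp cf cpsi im))
    (flow_continuous (A := A) (ss := ss) hV cKv KvD)).
  move=> q hq; have [h1 _ _] := hq; rewrite ssz; split=> //=.
  have [_ _ sy _ _] := cutset_cut hq.
  by exists (sigc CX f q.2) => //; exists N, f, q.2.
- move=> f q /cutset_cut c; apply/esym/(sweepE f c) => /=.
  by rewrite subKr.
- rewrite -bigcup_seq eqEsubset; split=> [[z tau] [/= hz htau]|].
    have [f [t [st E]]] := HN z hz; have [x [y [c tE]]] := cut_exists st htau.
    exists f; first exact: sP.
    pose trunc (u : nat -> R) : {ptws nat -> R} := fun i => if (i <= N)%N then u i else 0.
    have trE u i : (i <= N)%N -> trunc u i = u i by rewrite /trunc => ->.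
    have cumtr u : cum (trunc u) N.+1 = cum u N.+1.
      by apply: eq_big_nat => i /andP[_ iN]; rewrite trE.
    have [x0 r0 [y0 y1] s1 o] := c.
    have le1 u i : (forall j, (j <= N)%N -> 0 <= u j) -> cum u N.+1 <= 1 ->
        0 <= trunc u i <= 1.
      move=> u0 u1; rewrite /trunc; case: ifP => iN; last by rewrite lexx ler01.
      rewrite u0 //=; apply: le_trans u1; rewrite /cum big_mkord.
      rewrite (bigD1 (Ordinal (iN : (i < N.+1)%N))) //= lerDl.
      by apply: sumr_ge0 => j _; apply: u0; rewrite -ltnS.
    exists ((trunc x, 1 - tau), trunc y).
      split=> /=.
      + split=> //=; first (move=> i; rewrite /= in_itv /=; apply: le1 => //; lra).
        * by case/andP: htau => *; apply/andP; split; lra.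
        * by rewrite cumtr.
        * by move=> i Ni; rewrite /trunc leqNgt Ni.
      + split=> //=; first (move=> i; rewrite /= in_itv /=; apply: le1 => //; lra).
        * by rewrite lexx ler01.
        * by rewrite cumtr addr0.
        * by move=> i Ni; rewrite /trunc leqNgt Ni.
      + by move=> i j ji iN; rewrite !trE ?o // (leq_trans (ltnW ji)).
    rewrite /= subKr -E; congr pair; apply: sigc_eq => i iN.
    by rewrite !trE // tE.
  move=> _ [f _ [q hq <-]]; have c := cutset_cut hq; split=> /=.
    by exists N, f, (fun i => q.1.1 i + q.1.2 * q.2 i); split=> //; exact: cut_weights.
  have [[_ /andP[r0 r1] _ _] _ _] := hq.
  by apply/andP; split; lra.
Qed.

End Sweep.

(** * The two families of simplicial sets *)

Section Codings.
Variables r d : nat.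
Implicit Types (i j l c : 'I_r).

Definition surd_word n (x : diag (Surd r d) n) : seq 'I_r := val (val x).

Lemma surd_count n (x : diag (Surd r d) n) l : count_mem l (surd_word x) = n.+1.
Proof. by have /forallP/(_ l)/eqP := valP (val x). Qed.

Lemma labels_decorate (h f : seq 'I_r) :
  labels_from h f = decorate (fun h l => count_mem l h) h f.
Proof. by elim: f h => //= l f IH h; rewrite IH. Qed.

Definition surd_coding : coding (diag (Surd r d)) 'I_r.
Proof.
refine (@Coding (diag (Surd r d)) 'I_r (fun n x => labels (surd_word x))
  (fun h l => count_mem l h) _ _ _ _).
- by move=> n x; rewrite /unzip1 labels_fst -labels_decorate.
- by move=> n x x'; rewrite /unzip1 !labels_fst => /val_inj/val_inj.
- move=> n x; apply/allP => -[l k]; rewrite mem_labels_from /=.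
  by rewrite (surd_count x) ltnS.
- move=> m n a x; exact: (@labels_act r (fun=> m) (fun=> n) (fun=> a)).
Defined.

Lemma enum_ord_fibers m n (a : dmap m n) : iota 0 m.+1 =
  flatten [seq iota (below a k) (fiber a k) | k <- iota 0 n.+1].
Proof.
have H q : iota 0 (below a q) = flatten [seq iota (below a k) (fiber a k) | k <- iota 0 q].
  elim: q => [|q IH]; first by rewrite below0.
  by rewrite belowS iotaD IH -[in RHS]addn1 iotaD map_cat flatten_cat /= cats0.
by rewrite -H below_all.
Qed.

Definition be_word n (w : BEd r d n) : seq 'S_r := [seq val w t | t <- enum 'I_n.+1].

Definition be_lam n (w : BEd r d n) : seq ('S_r * nat) :=
  [seq (val w t, val t) | t <- enum 'I_n.+1].

Lemma be_lamE n (w : BEd r d n) :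
  be_lam w = [seq (val w (inord t), t) | t <- iota 0 n.+1].
Proof. by rewrite -val_enum_ord -map_comp; apply: eq_map => t /=; rewrite inord_val. Qed.

Lemma be_word_lam n (w : BEd r d n) : unzip1 (be_lam w) = be_word w.
Proof. by rewrite /unzip1 -map_comp. Qed.

Lemma be_lam_snd n (w : BEd r d n) : unzip2 (be_lam w) = iota 0 n.+1.
Proof. by rewrite /unzip2 -map_comp val_enum_ord. Qed.

Lemma decorate_size (s h : seq 'S_r) :
  decorate (fun h _ => size h) h s = zip s (iota (size h) (size s)).
Proof. by elim: s h => //= a s IH h; rewrite IH. Qed.

Definition be_coding : coding (BEd r d) 'S_r.
Proof.
refine (@Coding (BEd r d) 'S_r be_lam (fun h _ => size h) _ _ _ _).
- move=> n w; rewrite decorate_size size_map /be_lam size_map size_enum_ord.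
  by rewrite -/(be_lam w) -(be_lam_snd w) zip_unzip.
- move=> n w w'; rewrite !be_word_lam => E; apply: val_inj; apply/ffunP => t.
  by move/eq_in_map : E; apply; rewrite mem_enum.
- by move=> n w; apply/allP => _ /mapP[t _ ->] /=; rewrite -ltnS.
- move=> m n a w; rewrite !be_lamE (enum_ord_fibers a) map_flatten -!map_comp.
  congr flatten; apply/eq_in_map => j; rewrite mem_iota /= => jn.
  apply/eq_in_map => t tj /=; congr pair.
  have tm := mem_iota_below tj; rewrite ffunE; congr (val w _); apply: val_inj.
  rewrite /= inordK //; have := mem_fiber a j (inord t); rewrite /= inordK // tj.
  by move/esym/eqP.
Defined.

(** ** The map of simplices *)

(** Besides the changes of the first letters of the permutations, the sequence
    has one between the two letters of the last permutation. *)
Lemma tc_le n (x : diag (Surd r d) n) : (0 < d)%N -> be_le d (tc_fun (val x)).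
Proof.
move=> d0; apply/forallP => i; apply/forallP => j; apply/implyP => ij.
have ne : i != j by apply: contraTneq ij => ->; rewrite ltnn.
have /forallP/(_ i)/forallP/(_ j)/implyP/(_ ij) := valP x.
have := subseq_firsts (surd_count x) ne (leqnn n).
move=> /changes_subseq h1 /(leq_trans h1) h2.
rewrite -ltnS prednK //; apply: leq_trans h2; set f := surd_word x.
have -> : [seq before (tc_fun (val x) t) i j | t <- enum 'I_n.+1] =
    [seq before s i j | s <- [seq vertex_perm f t | t <- iota 0 n.+1]].
  by rewrite -val_enum_ord -!map_comp; apply: eq_map => t /=; rewrite ffunE.
rewrite -changes_first // -map_comp cats1 -[n.+1]addn1 iotaD map_cat /= cats1.
by rewrite changes_rcons first_neq // addn1.
Qed.

Hypothesis d0 : (0 < d)%N.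

Definition tcd_fun n (x : diag (Surd r d) n) : BEd r d n := Sub (tc_fun (val x)) (tc_le x d0).

Lemma tcd_nat m n (a : dmap m n) (x : diag (Surd r d) n) :
  tcd_fun (sop a x) = sop a (tcd_fun x).
Proof. by apply: val_inj; exact: (tc_nat a (val x)). Qed.

Definition tcd : smap (diag (Surd r d)) (BEd r d) := SMap tcd_nat.

Lemma tcd_word n (x : diag (Surd r d) n) :
  be_word (tcd n x) = [seq vertex_perm (surd_word x) t | t <- iota 0 n.+1].
Proof.
by rewrite -val_enum_ord -map_comp; apply: eq_map => t /=; rewrite ffunE.
Qed.

End Codings.

Section Actions.
Variables (R : realType) (r : nat).
Implicit Types (z : signature R 'I_r) (s : 'S_r) (w : seq 'I_r).

Let all_letters := enum 'I_r.

Lemma represents_perm s w z : represents (codom s) w z <-> represents all_letters w z.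
Proof.
have E l : (l \in codom s) = (l \in all_letters) by rewrite mem_codom_perm mem_enum.
split=> -[l [nl al ml zl wl]]; exists l; split=> //.
- by apply: sub_all al => p; rewrite E.
- by move=> k kl; apply: ml; rewrite E.
- by apply: sub_all al => p; rewrite E.
- by move=> k kl; apply: ml; rewrite -E.
Qed.

Lemma unit_words_perm s : unit_words (R := R) (codom s) = unit_words all_letters.
Proof.
by rewrite eqEsubset; split=> z [w /represents_perm h]; exists w => //; apply/represents_perm.
Qed.

Lemma tidy_in s th z : 0 <= th <= 1 -> unit_words all_letters z ->
  unit_words all_letters (tidy (codom s) th z).
Proof.
rewrite -(unit_words_perm s) => /andP[th0 _] [w h].
by have [w' h' _] := represents_tidy (uniq_codom s) th0 h; exists w'.
Qed.

(** This is how weighted permutations act on the points of the realization of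
    sequences. *)
Definition tidy_action : cone_action R 'S_r (unit_words (R := R) all_letters).
Proof.
refine (@ConeAction R 'S_r _ _ (fun s => tidy (codom s))
  (fun s => sig [seq (k, 1) | k <- codom s]) _ _ _ _ _).
- by move=> s th z; exact: tidy_in.
- by move=> s z; rewrite -(unit_words_perm s); exact: tidy0.
- by move=> s z; rewrite -(unit_words_perm s); apply: tidy1; exact: uniq_codom.
- by move=> s th th' z t01 t01'; rewrite -(unit_words_perm s); apply: tidyM; rewrite ?uniq_codom.
- by move=> s; rewrite -(unit_words_perm s); apply: tidy_continuous; exact: uniq_codom.
Defined.

Definition join_act (T : choiceType) (k : T) th (z : signature R T) : signature R T :=
  expm k th (scla (1 - th) z).

(** For points of a simplicial set of words of total weight 1 the flow is the
    straight line homotopy, which puts letters in front of a word and rescales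
    it. *)
Definition join_action (T : choiceType) :
  cone_action R T [set z : signature R T | z [::] = 1].
Proof.
refine (@ConeAction R T _ _ (@join_act T) (fun k => expm k 1 (@sone R T)) _ _ _ _ _).
- by move=> k th z _ /= z1; rewrite /join_act expm_nil /scla /= expr0 mul1r.
- by move=> k z _; rewrite /join_act subr0 scla1 expm0.
- by move=> k z /= z1; rewrite /join_act subrr scla0.
- move=> k th th' z _ _ _; rewrite /join_act scla_expm sclaM expmD.
  by congr (expm _ _ (scla _ _)); ring.
- move=> k; apply: continuous_subspaceT => -[th z].
  have c1 : p.1 @[p --> (th, z)] --> th by exact: cvg_fst.
  have c2 : p.2 @[p --> (th, z)] --> z by exact: cvg_snd.
  have c3 : 1 - p.1 @[p --> (th, z)] --> 1 - th by exact: (cvgB (cvg_cst _) c1).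
  have c4 : scla (1 - p.1) p.2 @[p --> (th, z)] --> scla (1 - th) z.
    exact: (scla_cvg _ c3 c2).
  exact: (expm_cvg _ c1 c4).
Defined.

End Actions.

(** * Representing signatures by simplices *)

Section Reduction.
Variables (R : realType) (T : choiceType).
Implicit Types (l : seq (T * R)).

(** Words without equal neighbors are bounded by their changes, which bounds the
    dimensions that are needed. *)
Lemma merge_neighbors l : nonneg l -> exists l', [/\ nonneg l', sig l' = sig l,
  (forall k, mass k l' = mass k l) /\ total l' = total l,
  subseq (unzip1 l') (unzip1 l) & changes (unzip1 l') = (size l').-1].
Proof.
elim: l => [|[k x] l IH] /=; first by move=> _; exists [::].
case/andP=> x0 /IH[[|[k' x'] l'] [/= nl' sl' [ml' tl'] ul' cl']].
  exists [:: (k, x)]; split=> //=; rewrite ?x0 ?sl' ?eqxx ?sub0seq //.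
  by split=> [a|]; rewrite ?mass_cons ?total_cons ?ml' ?tl'.
case/andP: nl' => x'0 nl'; have [kk|kk] := eqVneq k k'; last first.
  exists [:: (k, x), (k', x') & l']; split=> //=; rewrite ?x0 ?x'0 ?nl' ?eqxx //.
  - by rewrite -sl'.
  - by split=> [a|]; [rewrite [LHS]mass_cons ml' mass_cons|rewrite [LHS]total_cons tl' total_cons].
  - by rewrite changes_cons2 kk cl'.
exists ((k, x + x') :: l'); split=> //=; rewrite ?addr_ge0 ?nl' ?eqxx //.
- by rewrite -expmD -sl' kk.
- split=> [a|]; last by rewrite !total_cons -tl' total_cons /= addrA.
  rewrite !mass_cons -ml' mass_cons /= -kk; case: ifP => _; last by rewrite !add0r.
  by rewrite addrA.
- exact: subseq_trans (subseq_cons _ _) ul'.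
- by rewrite kk.
Qed.

Lemma drop_zero l :
  [/\ sig [seq p <- l | p.2 != 0] = sig l,
      (forall k, mass k [seq p <- l | p.2 != 0] = mass k l),
      total [seq p <- l | p.2 != 0] = total l &
      nonneg l -> nonneg [seq p <- l | p.2 != 0]].
Proof.
elim: l => [|[k x] l [IH1 IH2 IH3 IH4]] //=; case: eqVneq => /= [->|x0].
  split; first by rewrite expm0.
  - by move=> a; rewrite mass_cons /= IH2; case: ifP; rewrite add0r.
  - by rewrite total_cons add0r.
  - by case/andP=> _; exact: IH4.
split; first by rewrite IH1.
- by move=> a; rewrite !mass_cons IH2.
- by rewrite !total_cons IH3.
- by case/andP=> -> /IH4.
Qed.

End Reduction.

Lemma changes_le_sum (T : eqType) (P : finType) (F : P -> seq T -> nat) s :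
  (forall p x t, F p t <= F p (x :: t))%N ->
  (forall x y t, x != y -> exists p, F p (y :: t) < F p [:: x, y & t])%N ->
  (changes s <= \sum_p F p s)%N.
Proof.
move=> mono jump; elim: s => // x [//|y s] IH; rewrite changes_cons2.
case: eqVneq => [_|xy] /=.
  by rewrite add0n (leq_trans IH) // leq_sum.
have [p lt] := jump x y s xy; rewrite add1n.
apply: (@leq_ltn_trans (\sum_p F p (y :: s))%N) => //.
by rewrite (bigD1 p) //= [X in (_ < X)%N](bigD1 p) //= -addSn leq_add // leq_sum.
Qed.

Section WordBounds.
Variable r : nat.

(** A change from [i] to [j] in [u] is one in the subsequence of [i] and [j]. *)
Lemma changes_pairs (u : seq 'I_r) d :
  (forall i j : 'I_r, (i < j)%N -> (changes (pair_sub i j u) <= d)%N) ->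
  (changes u <= r * r * d)%N.
Proof.
move=> h; pose F (p : 'I_r * 'I_r) u := if (p.1 < p.2)%N then changes (pair_sub p.1 p.2 u) else 0%N.
apply: (@leq_trans (\sum_p F p u)); last first.
  rewrite (@leq_trans (\sum_(p : 'I_r * 'I_r) d)%N) //;
    last by rewrite sum_nat_const card_prod card_ord.
  by apply: leq_sum => p _; rewrite /F; case: ifP => // /h.
apply: changes_le_sum => [p x t|x y t xy].
  rewrite /F; case: ifP => // _; apply: changes_subseq.
  by rewrite /pair_sub /=; case: ifP => _; rewrite ?subseq_refl // subseq_cons.
wlog lt : x y xy / (x < y)%N => [H|].
  case: (ltngtP x y) => [lt|lt|e]; first exact: H.
    exists (y, x); rewrite /F /= lt /pair_sub /= !eqxx orbT /=.
    by rewrite changes_cons2 xy.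
  by case/eqP: xy; exact: val_inj.
exists (x, y); rewrite /F /= lt /pair_sub /= !eqxx orbT /=.
by rewrite changes_cons2 xy.
Qed.

Lemma before_inj (s s' : 'S_r) :
  (forall i j : 'I_r, (i < j)%N -> before s i j = before s' i j) -> s = s'.
Proof.
move=> h; have h' i j : before s i j = before s' i j.
  case: (ltngtP i j) => [ij|ij|/val_inj ->]; first exact: h.
    by rewrite !(@before_sym _ _ j i) ?h // neq_ltn ij.
  by rewrite /before !ltnn.
have pos (u : 'S_r) l : val ((u^-1)%g l) = #|[pred i | before u i l]|.
  have winj q (h'' : (q <= r)%N) : injective (widen_ord h'').
    by move=> x y /(congr1 val) /= xy; apply: val_inj.
  rewrite -{1}[val _]card_ord -(card_imset _ (winj _ (ltnW (ltn_ord ((u^-1)%g l))))).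
  rewrite -[RHS](card_imset _ (@perm_inj _ (u^-1)%g)); apply: eq_card => a.
  apply/imsetP/imsetP => [[b _ ->]|[i ib ->]].
    exists (u (widen_ord (ltnW (ltn_ord ((u^-1)%g l))) b)); last by rewrite permK.
    by rewrite inE /before permK /=.
  rewrite inE /before in ib.
  by exists (Ordinal ib) => //; apply: val_inj.
apply: (can_inj invgK); apply/permP => l; apply: val_inj.
by rewrite /= !pos; apply: eq_card => i; rewrite !inE h'.
Qed.

(** Different permutations differ in the order of two letters. *)
Lemma changes_befores (u : seq 'S_r) d :
  (forall i j : 'I_r, (i < j)%N -> (changes [seq before s i j | s <- u] <= d)%N) ->
  (changes u <= r * r * d)%N.
Proof.
move=> h; pose F (p : 'I_r * 'I_r) (u : seq 'S_r) :=
  if (p.1 < p.2)%N then changes [seq before s p.1 p.2 | s <- u] else 0%N.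
apply: (@leq_trans (\sum_p F p u)); last first.
  rewrite (@leq_trans (\sum_(p : 'I_r * 'I_r) d)%N) //;
    last by rewrite sum_nat_const card_prod card_ord.
  by apply: leq_sum => p _; rewrite /F; case: ifP => // /h.
apply: changes_le_sum => [p x t|x y t xy].
  by rewrite /F; case: ifP => // _; exact: changes_cons_ge.
have : ~~ [forall p : 'I_r * 'I_r, (p.1 < p.2)%N ==> (before x p.1 p.2 == before y p.1 p.2)].
  apply: contraNN xy => /forallP h'; apply/eqP/before_inj => i j ij.
  by have /implyP/(_ ij)/eqP := h' (i, j).
rewrite negb_forall => /existsP[p]; rewrite negb_imply => /andP[lt ne].
by exists p; rewrite /F lt /= changes_cons2 ne.
Qed.

End WordBounds.

Section Padding.
Variable R : realType.

(** The map is a degeneracy, which repeats the last vertex. *)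
Lemma pad_simplex p N (t : nat -> R) : (p <= N)%N -> simplex p t ->
  exists (a : dmap N p) t', simplex N t' /\ forall i, (i <= p)%N -> push a t' i = t i.
Proof.
move=> pN [t0 t1].
have mono (q q' : 'I_N.+1) : (q <= q')%N ->
    ((inord (minn p q) : 'I_p.+1) <= (inord (minn p q') : 'I_p.+1))%N.
  by move=> qq; rewrite !inordK ?ltnS ?geq_minl // leq_min geq_minl geq_min qq orbT.
pose a : dmap N p := mkdmap mono; pose t' i := if (i <= p)%N then t i else 0.
have ct q : (q <= p.+1)%N -> cum t' q = cum t q.
  by move=> qp; apply: eq_big_nat => i /andP[_ iq]; rewrite /t' -ltnS (leq_trans iq).
have ct' q : (p < q)%N -> cum t' q = 1.
  move=> pq; rewrite /cum (big_cat_nat (n := p.+1)) //= -/(cum t' _) ct // t1.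
  by rewrite big_nat big1 ?addr0 // => i /andP[pi _]; rewrite /t' leqNgt pi.
have bl j : (j <= p)%N -> below a j = j.
  move=> jp; apply/eqP; rewrite eqn_leq; have jN : (j < N.+1)%N by rewrite ltnS (leq_trans jp).
  have bN : (below a j <= N.+1)%N by exact: below_max.
  have h (q : 'I_N.+1) : (q < below a j)%N = (q < j)%N.
    by rewrite below_lt ffunE inordK ?ltnS ?geq_minl // gtn_min ltnNge jp.
  apply/andP; split; rewrite leqNgt; apply/negP => lt.
    by have := h (Ordinal jN); rewrite lt ltnn.
  have lt' : (below a j < N.+1)%N by exact: ltn_trans lt jN.
  by have := h (Ordinal lt'); rewrite ltnn lt.
exists a, t'; split.
  split; last exact: ct'.
  by move=> i _; rewrite /t'; case: ifP => // /t0.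
move=> i; rewrite pushE leq_eqVlt => /orP[/eqP ->|ip].
  by rewrite below_all // bl // ct' // ct // -t1 cumS addrC addKr.
rewrite (bl _ ip) (bl _ (ltnW ip)) (ct _ (leqW ip)) (ct _ (leqW (ltnW ip))).
by rewrite cumS addrAC subrr add0r.
Qed.

End Padding.

Section SurImage.
Variables (R : realType) (r d : nat).
Implicit Types (i j c k : 'I_r) (z : signature R 'I_r).

Let CS := surd_coding r d.
Let all_letters := enum 'I_r.

Lemma labels_from_snd k (h f : seq 'I_r) :
  [seq p.2 | p <- labels_from h f & p.1 == k] = iota (count_mem k h) (count_mem k f).
Proof.
elim: f h => //= a f IH h; case: eqVneq => [->|ak] /=; rewrite IH /= ?eqxx //.
by rewrite (negbTE ak).
Qed.

Lemma sum_counts (u : seq 'I_r) : (\sum_k count_mem k u)%N = size u.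
Proof.
elim: u => [|a u IH] /=; first by rewrite big1.
rewrite big_split /= IH (bigD1 a) //= eqxx big1 // => k.
by rewrite eq_sym => /negbTE ->.
Qed.

Lemma mass_labels k (f : seq 'I_r) (t : nat -> R) :
  mass k (weigh (fun=> t) (labels f)) = cum t (count_mem k f).
Proof.
rewrite /mass big_map -big_filter /= /cum /index_iota subn0.
by have := labels_from_snd k [::] f; rewrite /= => <-; rewrite big_map.
Qed.

Lemma surd_represents n (x : diag (Surd r d) n) (t : nat -> R) : simplex n t ->
  represents all_letters [seq p.1 | p <- labels (surd_word x) & t p.2 != 0]
    (sigc CS x t).
Proof.
move=> st; have [s m _ nn] := drop_zero (weigh (fun=> t) (labels (surd_word x))).
exists [seq p <- weigh (fun=> t) (labels (surd_word x)) | p.2 != 0]; split=> //.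
- by apply: nn; apply: (weigh_nonneg CS) => i; apply: st.1.
- by apply/allP => p _; rewrite mem_enum.
- by move=> k _; rewrite m mass_labels surd_count st.2.
- by rewrite filter_map /unzip1 -map_comp.
Qed.

Lemma weigh_labels (B : seq ('I_r * R)) :
  weigh (fun l q => nth 0 [seq p.2 | p <- B & p.1 == l] q) (labels (unzip1 B)) = B.
Proof.
suff H (A C : seq ('I_r * R)) : weigh (fun l q => nth 0 [seq p.2 | p <- A ++ C & p.1 == l] q)
    (labels_from (rev (unzip1 A)) (unzip1 C)) = C by exact: (H [::] B).
elim: C A => //= -[l x] C IH A /=; congr ((_, _) :: _).
  rewrite filter_cat map_cat nth_cat size_map size_filter count_rev count_map.
  by rewrite (eq_count (a2 := fun p => p.1 == l)) // ltnn subnn /= eqxx.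
by have := IH (rcons A (l, x)); rewrite /unzip1 map_rcons rev_rcons -cats1 -catA.
Qed.

Lemma sig_sur_act p (n : 'I_r -> nat) (a : forall l, dmap p (n l)) (u : seq 'I_r)
    (t : nat -> R) : sig (weigh (fun=> t) (labels (sur_act (m := fun=> p) a u))) =
  sig (weigh (fun l => push (a l) t) (labels u)).
Proof.
rewrite labels_act; elim: (labels u) => //= q s IH.
by rewrite /weigh map_cat sig_cat -map_comp expm_iota -/(weigh _ _) IH.
Qed.

Lemma sub_sur_act (m n : 'I_r -> nat) (a : forall l, dmap (m l) (n l)) u i j c :
  (changes (c :: pair_sub i j (sur_act a u)) <= changes (c :: pair_sub i j u))%N.
Proof.
rewrite -{2}(labels_fst u) /sur_act /pair_sub; move: (labels u) => s.
set P := fun l => _.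
have -> : [seq l <- flatten [seq nseq (fiber (a p.1) p.2) p.1 | p <- s] | P l] =
    flatten [seq nseq (fiber (a p.1) p.2) p.1 | p <- s & P p.1].
  elim: s => //= p s IH; rewrite filter_cat filter_nseq IH.
  by case: (P p.1); rewrite ?mul1n ?mul0n.
rewrite filter_map; move: [seq p <- s | P p.1] => {s} s.
have := changes_flatten (fun p => if p is Some p then fiber (a p.1) p.2 else 1%N)
  (fun p => if p is Some p then p.1 else c) (None :: [seq Some p | p <- s]).
by rewrite /= -!map_comp.
Qed.

(* A word with [c] changes and without equal neighbors has [c + 1] letters;
   there are at most [r * r] pairs of letters. *)
Definition surd_dim := (r * r * d).+1.

(** The weights of the occurrences of each letter are a point of a simplex, so
    that a word of bounded length is a point of a prism. The common refinement
    of its coordinates is a point of a simplex of the diagonal. *)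
Lemma represents_surd w z : represents all_letters w z ->
  (forall i j, (i < j)%N -> (changes (pair_sub i j w) <= d)%N) ->
  exists (x : diag (Surd r d) surd_dim) t,
    [/\ simplex surd_dim t, sigc CS x t = z & forall i j c,
      (changes (c :: pair_sub i j (surd_word x)) <= changes (c :: pair_sub i j w))%N].
Proof.
case=> l [nl _ ml lz lw] cw.
have [l' [nl' sl' [ml' _] ul' cl']] := merge_neighbors nl.
pose u := unzip1 l'; have {ul'} uw : subseq u w by rewrite -lw.
pose B k := [seq p.2 | p <- l' & p.1 == k].
have szB k : size (B k) = count_mem k u.
  by rewrite size_map size_filter /u /unzip1 count_map.
have sumB k : \sum_(x <- B k) x = 1.
  by rewrite big_map big_filter -/(mass k l') ml' ml // mem_enum.
have cu k : (0 < count_mem k u)%N.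
  rewrite -szB; case: (B k) (sumB k) => //; rewrite big_nil => /eqP.
  by rewrite eq_sym oner_eq0.
pose n k := (count_mem k u).-1.
have nE k : (n k).+1 = count_mem k u by rewrite /n prednK.
pose y k q := nth 0 (B k) q.
have sy k : simplex (n k) (y k).
  split; last by rewrite nE -szB /cum -(big_nth 0 xpredT id) sumB.
  move=> q; rewrite -ltnS nE -szB => qB.
  by rewrite /y; have /mapP[p + ->] := mem_nth 0 qB; rewrite mem_filter => /andP[_ /(allP nl')].
(* the operators of the refinement send the prism to the diagonal *)
have [p [t [a [st _ pa pn]]]] := common_refinement sy.
have uP : sur_pred n u by apply/forallP => k; rewrite nE.
have uL : sur_le d (Sub u uP : Sur r n).
  apply/forallP => i; apply/forallP => j; apply/implyP => ij /=.
  apply: leq_trans (cw i j ij); apply: changes_subseq.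
  by apply: pair_sub_subseq.
pose x0 : Surd r d n := Sub (Sub u uP) uL.
pose x1 : diag (Surd r d) p := mop a x0.
have pN : (p <= surd_dim)%N.
  apply: leq_trans pn _; apply: (@leq_trans (size u)).
    by rewrite -sum_counts; apply: leq_sum => k _; exact: leq_pred.
  have h : (changes u <= r * r * d)%N.
    apply: changes_pairs => i j ij; apply: leq_trans (cw i j ij).
    by apply: changes_subseq; apply: pair_sub_subseq.
  rewrite /surd_dim; move: h; rewrite cl' /u size_map; case: (size l') => //.
have [b [t' [st' tb]]] := pad_simplex pN st.
exists (sop b x1), t'; split=> //.
  rewrite sigc_op (sigc_eq _ _ tb) /sigc /=.
  rewrite (_ : labels (surd_word x1) = labels (sur_act (m := fun=> p) a u)) // sig_sur_act.
  rewrite -lz -sl' -[in RHS](weigh_labels l'); congr sig.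
  apply/eq_in_map => -[k q]; rewrite mem_labels_from /= add0n -nE ltnS => qn.
  by rewrite pa.
move=> i j c; apply: leq_trans (sub_sur_act _ _ _ _ _) _.
apply: leq_trans (sub_sur_act _ _ _ _ _) _.
by apply: changes_subseq_cons; apply: pair_sub_subseq.
Qed.

Lemma surd_image_represents z : sig_image CS z ->
  exists2 w, represents all_letters w z &
    forall i j, (i < j)%N -> (changes (pair_sub i j w) <= d)%N.
Proof.
case=> n [x [t [st <-]]]; exists [seq p.1 | p <- labels (surd_word x) & t p.2 != 0].
  exact: surd_represents.
move=> i j ij; have /forallP/(_ i)/forallP/(_ j)/implyP/(_ ij) := valP x.
apply: leq_trans; apply: changes_subseq; apply: pair_sub_subseq.
rewrite -[X in subseq _ X](labels_fst (surd_word x)); apply: map_subseq.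
exact: filter_subseq.
Qed.

Lemma surd_enum N : exists s : seq (diag (Surd r d) N), forall x, x \in s.
Proof.
exists (pmap insub (pmap insub [seq val t | t : (r * N.+1).-tuple 'I_r])) => x.
rewrite mem_pmap; apply/mapP; exists (val x); last by rewrite valK.
rewrite mem_pmap; apply/mapP; exists (val (val x)); last by rewrite valK.
have sz : size (val (val x)) == (r * N.+1)%N.
  rewrite -sum_counts.
  by rewrite (eq_bigr (fun=> N.+1)) ?sum_nat_const ?card_ord // => k _; rewrite (surd_count x).
by apply/mapP; exists (Tuple sz) => //; rewrite mem_enum.
Qed.

Lemma surd_bounded : bounded_dim R CS surd_dim.
Proof.
split; first exact: surd_enum.
move=> z /surd_image_represents[w hw cw].
by have [x [t [st E _]]] := represents_surd hw cw; exists x, t.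
Qed.

End SurImage.

Section BarrattEcclesImage.
Variables (R : realType) (r d : nat).
Implicit Types (i j : 'I_r) (z : signature R 'S_r) (l : seq ('S_r * R)).

Let CE := be_coding r d.

Definition be_dim := (r * r * d.-1)%N.

Lemma be_enum N : exists s : seq (BEd r d N), forall x, x \in s.
Proof.
exists (pmap insub (enum {ffun 'I_N.+1 -> 'S_r})) => x.
rewrite mem_pmap; apply/mapP; exists (val x); last by rewrite valK.
by rewrite mem_enum.
Qed.

Lemma be_image l : nonneg l -> total l = 1 ->
  (forall i j, (i < j)%N -> (changes [seq before s i j | s <- unzip1 l] <= d.-1)%N) ->
  exists (w : BEd r d be_dim) t, simplex be_dim t /\ sigc CE w t = sig l.
Proof.
move=> nl tl cl; have [l' [nl' sl' [_ tl'] ul' cl']] := merge_neighbors nl.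
have cl2 i j : (i < j)%N -> (changes [seq before s i j | s <- unzip1 l'] <= d.-1)%N.
  by move=> ij; apply: leq_trans (cl i j ij); apply: changes_subseq; apply: map_subseq.
rewrite -{}tl' in tl; rewrite -{}sl'.
case: l' nl' tl cl' cl2 {ul'} => [|q l']; first by rewrite /total big_nil => _ /eqP; rewrite eq_sym oner_eq0.
set L := q :: l' => nL tL cL cL2; pose n := size l'.
pose w0 : {ffun 'I_n.+1 -> 'S_r} := [ffun t : 'I_n.+1 => nth 1%g (unzip1 L) t].
have wE : [seq w0 t | t <- enum 'I_n.+1] = unzip1 L.
  have -> : [seq w0 t | t <- enum 'I_n.+1] = [seq nth 1%g (unzip1 L) t | t <- iota 0 n.+1].
    by rewrite -val_enum_ord -map_comp; apply: eq_map => t /=; rewrite ffunE.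
  have -> : n.+1 = size (unzip1 L) by rewrite size_map.
  exact: (mkseq_nth 1%g (unzip1 L)).
have w0L : be_le d (w0 : BE r n).
  apply/forallP => i; apply/forallP => j; apply/implyP => ij; apply: leq_trans (cL2 i j ij).
  by rewrite -wE -map_comp.
pose w : BEd r d n := Sub w0 w0L; pose t k := nth 0 (unzip2 L) k.
have sL : size (unzip2 L) = n.+1 by rewrite size_map.
have st : simplex n t.
  split; last by rewrite -tL /total -sL /cum -(big_nth 0 xpredT id) big_map.
  move=> k; rewrite -ltnS -sL => kL.
  by rewrite /t; have /mapP[p /(allP nL) h ->] := mem_nth 0 kL.
have lamE : weigh (fun=> t) (be_lam w) = L.
  have -> : be_lam w = zip (unzip1 L) (iota 0 n.+1).
    by rewrite -(zip_unzip (be_lam w)) be_word_lam be_lam_snd -wE.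
  rewrite /weigh; apply: (@eq_from_nth _ (1%g, 0)).
    by rewrite size_map size_zip size_iota size_map minnn.
  move=> k; rewrite size_map size_zip size_iota size_map minnn => kn.
  rewrite (nth_map (1%g, 0%N)); last by rewrite size_zip size_iota size_map minnn.
  have -> : nth (1%g, 0%N) (zip (unzip1 L) (iota 0 n.+1)) k = (nth 1%g (unzip1 L) k, k).
    by rewrite nth_zip ?size_iota ?size_map // nth_iota.
  by rewrite -[X in _ = nth _ X _]zip_unzip nth_zip ?size_map.
have nN : (n <= be_dim)%N.
  by have := changes_befores cL2; rewrite cL.
have [b [t' [st' tb]]] := pad_simplex nN st.
exists (sop b w), t'; split=> //.
by rewrite sigc_op (sigc_eq _ _ tb) /sigc /= lamE.
Qed.

Lemma be_befores n (w : BEd r d n) i j : (i < j)%N ->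
  (changes [seq before s i j | s <- be_word w] <= d.-1)%N.
Proof.
move=> ij; have /forallP/(_ i)/forallP/(_ j)/implyP/(_ ij) := valP w.
by apply: leq_trans; rewrite /be_word -map_comp; exact: leqnn.
Qed.

Lemma be_total n (w : BEd r d n) (t : nat -> R) : total (weigh (fun=> t) (be_lam w)) = cum t n.+1.
Proof. exact: (@total_weigh R _ _ CE (@be_lam_snd r d)). Qed.

Lemma be_bounded : bounded_dim R CE be_dim.
Proof.
split; first exact: be_enum.
move=> z [n [w [t [st <-]]]]; apply: be_image.
- by apply: (weigh_nonneg CE) => i; apply: st.1.
- by rewrite be_total st.2.
- move=> i j ij; have -> : unzip1 (weigh (fun=> t) (lam CE w)) = be_word w.
    by rewrite -be_word_lam /weigh /unzip1 -map_comp.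
  exact: be_befores.
Qed.

End BarrattEcclesImage.

(** * The homotopy equivalence *)

(** ** The words along a flow *)

Section FlowWords.
Variables (R : realType) (r : nat).
Implicit Types (i j c : 'I_r) (l : seq ('S_r * R)) (z : signature R 'I_r).

Let all_letters := enum 'I_r.
Let A := tidy_action R r.

Lemma represents_mem w z : represents all_letters w z -> forall k, k \in w.
Proof.
case=> l [_ _ ml _ <-] k; apply: contraT => kl.
have := ml k; rewrite mem_enum => /(_ isT); rewrite /mass big_seq_cond big1 => [/eqP|p].
  by rewrite eq_sym oner_eq0.
by case/andP=> pl /eqP pk; rewrite -pk map_f in kl.
Qed.

Lemma represents_unit (s : seq 'I_r) : perm_eq s all_letters ->
  represents all_letters s (sig [seq (k, 1 : R) | k <- s]).
Proof.
move=> ps; exists [seq (k, 1) | k <- s]; split=> //.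
- by apply/allP => _ /mapP[k _ ->]; exact: ler01.
- by apply/allP => p _; rewrite mem_enum.
- move=> k _; rewrite /mass big_map (perm_big _ ps) /= /all_letters big_enum_cond /=.
  by rewrite (eq_bigl (pred1 k)) ?big_pred1_eq.
- by rewrite /unzip1 -map_comp map_id.
Qed.

Lemma perm_codom (s : 'S_r) : perm_eq (codom s) all_letters.
Proof.
by apply: uniq_perm; rewrite ?uniq_codom ?enum_uniq // => k; rewrite mem_codom_perm mem_enum.
Qed.

(** The changes of this sequence are the complexity, for [i] and [j], of a chain
    of permutations whose members of weight 0 are left out. *)
Definition firsts i j l := [seq first i j p.1 | p <- l & p.2 != 0].

(** Every permutation that acts is accounted for by the one of the letters [i]
    and [j] that it moves first. *)
Lemma flow_word l rho z u : nonneg l -> 0 <= rho -> represents all_letters u z ->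
  exists2 v, represents all_letters v (flow A l rho z) & forall i j c, i != j ->
    (changes (c :: pair_sub i j v) <= changes (c :: firsts i j l ++ pair_sub i j u))%N.
Proof.
move=> + r0 hu; have Dz : unit_words all_letters z by exists u.
elim: l => [_|[s x] l IH] /=; first by exists u.
case/andP=> x0 nl; have [v hv cv] := IH nl.
have Dv : unit_words all_letters (flow A l rho z) by exists v.
rewrite /firsts /=; case: eqVneq => [->|xn] /=.
  rewrite mul0r; exists v; last exact: cv.
  by have -> := tidy0 (ks := codom s) (z := flow A l rho z); rewrite ?unit_words_perm.
have th0 : 0 <= x / (x + total l + rho) by rewrite divr_ge0 ?addr_ge0 ?total_ge0.
have [v' hv' pv'] := represents_tidy (uniq_codom s) th0 ((represents_perm s v _).2 hv).
exists v'; first exact/(represents_perm s).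
move=> i j c ij; apply: leq_trans (changes_le_cons _ (first i j s) _) _.
rewrite [X in (_ <= X)%N]changes_cons2 leq_add2l.
apply: leq_trans (cv i j _ ij).
by apply: pulled_perm_changes pv' => //; exact: represents_mem hv _.
Qed.

Lemma last_nonzero l : nonneg l -> 0 < total l -> exists l1 s x l2,
  [/\ l = l1 ++ (s, x) :: l2, x != 0, total l2 = 0 & nonneg l1].
Proof.
elim: l => [|[s x] l IH] /=; first by rewrite /total big_nil ltxx.
case/andP=> x0 nl; rewrite total_cons /=.
have [l0|ln] := eqVneq (total l) 0.
  by rewrite l0 addr0 => xp; exists [::], s, x, l; rewrite gt_eqF.
have lp : 0 < total l by rewrite lt_neqAle eq_sym ln total_ge0.
have [l1 [s' [x' [l2 [-> xn t2 n1]]]]] := IH nl lp.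
by exists ((s, x) :: l1), s', x', l2; rewrite /= x0.
Qed.

(** The last permutation of nonzero weight acts by 1, so that its word replaces
    the initial one and contributes one change. *)
Lemma flow_word0 l z : nonneg l -> 0 < total l -> unit_words all_letters z ->
  exists2 v, represents all_letters v (flow A l 0 z) & forall i j c, i != j ->
    (changes (c :: pair_sub i j v) <= (changes (c :: firsts i j l)).+1)%N.
Proof.
move=> nl tl Dz; have [l1 [s [x [l2 [lE xn t2 n1]]]]] := last_nonzero nl tl.
move: (nl); rewrite lE /nonneg all_cat /= -/(nonneg l2) => /and3P[_ x0 n2].
have D2 : unit_words all_letters (flow A l2 0 z) by apply: flow_in.
have E : flow A l 0 z = flow A l1 x (sig [seq (k, 1) | k <- codom s]).
  rewrite lE flow_cat total_cons t2 /= t2 !addr0 divff //; congr flow.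
  by apply: tidy1; rewrite ?uniq_codom // unit_words_perm.
have [v hv cv] := flow_word n1 x0 (represents_unit (perm_codom s)).
rewrite -lE; exists v; first by rewrite E.
move=> i j c ij; apply: leq_trans (cv i j c ij) _; rewrite pair_sub_codom //.
have -> : firsts i j l = rcons (firsts i j l1) (first i j s).
  rewrite lE /firsts filter_cat map_cat /= xn /=.
  have -> : [seq p <- l2 | p.2 != 0] = [::]; last by rewrite cats1.
  apply/eqP; rewrite -[_ == _]negbK -has_filter; apply/hasPn => p pl /=.
  move/eqP: t2; rewrite /total big_seq_cond psumr_eq0; last first.
    by move=> q /andP[/(allP n2)].
  by move=> /allP /(_ p pl); rewrite pl /= negbK.
rewrite -cat_rcons cats1 -!rcons_cons changes_rcons.
by rewrite -addn1 leq_add2l leq_b1.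
Qed.

Lemma changes_of_cons (s t : seq 'I_r) : (forall c, changes (c :: s) <= changes (c :: t))%N ->
  (changes s <= changes t)%N.
Proof.
move=> h; case: t h => [|a t] h; last first.
  by have := h a; rewrite [changes [:: a, a & t]]changes_cons2 eqxx; apply: leq_trans; exact: changes_cons_ge.
by case: s h => // a s h; apply: leq_trans (h a); rewrite changes_cons2 eqxx.
Qed.

End FlowWords.

(** ** The vertices on both sides of a cut *)

Section CutIndices.
Variable R : realType.
Implicit Types (x y : nat -> R).

Lemma cut_index n x rho y : cut n x rho y -> rho != 0 -> exists2 q, (q <= n)%N &
  [/\ y q != 0, forall k, (k <= n)%N -> x k != 0 -> (k <= q)%N &
      forall k, (k <= n)%N -> y k != 0 -> (q <= k)%N].
Proof.
case=> x0 r0 [y0 y1] _ o rn.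
have ex : exists q, (q <= n)%N && (y q != 0).
  apply: contrapT => h; move: y1; rewrite /cum big_nat big1 => [/eqP|k /andP[_ kn]].
    by rewrite eq_sym oner_eq0.
  by apply/eqP/negPn/negP => yk; apply: h; exists k; rewrite -ltnS kn.
case: (ex_minnP ex) => q /andP[qn yq] qmin; exists q => //; split=> //.
  move=> k kn; apply: contraNT; rewrite -ltnNge => qk.
  by move/eqP: (o k q qk kn); rewrite !mulf_eq0 (negbTE rn) (negbTE yq) !orbF.
by move=> k kn yk; apply: qmin; rewrite kn.
Qed.

Lemma filter_iota_low (P : pred nat) n q : (q <= n)%N ->
  (forall k, (k <= n)%N -> P k -> (k <= q)%N) ->
  subseq [seq k <- iota 0 n.+1 | P k] (iota 0 q.+1).
Proof.
move=> qn h; have -> : n.+1 = (q.+1 + (n - q))%N by rewrite addSn subnKC.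
rewrite iotaD filter_cat (_ : [seq k <- iota _ (n - q) | P k] = [::]) ?cats0 ?filter_subseq //.
apply/eqP; rewrite -[_ == _]negbK -has_filter; apply/hasPn => k; rewrite mem_iota add0n.
case/andP=> qk kn; apply/negP => pk; move: qk; rewrite ltnNge => /negP; apply; apply: h => //.
by move: kn; rewrite addSn subnKC.
Qed.

Lemma filter_iota_high (P : pred nat) n q : (q <= n)%N ->
  (forall k, (k <= n)%N -> P k -> (q <= k)%N) ->
  subseq [seq k <- iota 0 n.+1 | P k] (iota q (n.+1 - q)).
Proof.
move=> qn h; rewrite -{1}(subnKC (leqW qn)) iotaD filter_cat add0n.
rewrite (_ : [seq k <- iota 0 q | P k] = [::]) ?filter_subseq //.
apply/eqP; rewrite -[_ == _]negbK -has_filter; apply/hasPn => k; rewrite mem_iota add0n => /andP[_ kq].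
apply/negP => /(h _ (leq_trans (ltnW kq) qn)); by rewrite leqNgt kq.
Qed.

End CutIndices.

Section Equivalence.
Variables (R : realType) (r d : nat) (d0 : (0 < d)%N).
Implicit Types (i j c : 'I_r).

Let all_letters := enum 'I_r.
Let A := tidy_action R r.
Let J := join_action R ('S_r : choiceType).
Let X := diag (Surd r d).
Let Y := BEd r d.
Let CX := surd_coding r d.
Let CY := be_coding r d.
Let tc_d := tcd r d0.

Lemma firsts_be n (w : Y n) (x : nat -> R) i j :
  firsts i j (weigh (fun=> x) (be_lam w)) =
  [seq first i j (val w (inord k)) | k <- iota 0 n.+1 & x k != 0].
Proof.
by rewrite /firsts be_lamE /weigh -map_comp filter_map -map_comp.
Qed.

Lemma changes_be n (w : Y n) i j : (i < j)%N ->
  (changes [seq first i j (val w (inord k)) | k <- iota 0 n.+1] < d)%N.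
Proof.
move=> ij; have ne : i != j by apply: contraTneq ij => ->; rewrite ltnn.
have := be_befores w ij; rewrite -changes_first // -be_word_lam be_lamE.
by rewrite /unzip1 -!map_comp -ltnS prednK.
Qed.

Lemma changes_firsts n (w : Y n) (x : nat -> R) i j : (i < j)%N ->
  (changes (firsts i j (weigh (fun=> x) (be_lam w))) < d)%N.
Proof.
move=> ij; apply: leq_ltn_trans (changes_be w ij); rewrite firsts_be.
by apply: changes_subseq; apply: map_subseq; exact: filter_subseq.
Qed.

Lemma changes_le_firsts n (w : Y n) (x : nat -> R) i j (s : seq 'I_r) : (i < j)%N ->
  (forall c, changes (c :: s) <= (changes (c :: firsts i j (weigh (fun=> x) (be_lam w)))).+1)%N ->
  (changes s <= d)%N.
Proof.
move=> ij h; apply: leq_trans (changes_be w ij).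
pose c := first i j (val w (inord 0)).
apply: leq_trans (changes_cons_ge c s) _; apply: leq_trans (h c) _; rewrite ltnS.
rewrite firsts_be; apply: (@leq_trans (changes (c :: [seq first i j (val w (inord k)) | k <- iota 0 n.+1]))).
  by apply: changes_subseq_cons; apply: map_subseq; exact: filter_subseq.
by rewrite [iota 0 n.+1]/= [map _ _]/= changes_cons2 eqxx.
Qed.

(** When a cut of the weights splits the vertices, at most the vertex at the
    cut occurs on both sides. *)
Lemma changes_cut n (w : Y n) (x y : nat -> R) q i j : (i < j)%N -> (q <= n)%N ->
  (forall k, (k <= n)%N -> x k != 0 -> (k <= q)%N) ->
  (forall k, (k <= n)%N -> y k != 0 -> (q <= k)%N) ->
  (changes (firsts i j (weigh (fun=> x) (be_lam w)) ++
            firsts i j (weigh (fun=> y) (be_lam w))) < d)%N.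
Proof.
move=> ij qn hx hy; apply: leq_ltn_trans (changes_be w ij); rewrite !firsts_be -map_cat.
have sub := cat_subseq (filter_iota_low qn hx) (filter_iota_high qn hy).
apply: leq_trans (changes_subseq (map_subseq _ sub)) _.
have -> : iota 0 n.+1 = iota 0 q ++ iota q (n.+1 - q).
  by rewrite -{1}(subnKC (leqW qn)) iotaD.
rewrite -[q.+1]addn1 iotaD (subSn qn) !map_cat -catA add0n.
by rewrite [iota q 1]/= [iota q _.+1]/= !map_cons /= changes_dup.
Qed.

Lemma surd_image_of w (z : signature R 'I_r) : represents all_letters w z ->
  (forall i j, (i < j)%N -> (changes (pair_sub i j w) <= d)%N) -> sig_image CX z.
Proof. by move=> hw cw; have [x [t [st E _]]] := represents_surd hw cw; exists _, x, t. Qed.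

Lemma path_image0 n (w : Y n) (t : nat -> R) (z : signature R 'I_r) :
  simplex n t -> unit_words all_letters z ->
  exists2 v, represents all_letters v (path A CY w t 0 z) & forall i j c, i != j ->
    (changes (c :: pair_sub i j v) <=
     (changes (c :: firsts i j (weigh (fun=> t) (be_lam w)))).+1)%N.
Proof.
move=> [t0 t1] Dz; apply: flow_word0 => //.
  by apply: (weigh_nonneg CY).
by rewrite be_total t1 ltr01.
Qed.

Lemma path_image_surd n (w : Y n) (t : nat -> R) (z : signature R 'I_r) :
  simplex n t -> unit_words all_letters z ->
  sig_image CX (path A CY w t 0 z).
Proof.
move=> st Dz; have [v hv cv] := path_image0 w st Dz; apply: (surd_image_of hv) => i j ij.
apply: (changes_le_firsts (w := w) (x := t) ij) => c; apply: cv.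
by apply: contraTneq ij => ->; rewrite ltnn.
Qed.

Lemma image_unit_words (z : signature R 'I_r) : sig_image CX z -> unit_words (R := R) all_letters z.
Proof. by move=> /surd_image_represents[w hw _]; exists w. Qed.

(** ** From permutations to sequences *)

Definition base_sig : signature R 'I_r := sig [seq (k, 1) | k <- all_letters].

Lemma base_sig_unit : unit_words all_letters base_sig.
Proof. by exists all_letters; apply: represents_unit; exact: perm_refl. Qed.

Definition smap_id (Z : sset) : smap Z Z := SMap (fun m n (a : dmap m n) x => erefl (sop a x)).

Lemma CY_vertices n (w : Y n) : unzip2 (lam CY w) = iota 0 n.+1.
Proof. exact: be_lam_snd. Qed.

(** The flow of a point of the realization of [Y], of total weight 1, from any
    start. *)
Definition unfold_sig (z : signature R 'S_r) : signature R 'I_r :=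
  sweep A CY CY (smap_id Y) (fun=> base_sig) z 1.

Lemma unfold_sigE n (w : Y n) (t : nat -> R) : simplex n t ->
  unfold_sig (sigc CY w t) = path A CY w t 0 base_sig.
Proof.
move=> st; rewrite /unfold_sig (sweep1 _ CY_vertices) //.
by move=> *; exact: base_sig_unit.
Qed.

Lemma unfold_sig_image (z : signature R 'S_r) : sig_image CY z -> sig_image CX (unfold_sig z).
Proof.
by case=> n [w [t [st <-]]]; rewrite unfold_sigE //; apply: path_image_surd => //; exact: base_sig_unit.
Qed.

Lemma unfold_sig_continuous : {within sig_image CY, continuous unfold_sig}.
Proof.
have c0 (V : topologicalType) (v : V) : {within sig_image CY, continuous (fun _ : signature R 'S_r => v)}.
  have cv : continuous (fun _ : signature R 'S_r => v) by exact: cst_continuous.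
  exact: (continuous_subspaceT cv).
have c1 : {within sig_image CY, continuous (fun z : signature R 'S_r => (z, 1 : R))}.
  apply: (within_pair _ (c0 _ (1 : R))); apply: continuous_subspaceT => z; exact: cvg_id.
have c2 := @sweep_continuous R _ _ _ A _ CY CY_vertices _ _ CY (smap_id Y) (fun=> base_sig)
  (fun _ _ => base_sig_unit) (be_dim r d) (@signature_hausdorff R _) (be_bounded R r d).
have sub (z : signature R 'S_r) : sig_image CY z -> sig_image CY (z, 1 : R).1 /\ 0 <= (z, 1 : R).2 <= 1.
  by move=> hz; rewrite /= ler01 lexx.
exact: (within_comp c1 (c2 (c0 _ base_sig)) sub).
Qed.

(** ** The map of realizations *)

Let B := realization R X.
Let E := realization R Y.
Let f : B -> E := realization_map tc_d.

Lemma f_continuous : continuous f.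
Proof.
apply: real_continuous => n x.
have -> : (fun t : splx R n => f (to_realization (cell x t))) =
    (fun t => to_realization (cell (tc_d n x) t)).
  by apply/funext => t; rewrite /f realization_mapE.
exact: cell_continuous.
Qed.

Lemma real_sig_f n (x : X n) (t : splx R n) :
  real_sig CY (f (to_realization (cell x t))) = sigc CY (tc_d n x) (wt t).
Proof. by rewrite /f realization_mapE real_sigE. Qed.

Lemma exists_point : exists b : B, True.
Proof.
have [z [hz _]] : exists z, sig_image CX z /\ z = base_sig.
  exists base_sig; split=> //; have hw : represents all_letters all_letters base_sig.
    by apply: represents_unit; exact: perm_refl.
  apply: (surd_image_of hw) => i j ij; have ne : i != j.
    by apply: contraTneq ij => ->; rewrite ltnn.
  have -> : all_letters = codom (1%g : 'S_r).
    by rewrite codomE (eq_map (g := id)) ?map_id // => k; rewrite perm1.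
  rewrite pair_sub_codom // changes_cons2 addn0; exact: leq_trans (leq_b1 _) d0.
by have [b _] := sig_image_real hz; exists b.
Qed.

Definition base_point : B := projT1 (cid exists_point).

Definition tc_inverse (e : E) : B := real_of CX (unfold_sig (real_sig CY e)) base_point.

Lemma tc_inverse_continuous : continuous tc_inverse.
Proof.
have c1 : {within [set: E], continuous (@real_sig R _ _ CY)}.
  by apply: continuous_subspaceT; exact: real_sig_continuous.
have h1 (e : E) : [set: E] e -> sig_image CY (real_sig CY e) by move=> _; exact: real_sig_image.
have h2 (e : E) : [set: E] e -> sig_image CX (unfold_sig (real_sig CY e)).
  by move=> /h1; exact: unfold_sig_image.
have c2 := within_comp c1 unfold_sig_continuous h1.
have c3 := within_comp c2 (real_of_continuous (q0 := base_point) (surd_bounded R r d)) h2.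
by apply/continuous_subspace_setT; exact: c3.
Qed.

Definition refold_sig (z : signature R 'S_r) : signature R 'S_r :=
  real_sig CY (f (real_of CX (unfold_sig z) base_point)).

Lemma refold_sig_continuous : {within sig_image CY, continuous refold_sig}.
Proof.
have c1 := within_comp unfold_sig_continuous (real_of_continuous (q0 := base_point) (surd_bounded R r d))
  unfold_sig_image.
have c2 : {within [set: B], continuous f}.
  by apply: continuous_subspaceT; exact: f_continuous.
have c3 : {within [set: E], continuous (@real_sig R _ _ CY)}.
  by apply: continuous_subspaceT; exact: real_sig_continuous.
exact: (within_comp (within_comp c1 c2 (fun _ _ => I)) c3 (fun _ _ => I)).
Qed.

Lemma be_sig_nil (z : signature R 'S_r) : sig_image CY z -> z [::] = 1 :> R.
Proof. by case=> n [w [t [_ <-]]]; rewrite /sigc sig_nil. Qed.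

Lemma refold_sig_in (z : signature R 'S_r) : sig_image CY z -> refold_sig z [::] = 1.
Proof. by move=> _; apply: be_sig_nil; exact: real_sig_image. Qed.

Lemma refold_sigE n (w : Y n) (y : nat -> R) : simplex n y ->
  exists m (x : X m) t, [/\ simplex m t, refold_sig (sigc CY w y) = sigc CY (tc_d m x) t &
    forall i j c, i != j -> (changes (c :: pair_sub i j (surd_word x)) <=
      (changes (c :: firsts i j (weigh (fun=> y) (be_lam w)))).+1)%N].
Proof.
move=> sy; have [v hv cv] := path_image0 w sy base_sig_unit.
have cd i j : (i < j)%N -> (changes (pair_sub i j v) <= d)%N.
  move=> ij; apply: (changes_le_firsts (w := w) (x := y) ij) => c; apply: cv.
  by apply: contraTneq ij => ->; rewrite ltnn.
have [x [t [st Ex cx]]] := represents_surd hv cd.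
exists (surd_dim r d), x, t; split=> //; last first.
  by move=> i j c ij; apply: leq_trans (cx i j c) (cv i j c ij).
have [u uE] := mksplx st.
rewrite /refold_sig unfold_sigE // -Ex.
have -> : real_of CX (sigc CX x t) base_point = to_realization (cell x u).
  apply: (real_sig_inj (C := CX)); rewrite real_ofK; last by exists _, x, t.
  by rewrite real_sigE; apply: sigc_eq => i /uE ->.
by rewrite real_sig_f; exact: sigc_eq.
Qed.

(** ** The two homotopies *)

(** The sequence of [x] itself bounds the complexity: the permutations up to the
    vertex [q] of the cut are those of its occurrences before [q], and the rest
    consists of occurrences from [q] on. *)
Lemma sweep_surd_image n (x : X n) (xi : nat -> R) rho y : cut n xi rho y ->
  sig_image CX (path A CY (tc_d n x) xi rho (sigc CX x y)).
Proof.
move=> c; have [xi0 r0 sy s1 _] := c.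
have Dz : unit_words all_letters (sigc CX x y) by apply: image_unit_words; exists n, x, y.
have [rho0|rn] := eqVneq rho 0.
  rewrite rho0; apply: path_image_surd => //; split=> //.
  by rewrite -s1 rho0 addr0.
have nl : nonneg (weigh (fun=> xi) (lam CY (tc_d n x))) by apply: (weigh_nonneg CY).
have [v hv cv] := flow_word nl r0 (surd_represents x sy).
apply: (surd_image_of hv) => i j ij.
have ne : i != j by apply: contraTneq ij => ->; rewrite ltnn.
have [q qn [_ qxi qy]] := cut_index c rn.
apply: leq_trans (changes_of_cons (fun c => cv i j c ne)) _.
have /forallP/(_ i)/forallP/(_ j)/implyP/(_ ij) := valP x.
apply: leq_trans; rewrite -/(pair_sub i j _) -/(surd_word x).
apply: leq_trans (changes_subseq (subseq_late (surd_count x) ne qn)).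
have [L EL _] := late_head (surd_count x) ne qn.
pose F k := first i j (vertex_perm (surd_word x) k).
have firstsE : firsts i j (weigh (fun=> xi) (be_lam (tc_d n x))) =
    [seq F k | k <- iota 0 n.+1 & xi k != 0].
  rewrite firsts_be; apply/eq_in_map => k; rewrite mem_filter mem_iota add0n => /andP[_ kn].
  by rewrite /F /= ffunE inordK.
have lateE : subseq (pair_sub i j [seq p.1 | p <- labels (surd_word x) & y p.2 != 0])
    (unzip1 (late (surd_word x) i j q)).
  rewrite /pair_sub filter_map -filter_predI; apply: map_subseq.
  rewrite /late; set a := predI _ _; set b := fun p => _ && _.
  have -> : [seq p <- labels (surd_word x) | a p] =
      [seq p <- [seq p <- labels (surd_word x) | b p] | a p].
    rewrite -filter_predI; apply: eq_in_filter => -[l k].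
    rewrite (mem_labels (surd_count x)) => kn; rewrite /a /b /=.
    case: (boolP ((l == i) || (l == j))) => //= _; rewrite ?andbF //.
    by case: (boolP (y k != 0)) => //= yk; rewrite qy.
  exact: filter_subseq.
(* the vertex [q] may occur on both sides; then its first letter is repeated,
   which is no change *)
have sub := cat_subseq (map_subseq F (filter_iota_low qn qxi)) lateE.
rewrite [lam _ _]/(be_lam (tc_d n x)) firstsE.
apply: leq_trans (changes_subseq sub) _; rewrite EL.
by rewrite -addn1 iotaD map_cat -catA /= changes_dup.
Qed.

Lemma scla_flow l (rho : R) z : nonneg l -> 0 <= rho ->
  scla (total l + rho) (flow J l rho z) = foldr (fun p => expm p.1 p.2) (scla rho z) l.
Proof.
move=> + r0; elim: l => [_|[k x] l IH] /=; first by rewrite /total big_nil add0r.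
case/andP=> x0 nl; rewrite -IH // total_cons /= /join_act.
have T0 := total_ge0 nl; rewrite -addrA; set M := total l + rho.
have M0 : 0 <= M by rewrite addr_ge0.
have [E0|En] := eqVneq (x + M) 0.
  have xz : x = 0 by apply/eqP; move/eqP: E0; rewrite paddr_eq0 // => /andP[].
  by rewrite E0 xz mul0r !expm0 subr0 scla1 -E0 xz add0r.
rewrite scla_expm sclaM; congr (expm _ _ (scla _ _)); first by rewrite mulrC divfK.
by rewrite mulrBr mulr1 mulrCA divff // mulr1 [x + M]addrC addrK.
Qed.

(** The chain of permutations up to the cut is followed by one obtained from the
    rest of the chain, whose complexity is at most that of the rest, since the
    detour through sequences first adds one change and then removes one. *)
Lemma sweep_be_image n (w : Y n) (xi : nat -> R) rho y : cut n xi rho y ->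
  sig_image CY (path J CY w xi rho (refold_sig (sigc CY w y))).
Proof.
move=> c; have [xi0 r0 sy s1 _] := c.
have nl : nonneg (weigh (fun=> xi) (be_lam w)) by apply: (weigh_nonneg CY).
have tl : total (weigh (fun=> xi) (be_lam w)) + rho = 1 by rewrite be_total.
have [s2 _ t2 n2] := drop_zero (weigh (fun=> xi) (be_lam w)).
have [m [x [t [st Er cr]]]] := refold_sigE w sy.
have pE : path J CY w xi rho (refold_sig (sigc CY w y)) =
    foldr (fun p => expm p.1 p.2) (scla rho (refold_sig (sigc CY w y))) (weigh (fun=> xi) (be_lam w)).
  by rewrite -scla_flow // tl scla1.
set l1 := [seq p <- weigh (fun=> xi) (be_lam w) | p.2 != 0] in s2 t2 n2.
have dropE z : foldr (fun p => expm p.1 p.2) z l1 =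
    foldr (fun p => expm p.1 p.2) z (weigh (fun=> xi) (be_lam w)).
  rewrite /l1; elim: (weigh _ _) => //= p l IH; case: eqVneq => /= [->|_]; by rewrite ?expm0 IH.
(* for [rho = 0] the second part has to be left out, as nothing bounds its
   complexity together with that of the first part *)
pose l2 := if rho == 0 then [::] else
  [seq (p.1, rho * p.2) | p <- weigh (fun=> t) (be_lam (tc_d m x))].
have pL : path J CY w xi rho (refold_sig (sigc CY w y)) = sig (l1 ++ l2).
  rewrite pE sig_cat dropE; congr foldr; rewrite /l2 Er; case: eqVneq => [->|_].
    by apply: scla0; rewrite /sigc sig_nil.
  by rewrite scla_sig.
suff [w' [t' [st' E']]] : exists (w' : Y (be_dim r d)) t', simplex (be_dim r d) t' /\
    sigc CY w' t' = sig (l1 ++ l2) by exists _, w', t'; rewrite pL.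
apply: be_image.
- rewrite /nonneg all_cat -!/(nonneg _) n2 //= /l2; case: ifP => // _.
  rewrite /nonneg all_map; apply/allP => p pl /=; rewrite mulr_ge0 //.
  by have := weigh_nonneg CY (tc_d m x) st.1 => /allP /(_ p pl).
- rewrite total_cat t2 -tl; congr (_ + _); rewrite /l2; case: eqVneq => [->|_].
    by rewrite /total big_nil.
  rewrite /total big_map -mulr_sumr -/(total _) be_total.
  by rewrite st.2 mulr1.
move=> i j ij; have ne : i != j by apply: contraTneq ij => ->; rewrite ltnn.
rewrite -changes_first // -ltnS prednK // /unzip1 map_cat map_cat -map_comp.
rewrite -/(firsts i j (weigh (fun=> xi) (be_lam w))) /l2.
have [rho0|rn] := eqVneq rho 0; first by rewrite cats0; exact: changes_firsts.
have [q qn [yq qxi qy]] := cut_index c rn.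
apply: leq_ltn_trans (changes_cut w ij qn qxi qy).
have -> : [seq first i j s | s <- [seq p.1 | p <- [seq (p.1, rho * p.2)
    | p <- weigh (fun=> t) (be_lam (tc_d m x))]]] =
    [seq first i j s | s <- be_word (tc_d m x)].
  by rewrite -be_word_lam /unzip1 /weigh -!map_comp.
apply: changes_cat_le => [c'|]; last first.
  rewrite firsts_be; have : q \in [seq k <- iota 0 n.+1 | y k != 0].
    by rewrite mem_filter yq mem_iota /= ltnS.
  by case: [seq k <- iota 0 n.+1 | y k != 0].
rewrite -ltnS; apply: leq_trans (cr i j c' ne).
apply: leq_trans (changes_subseq_cons c' (subseq_firsts (surd_count x) ne (leqnn m))).
rewrite tcd_word -map_comp; set s := map _ _; rewrite /s.
rewrite -[m.+1]addn1 iotaD !map_cat /= !cats1 -!rcons_cons changes_rcons.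
by rewrite first_neq // addn1 leqnn.
Qed.

Let itv : set R := `[0, 1]%classic.

(** At the end of the sweep the whole weight flows, and the flow does not depend
    on its start. *)
Lemma homotopy_gf : homotopic R (tc_inverse \o f) id.
Proof.
pose sw := sweep A CY CX tc_d (fun z : signature R 'I_r => z).
have psi_in (z : signature R 'I_r) : sig_image CX z -> unit_words all_letters z := @image_unit_words z.
have img z tau : sig_image CX z -> 0 <= tau <= 1 -> sig_image CX (sw z tau).
  apply: (@sweep_ind R _ _ _ A _ CY CY_vertices _ _ CX tc_d _ psi_in (fun _ _ v => sig_image CX v)).
  by move=> n x xi rho y c; exact: sweep_surd_image.
exists (fun p => real_of CX (sw (real_sig CX p.1) (1 - p.2)) base_point); split.
  have c1 : {within [set: B] `*` itv, continuous (fun p : B * R => (real_sig CX p.1, 1 - p.2))}.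
    apply: continuous_subspaceT => -[b tau].
    have c2 : p.1 @[p --> (b, tau)] --> b by exact: cvg_fst.
    have c3 : p.2 @[p --> (b, tau)] --> tau by exact: cvg_snd.
    have c4 : real_sig CX p.1 @[p --> (b, tau)] --> real_sig CX b.
      by apply: cvg_comp c2 _; exact: real_sig_continuous.
    have c5 : 1 - p.2 @[p --> (b, tau)] --> 1 - tau by exact: (cvgB (cvg_cst _) c3).
    exact: (cvg_pair c4 c5).
  have cid' : {within sig_image CX, continuous (fun z : signature R 'I_r => z)}.
    by apply: continuous_subspaceT => z; exact: cvg_id.
  have c2 := sweep_continuous (A := A) CY_vertices (phi := tc_d) psi_in
    (@signature_hausdorff R _) (surd_bounded R r d) cid'.
  have h1 (p : B * R) : ([set: B] `*` itv) p ->
      sig_image CX (real_sig CX p.1) /\ 0 <= 1 - p.2 <= 1.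
    case=> _; rewrite /itv /= in_itv /= => /andP[p0 p1]; split; first exact: real_sig_image.
    by apply/andP; split; lra.
  apply: (within_comp (within_comp c1 c2 h1) (real_of_continuous (q0 := base_point) (surd_bounded R r d))).
  by move=> p /h1 [h2 h3]; exact: img.
elim/real_ind => n x t; rewrite /= subr0 subrr; split; last first.
  by rewrite /sw sweep0 ?real_sigK //; [exact: CY_vertices|exact: real_sig_image].
have st := wt_simplex t.
rewrite /tc_inverse /= real_sig_f real_sigE unfold_sigE // /sw (sweep1 _ CY_vertices) //.
apply: (congr1 (fun z => real_of CX z base_point)).
apply: flow_const; [| |exact: base_sig_unit|].
- by apply: (weigh_nonneg CY) => i; apply: (wt_simplex t).1.
- by apply: psi_in; exists n, x, (wt t); split=> //; exact: wt_simplex.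
- by rewrite be_total (wt_simplex t).2 ltr01.
Qed.

(** At the end of the sweep the whole weight is written in front of a word of
    weight 0. *)
Lemma homotopy_fg : homotopic R (f \o tc_inverse) id.
Proof.
pose sw := sweep J CY CY (smap_id Y) refold_sig.
have img z tau : sig_image CY z -> 0 <= tau <= 1 -> sig_image CY (sw z tau).
  apply: (@sweep_ind R _ _ _ J _ CY CY_vertices _ _ CY (smap_id Y) _ refold_sig_in
    (fun _ _ v => sig_image CY v)).
  by move=> n x xi rho y c; exact: sweep_be_image.
pose e0 : E := f base_point.
exists (fun p => real_of CY (sw (real_sig CY p.1) p.2) e0); split.
  have c1 : {within [set: E] `*` itv, continuous (fun p : E * R => (real_sig CY p.1, p.2))}.
    apply: continuous_subspaceT => -[b tau].
    have c2 : p.1 @[p --> (b, tau)] --> b by exact: cvg_fst.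
    have c3 : p.2 @[p --> (b, tau)] --> tau by exact: cvg_snd.
    have c4 : real_sig CY p.1 @[p --> (b, tau)] --> real_sig CY b.
      by apply: cvg_comp c2 _; exact: real_sig_continuous.
    exact: (cvg_pair c4 c3).
  have c2 := sweep_continuous (A := J) CY_vertices (phi := smap_id Y) refold_sig_in
    (@signature_hausdorff R _) (be_bounded R r d) refold_sig_continuous.
  have h1 (p : E * R) : ([set: E] `*` itv) p ->
      sig_image CY (real_sig CY p.1) /\ 0 <= p.2 <= 1.
    by case=> _; rewrite /itv /= in_itv /=; split=> //; exact: real_sig_image.
  apply: (within_comp (within_comp c1 c2 h1) (real_of_continuous (q0 := e0) (be_bounded R r d))).
  by move=> p /h1 [h2 h3]; exact: img.
move=> e; split.
  rewrite /sw sweep0; [|exact: CY_vertices|exact: refold_sig_in|exact: real_sig_image].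
  by rewrite /refold_sig real_sigK.
rewrite -[RHS](real_sigK CY e0 e); congr (real_of _ _ _).
elim/real_ind: e => n w t; rewrite /= real_sigE /sw.
rewrite (sweep1 _ CY_vertices); [|exact: refold_sig_in|exact: wt_simplex].
have [t0 t1] := wt_simplex t.
have nl : nonneg (weigh (fun=> wt t) (be_lam w)) by apply: (weigh_nonneg CY).
have := scla_flow (refold_sig (sigc CY w (wt t))) nl (lexx 0).
rewrite be_total t1 addr0 scla1 scla0; last first.
  by apply: refold_sig_in; exists n, w, (wt t).
by move=> E'; rewrite /path E'.
Qed.

Lemma weak_equivalence_tcd : weak_equivalence R tc_d.
Proof.
split; first exact: f_continuous.
by exists tc_inverse; split; [exact: tc_inverse_continuous|exact: homotopy_gf|exact: homotopy_fg].
Qed.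

End Equivalence.

(** * Shuffles and lattice paths *)

(** ** Linear extensions *)

Section LinearExtension.
Variables (K : comNzRingType) (T : choiceType) (D : T -> Prop) (V : lmodType K).
Variable F : T -> V.
Implicit Types c : nchains K D.

Lemma linext_seq c (s : seq {x : T | `[< ~ D x >]}) : uniq s -> {subset msupp c <= s} ->
  linext F c = \sum_(x <- s) mcoeff x c *: F (val x).
Proof.
move=> us sub; rewrite /linext [RHS](bigID (mem (msupp c))) /= [X in _ = _ + X]big1 ?addr0.
  rewrite -[RHS]big_filter; apply: perm_big; apply: uniq_perm; rewrite ?filter_uniq ?fset_uniq //.
  by move=> x; rewrite mem_filter; apply/idP/andP => [xc|[]//]; split=> //; exact: sub.
by move=> x xc; rewrite mcoeff_outdom ?scale0r.
Qed.

Lemma linextD c c' : linext F (c + c') = linext F c + linext F c'.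
Proof.
pose s := undup (msupp c ++ msupp c' ++ msupp (c + c') : seq _).
have us : uniq s by exact: undup_uniq.
rewrite (linext_seq (s := s)) // => [|x h]; last by rewrite mem_undup !mem_cat h !orbT.
rewrite (@linext_seq c s) // => [|x h]; last by rewrite mem_undup !mem_cat h.
rewrite (@linext_seq c' s) // => [|x h]; last by rewrite mem_undup !mem_cat h orbT.
by rewrite -big_split; apply: eq_bigr => x _; rewrite mcoeffD scalerDl.
Qed.

Lemma linextZ a c : linext F (a *: c) = a *: linext F c.
Proof.
pose s := undup (msupp c ++ msupp (a *: c) : seq _).
have us : uniq s by exact: undup_uniq.
rewrite (@linext_seq (a *: c) s) // => [|x h]; last by rewrite mem_undup mem_cat h orbT.
rewrite (@linext_seq c s) // => [|x h]; last by rewrite mem_undup mem_cat h.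
by rewrite scaler_sumr; apply: eq_bigr => x _; rewrite mcoeffZ scalerA.
Qed.

Lemma linext0 : linext F (0 : nchains K D) = 0.
Proof. by rewrite -[0 in LHS](scale0r 0) linextZ scale0r. Qed.

Lemma linext_sum (I : Type) (s : seq I) (P : pred I) (c : I -> nchains K D) :
  linext F (\sum_(i <- s | P i) c i) = \sum_(i <- s | P i) linext F (c i).
Proof. by apply: (big_morph _ linextD linext0). Qed.

Lemma linext_class x : (D x -> F x = 0) -> linext F (nclass K D x) = F x.
Proof.
move=> F0; rewrite /nclass; case: insubP => [y _ <-|].
  by rewrite /linext msuppU oner_eq0 big_seq_fset1 mcoeffUU scale1r.
by move/asboolPn/contrapT => /F0 ->; exact: linext0.
Qed.

End LinearExtension.

Lemma sclass_degenerate (K : comNzRingType) (X : sset) n (x : X n) :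
  sdegenerate (Tagged (fun n => X n) x) -> sclass K x = 0.
Proof. by move=> dx; rewrite /sclass /nclass insubN //; apply/asboolPn; apply. Qed.

Lemma Nmap_sclass (K : comNzRingType) (X Y : sset) (f : smap X Y) n (x : X n) :
  Nmap f (sclass K x) = sclass K (f n x).
Proof.
rewrite /Nmap linext_class // => -[m [i [y E]]]; apply: sclass_degenerate.
by exists m, i, (f m y); rewrite E /= sfun_nat.
Qed.

Lemma NmapZ (K : comNzRingType) (X Y : sset) (f : smap X Y) a (c : sN K X) :
  Nmap f (a *: c) = a *: Nmap f c.
Proof. exact: linextZ. Qed.

Lemma Nmap_sum (K : comNzRingType) (X Y : sset) (f : smap X Y) (I : Type) (s : seq I)
    (P : pred I) (c : I -> sN K X) :
  Nmap f (\sum_(i <- s | P i) c i) = \sum_(i <- s | P i) Nmap f (c i).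
Proof. exact: linext_sum. Qed.

(** ** The bijection *)

Section Shuffles.
Variables (k : nat) (n : 'I_k -> nat).
Implicit Types (l : 'I_k) (s : 'S_(tdim n)) (b : 'I_(tdim n)) (t : 'I_(tdim n).+1).
Implicit Types g : {ffun 'I_(tdim n).+1 -> vertex n}.

(* The partial sums of the block sizes: the block of [l] is the interval from
   [psum l] to [psum l.+1]. *)
Let psum p := (\sum_(j < k | (j < p)%N) n j)%N.

Lemma psumS l : psum l.+1 = (psum l + n l)%N.
Proof.
rewrite /psum (bigD1 l) //= addnC; congr addn; apply: eq_bigl => j.
by rewrite ltnS andbC ltn_neqAle.
Qed.

Lemma psum_le p q : (p <= q)%N -> (psum p <= psum q)%N.
Proof.
move=> pq; rewrite /psum [X in (_ <= X)%N](bigID (fun j : 'I_k => (j < p)%N)) /=.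
rewrite (eq_bigl (fun j : 'I_k => (j < q)%N && (j < p)%N)) ?leq_addr // => j.
by case: (ltnP j p) => jp; rewrite ?andbF // (leq_trans jp pq).
Qed.

Lemma psum_tdim : psum k = tdim n.
Proof. by apply: eq_bigl => j; rewrite ltn_ord. Qed.

Lemma block_end l : (offset n l + n l <= tdim n)%N.
Proof. by rewrite -psum_tdim -[offset n l]/(psum l) -psumS psum_le. Qed.

Lemma in_block_ex b : exists l, in_block l b.
Proof.
have [p pk bp] : exists2 p, (p <= k)%N & (b < psum p)%N.
  by exists k => //; rewrite psum_tdim.
elim: p pk bp => [|p IH] pk; first by rewrite /psum big_pred0.
case: (ltnP b (psum p)) => h; first by move=> _; apply: IH => //; exact: ltnW.
by rewrite (psumS (Ordinal pk)) => h'; exists (Ordinal pk); rewrite /in_block h.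
Qed.

Lemma in_block_inj l l' b : in_block l b -> in_block l' b -> l = l'.
Proof.
wlog ll : l l' / (l <= l')%N => [h|].
  by case: (leqP l l') => [/h|/ltnW /h hl p q]; [apply|apply/esym/hl].
move=> /andP[_ bl] /andP[bl' _]; apply: val_inj; apply/eqP; rewrite eqn_leq ll /=.
rewrite leqNgt; apply/negP => lt; move: (leq_ltn_trans bl' bl).
by rewrite -[offset n l]/(psum l) -psumS ltnNge psum_le.
Qed.

Lemma card_interval N a c : (a + c <= N)%N -> #|[pred b : 'I_N | (a <= b < a + c)%N]| = c.
Proof.
move=> acN; have lt (i : 'I_c) : (a + i < N)%N by apply: leq_trans acN; rewrite ltn_add2l.
have inj : injective (fun i => Ordinal (lt i)).
  by move=> i j /(congr1 val) /= /addnI /val_inj.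
rewrite -[RHS](card_ord c) -(card_imset _ inj); apply: eq_card => b.
rewrite !inE; apply/andP/imsetP => [[ab bc]|[i _ ->]] /=; last by rewrite leq_addr ltn_add2l.
have bac : (b - a < c)%N by rewrite ltn_subLR.
by exists (Ordinal bac) => //; apply: val_inj; rewrite /= subnKC.
Qed.

Lemma count_le s l (t : nat) : (#|[pred b | in_block l b & (s b < t)%N]| <= n l)%N.
Proof.
rewrite -[X in (_ <= X)%N](card_interval (block_end l)); apply: subset_leq_card.
by apply/fintype.subsetP => b; rewrite !inE => /andP[].
Qed.

Lemma shuffle_compE s l t :
  shuffle_comp s l t = #|[pred b | in_block l b & (s b < t)%N]| :> nat.
Proof. by rewrite ffunE inordK // ltnS count_le. Qed.

Definition shuffle_path s : {ffun 'I_(tdim n).+1 -> vertex n} :=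
  [ffun t => [ffun l => shuffle_comp s l t]].

Lemma shuffle_pathE s t l : shuffle_path s t l = shuffle_comp s l t.
Proof. by rewrite !ffunE. Qed.

Lemma shuffle_path_step s l (q : 'I_(tdim n)) : in_block l ((s^-1)%g q) -> forall l',
  shuffle_path s (step_tgt q) l' = (shuffle_path s (step_src q) l' + (l' == l))%N :> nat.
Proof.
move=> ql l'; rewrite !shuffle_pathE !shuffle_compE /= /bump leq0n add1n.
set c := ((s^-1)%g q) in ql *; rewrite [LHS](cardD1 c) inE /= permKV ltnSn andbT addnC.
have -> : in_block l' c = (l' == l).
  by apply/idP/eqP => [h|->//]; exact: in_block_inj h ql.
congr addn; apply: eq_card => b'; rewrite !inE ltnS leq_eqVlt andbCA.
by case: (eqVneq b' c) => [->|bc] /=; rewrite ?permKV ?ltnn ?andbF //;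
  rewrite -[_ == _ :> nat]/(s b' == q) (can2_eq (permK s) (permKV s)) (negbTE bc).
Qed.

Lemma shuffle_path_is_path s : is_path (shuffle_path s).
Proof.
apply/and3P; split.
- by apply/forallP => l; rewrite shuffle_pathE shuffle_compE eq_card0 // => b; rewrite inE ltn0 andbF.
- apply/forallP => l; rewrite shuffle_pathE shuffle_compE /=.
  rewrite -[X in _ == X](card_interval (block_end l)); apply/eqP; apply: eq_card => b.
  by rewrite !inE ltn_ord andbT.
- apply/forallP => q; have [l ql] := in_block_ex ((s^-1)%g q).
  by apply/existsP; exists l; apply/forallP => l'; apply/eqP; exact: shuffle_path_step.
Qed.

Lemma shuffle_ltn s l b b' : shuffle s -> in_block l b -> in_block l b' ->
  (s b < s b')%N = (b < b')%N.
Proof.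
move=> /forallP/(_ l) sh bl bl'.
have mono a c : in_block l a -> in_block l c -> (a < c)%N -> (s a < s c)%N.
  by move=> al cl ac; have /forallP/(_ a)/forallP/(_ c) := sh; rewrite al cl ac.
case: (ltngtP b b') => [||/val_inj ->]; [exact: mono| |by rewrite ltnn].
by move=> /(mono _ _ bl' bl) /ltnW; rewrite leqNgt => /negbTE.
Qed.

Lemma encodes_shuffle_path s : shuffle s -> encodes (shuffle_path s) s.
Proof.
move=> sh; apply/forallP => l; apply/forallP => b; apply/implyP => bl.
rewrite (@shuffle_path_step s l) ?permK // eqxx addn1 eqSS andbb.
rewrite shuffle_pathE shuffle_compE /=; have /andP[lb be] := bl.
have bE : (offset n l + (b - offset n l) <= tdim n)%N by rewrite subnKC // ltnW.
rewrite -[X in _ == X](card_interval bE) subnKC //; apply/eqP; apply: eq_card => b'.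
rewrite !inE /in_block; apply/andP/andP => [[b'l]|[lb' b'b]].
  by rewrite (shuffle_ltn sh b'l bl) => ?; split=> //; case/andP: b'l.
have b'l : in_block l b' by rewrite /in_block lb' (ltn_trans b'b).
by rewrite (shuffle_ltn sh b'l bl).
Qed.

Lemma path_mono g l : is_path g -> {homo (fun t => g t l : nat) : t t' / (t <= t')%N}.
Proof.
case/and3P=> _ _ /forallP st.
have h m t t' : t' = (t + m)%N :> nat -> (g t l <= g t' l)%N.
  elim: m t' => [|m IH] t' E; first by rewrite (_ : t' = t) //; apply: val_inj; rewrite /= E addn0.
  have qm : (t + m < tdim n)%N by rewrite -ltnS -addnS -E ltn_ord.
  have /existsP[l' /forallP/(_ l)/eqP] := st (Ordinal qm).
  rewrite (_ : step_tgt _ = t'); last by apply: val_inj; rewrite /= /bump leq0n E addnS.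
  by move=> ->; apply: leq_trans (leq_addr _ _); apply: IH.
by move=> t t' tt; apply: (h (t' - t)%N); rewrite subnKC.
Qed.

(** A path takes the step from [i] to [i.+1] in a given direction only once,
    so it determines the permutation which encodes it. *)
Lemma encodes_inj g s s' : is_path g -> encodes g s -> encodes g s' -> s = s'.
Proof.
move=> pg es es'; apply/permP => b; have [l bl] := in_block_ex b.
have lt u v : encodes g u -> encodes g v -> (u b <= v b)%N.
  move=> /forallP/(_ l)/forallP/(_ b)/implyP/(_ bl)/andP[/eqP u1 _].
  move=> /forallP/(_ l)/forallP/(_ b)/implyP/(_ bl)/andP[_ /eqP v2].
  rewrite leqNgt; apply/negP => vu.
  have := path_mono l pg (x := step_tgt (v b)) (y := step_src (u b)).
  by rewrite /= /bump leq0n add1n v2 u1 ltnn => /(_ vu).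
by apply: val_inj; apply/eqP; rewrite eqn_leq !lt.
Qed.

Lemma path_permK s : shuffle s -> path_perm (shuffle_path s) = s.
Proof.
move=> sh; rewrite /path_perm; case: pickP => [s' /= es|/(_ s)]; last first.
  by rewrite encodes_shuffle_path.
exact: encodes_inj (shuffle_path_is_path s) es (encodes_shuffle_path sh).
Qed.

(** The element of a block which a step of the path corresponds to is read off
    from the direction and the height of the step; its inverse is the shuffle
    of the path. *)
Lemma shuffle_of_path g : is_path g -> exists2 s, shuffle s & shuffle_path s = g.
Proof.
move=> pg; have /and3P[/forallP g0 /forallP gm /forallP st] := pg.
pose dir (q : 'I_(tdim n)) := xchoose (existsP (st q)).
have dirP q l : g (step_tgt q) l = (g (step_src q) l + (l == dir q))%N :> nat.
  by have /forallP/(_ l)/eqP := xchooseP (existsP (st q)).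
have mono l := path_mono l pg.
have lt q : (g (step_src q) (dir q) < n (dir q))%N.
  have := mono (dir q) (step_tgt q) ord_max (leq_ord _).
  by rewrite dirP eqxx addn1 (eqP (gm (dir q))).
have hlt q : (offset n (dir q) + g (step_src q) (dir q) < tdim n)%N.
  by apply: leq_trans (block_end (dir q)); rewrite ltn_add2l.
pose h (q : 'I_(tdim n)) := Ordinal (hlt q).
have hb q : in_block (dir q) (h q) by rewrite /in_block /= leq_addr ltn_add2l lt.
have later (q : 'I_(tdim n)) (t : 'I_(tdim n).+1) : (q < t)%N -> (g (step_src q) (dir q) < g t (dir q))%N.
  move=> qt; apply: (@leq_trans (g (step_tgt q) (dir q))); first by rewrite dirP eqxx addn1.
  by apply: mono; rewrite /= /bump leq0n.
have hinj : injective h.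
  suff H (q q' : 'I_(tdim n)) : h q = h q' -> (q' <= q)%N.
    by move=> q q' E; apply: val_inj; apply/eqP; rewrite eqn_leq !H.
  move=> E; have dE : dir q = dir q' by apply: (in_block_inj (hb q)); rewrite E.
  rewrite leqNgt; apply/negP => /(later q (step_src q')).
  by move/(congr1 val): E => /=; rewrite -dE => /addnI ->; rewrite ltnn.
pose s := ((perm hinj)^-1)%g.
have hs b : h (s b) = b by rewrite -[h _](permE hinj) permKV.
have sdir b l : in_block l b -> dir (s b) = l.
  by move=> bl; apply: (in_block_inj (hb (s b))); rewrite hs.
have sval b l : in_block l b -> g (step_src (s b)) l = (b - offset n l)%N :> nat.
  by move=> bl; rewrite -{2}(hs b) /= (sdir b l bl) addKn.
have slt b l (t : 'I_(tdim n).+1) : in_block l b -> (s b < t)%N = (b < offset n l + g t l)%N.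
  move=> bl; have /andP[lb _] := bl; rewrite -ltn_subLR // -(sval b l bl).
  apply/idP/idP => [|]; first by rewrite -(sdir b l bl); exact: later.
  by apply: contraTT; rewrite -!leqNgt => h'; exact: mono.
exists s.
  apply/forallP => l; apply/forallP => a; apply/forallP => b; apply/implyP => /and3P[al bl ab].
  rewrite -[(s b : nat)]/(step_src (s b) : nat) (slt a l) //.
  by rewrite (sval b l bl) subnKC //; case/andP: bl.
apply/ffunP => t; apply/ffunP => l; apply: val_inj; rewrite /= shuffle_pathE shuffle_compE.
have le : (offset n l + g t l <= tdim n)%N.
  by apply: leq_trans (block_end l); rewrite leq_add2l -ltnS ltn_ord.
rewrite -[RHS](card_interval le); apply: eq_card => b; rewrite !inE.
apply/andP/andP => [[bl]|[lb bt]].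
  by rewrite (slt b l) // => ?; split=> //; case/andP: bl.
have bl : in_block l b.
  by rewrite /in_block lb (leq_trans bt) // leq_add2l -ltnS ltn_ord.
by rewrite (slt b l).
Qed.

Lemma shuffle_pathK g : is_path g -> shuffle_path (path_perm g) = g.
Proof. by case/shuffle_of_path => s sh <-; rewrite path_permK. Qed.

Lemma shuffle_pathP s :
  is_path (shuffle_path s) && (path_perm (shuffle_path s) == s) = shuffle s.
Proof.
apply/andP/idP => [[_ /eqP E]|sh]; last by rewrite path_permK ?shuffle_path_is_path.
by have [s' sh E'] := shuffle_of_path (shuffle_path_is_path s); rewrite -E -E' path_permK.
Qed.

End Shuffles.

Section TableCompletionFactors.
Variables (K : comNzRingType) (r : nat).

(** The occurrences numbered [t] after the operators of a shuffle have acted are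
    those at the vertex of its path at time [t] before; so the sums agree term
    by term. *)
Lemma TC_EZ_basis (x : {m : 'I_r -> nat & Sur r m}) :
  Nmap (tc r) (EZ_basis K x) = TC_basis K x.
Proof.
case: x => m x; rewrite /EZ_basis /TC_basis /= Nmap_sum.
rewrite [RHS](reindex_onto (@shuffle_path r m) (@path_perm r m)); last exact: shuffle_pathK.
rewrite (eq_bigl _ _ (@shuffle_pathP r m)); apply: eq_bigr => s sh.
rewrite path_permK // NmapZ Nmap_sclass.
apply: (congr1 (fun y : BE r (tdim m) => (-1) ^+ s *: sclass K y)).
apply/ffunP => t; rewrite [LHS]ffunE [RHS]ffunE; congr perm_of_seq.
rewrite (vertex_seq_act _ (fun=> t)) /vertex_seq; congr map; apply: eq_filter => p.
by rewrite shuffle_pathE.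
Qed.

Lemma TC_EZ (c : mN K (Sur r)) : TC c = Nmap (tc r) (EZ c).
Proof.
rewrite /EZ /linext Nmap_sum; apply: eq_bigr => x _.
by rewrite NmapZ TC_EZ_basis.
Qed.

End TableCompletionFactors.

Theorem theorem4p4p1 (K : comNzRingType) (R : realType) (r : nat)
    (hr : (1 <= r)%N) :
  (forall c : mN K (Sur r), TC c = Nmap (tc r) (EZ c)) /\
  (forall d : nat, (1 <= d)%N ->
     exists tcd : smap (diag (Surd r d)) (BEd r d),
       (forall (n : nat) (f : diag (Surd r d) n),
          sval (tcd n f) = tc r n (sval f)) /\
       weak_equivalence R tcd).
Proof.
split=> [c|d d0]; first exact: TC_EZ.
by exists (tcd r d0); split=> //; exact: weak_equivalence_tcd.
Qed.
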